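(* For every $C>0$ there exist $b>0$ and $\varepsilon_0>0$ such that for every $\varepsilon\in(0,\varepsilon_0)$ and every solution $u:\mathbb{R}^d\times[0,\infty)\to N$ of the harmonic map heat flow $$\partial_t u-\Delta u=A(u)(\nabla u,\nabla u),\qquad u(\cdot,0)=u_0,$$ with $\|u_0-P\|_{W^{1,\infty}}\le\varepsilon$, where $P\in N$ is an arbitrary point, we have $$\sup_{t\in[0,\exp(\frac{b}{\varepsilon})-1]}\|u(t)-P\|_{C^0}+\sup_{t\in[0,\exp(\frac{b}{\varepsilon})-1]}(1+t)^{\frac12}\|\nabla u(t)\|_{C^0}\le C.$$
   Context: $N$ is a smooth Riemannian manifold isometrically embedded in some Euclidean space $\mathbb{R}^m$. For $\delta>0$ small, $\pi:N_\delta\to N$ is the nearest point projection on $N_\delta=\{x\in\mathbb{R}^m:\operatorname{dist}(x,N)<\delta\}$, and the second fundamental form is $A(y)(v_1,v_2)=-D^2\pi(y)(v_1,v_2)$ for $y\in N$, $v_1,v_2\in T_yN$; $A(u)(\nabla u,\nabla u)=\sum_{k=1}^d A(u)(\partial_k u,\partial_k u)$. $\|\cdot\|_{C^0}$ is the supremum norm over $\mathbb{R}^d$.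
   Formalization: Solutions are taken classical for t>0, continuous up to t=0, with gradient bounded on (0,T] for every T; without such control Tychonoff-type solutions (N a circle, constant initial map) violate the bound. *)

(* Defs.v *)
From HB Require Import structures.
From mathcomp Require Import all_boot all_order all_algebra.
From mathcomp Require Import all_classical all_reals all_analysis.

Set Implicit Arguments.
Unset Strict Implicit.
Unset Printing Implicit Defensive.
Import Order.TTheory GRing.Theory Num.Theory.
Import numFieldNormedType.Exports.

Local Open Scope classical_set_scope.
Local Open Scope ring_scope.

(* The library norm on matrices is the sup norm; distances to a submanifold and
   pointwise norms of gradients need the Euclidean (Frobenius) one, which
   induces the same topology. *)
Definition enorm (R : realType) (p q : nat) (A : 'M[R]_(p, q)) : R :=
  Num.sqrt (\sum_(i < p) \sum_(j < q) A i j ^+ 2).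

Definition basis_vec (R : realType) (d : nat) (k : 'I_d) : 'rV[R]_d :=
  delta_mx 0 k.

Definition partial (R : realType) (d m : nat) (k : 'I_d)
    (f : 'rV[R]_d -> 'rV[R]_m) (x : 'rV[R]_d) : 'rV[R]_m :=
  'D_(basis_vec R k) f x.

(* Row k is the k-th partial derivative. A partial derivative that does not
   exist is 0 (library convention for limits, see [partial_default]). *)
Definition grad (R : realType) (d m : nat) (f : 'rV[R]_d -> 'rV[R]_m)
    (x : 'rV[R]_d) : 'M[R]_(d, m) :=
  \matrix_(k < d, j < m) partial k f x 0 j.

Lemma partial_default (R : realType) (d m : nat) (k : 'I_d)
    (f : 'rV[R]_d -> 'rV[R]_m) (x : 'rV[R]_d) :
  ~ derivable f x (basis_vec R k) -> partial k f x = 0.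
Proof.
move=> nd; rewrite /partial /derive dvgP//.
by apply/matrixP => i j; rewrite [LHS]mxE [RHS]mxE.
Qed.

Definition laplacian (R : realType) (d m : nat) (f : 'rV[R]_d -> 'rV[R]_m)
    (x : 'rV[R]_d) : 'rV[R]_m :=
  \sum_(k < d) partial k (partial k f) x.

(* C^oo on the open set U: all iterated directional derivatives are Frechet
   differentiable on U. *)
Definition smooth_on (R : realType) (V W : normedModType R) (U : set V)
    (f : V -> W) : Prop :=
  forall (vs : seq V) (x : V), U x ->
    differentiable (foldr (fun v (g : V -> W) => 'D_v g) f vs) x.

(* Embedded n-dimensional C^oo submanifold without boundary of R^m: around each
   of its points there is a diffeomorphism Phi : U -> W between open sets, with
   inverse Psi, straightening N to R^n x {0}.  N carries the metric induced by
   the Euclidean one. *)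
Definition smooth_submanifold (R : realType) (m n : nat)
    (N : set 'rV[R]_m) : Prop :=
  (n <= m)%N /\
  forall p, N p ->
    exists (U W : set 'rV[R]_m) (Phi Psi : 'rV[R]_m -> 'rV[R]_m),
      [/\ open_nbhs p U, open W, smooth_on U Phi & smooth_on W Psi] /\
      [/\ forall x, U x -> W (Phi x) /\ Psi (Phi x) = x,
          forall z, W z -> U (Psi z) /\ Phi (Psi z) = z &
          forall x, U x ->
            (N x <-> forall i : 'I_m, (n <= i)%N -> Phi x 0 i = 0)].

Definition edist (R : realType) (m : nat) (x : 'rV[R]_m)
    (N : set 'rV[R]_m) : R :=
  inf [set enorm (x - y) | y in N].

Definition tubular_nbhd (R : realType) (m : nat) (N : set 'rV[R]_m)
    (delta : R) : set 'rV[R]_m :=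
  [set x | edist x N < delta].

(* "delta is small": each point of N_delta has exactly one nearest point pr x
   in N, and pr is smooth on N_delta. *)
Definition nearest_point_projection (R : realType) (m : nat)
    (N : set 'rV[R]_m) (delta : R) (pr : 'rV[R]_m -> 'rV[R]_m) : Prop :=
  (forall x, tubular_nbhd N delta x ->
     N (pr x) /\
     forall y, N y -> y != pr x -> enorm (x - pr x) < enorm (x - y)) /\
  smooth_on (tubular_nbhd N delta) pr.

(* Only used for y in N and v1, v2 tangent to N at y. *)
Definition second_fundamental_form (R : realType) (m : nat)
    (pr : 'rV[R]_m -> 'rV[R]_m) (y v1 v2 : 'rV[R]_m) : 'rV[R]_m :=
  - 'D_v1 ('D_v2 pr) y.

(* u is C^1 in time and C^2 in space on R^d x (0, oo). *)
Definition parabolic_C21 (R : realType) (d m : nat)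
    (u : 'rV[R]_d -> R -> 'rV[R]_m) : Prop :=
  forall z : 'rV[R]_d * R, 0 < z.2 ->
    [/\ derivable (u z.1) z.2 1,
        forall k, derivable (u ^~ z.2) z.1 (basis_vec R k) &
        forall k l, derivable (partial l (u ^~ z.2)) z.1 (basis_vec R k)] /\
    [/\ {for z, continuous (fun z : 'rV[R]_d * R => derive1 (u z.1) z.2)},
        forall k, {for z, continuous
          (fun z : 'rV[R]_d * R => partial k (u ^~ z.2) z.1)} &
        forall k l, {for z, continuous
          (fun z : 'rV[R]_d * R => partial k (partial l (u ^~ z.2)) z.1)}].

Definition C0norm (R : realType) (d p q : nat) (f : 'rV[R]_d -> 'M[R]_(p, q))
    : \bar R :=
  ereal_sup [set (enorm (f x))%:E | x in [set: 'rV[R]_d]].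

(* Classical solutions, continuous up to t = 0 and with gradient bounded
   locally uniformly in time.  Without some such control of the gradient,
   Tychonoff's solutions of the heat equation (as angles, for N a circle)
   provide classical solutions issued from a constant map that do not stay
   close to it. *)
Definition harmonic_map_heat_flow (R : realType) (d m : nat)
    (N : set 'rV[R]_m) (pr : 'rV[R]_m -> 'rV[R]_m)
    (u0 : 'rV[R]_d -> 'rV[R]_m) (u : 'rV[R]_d -> R -> 'rV[R]_m) : Prop :=
  [/\ forall x t, 0 <= t -> N (u x t),
      forall x, u x 0 = u0 x,
      {within [set z : 'rV[R]_d * R | 0 <= z.2],
        continuous (fun z : 'rV[R]_d * R => u z.1 z.2)} &
      parabolic_C21 u] /\
  (forall T : R, exists M : R, forall t, 0 < t <= T ->
     (C0norm (grad (u ^~ t)) <= M%:E)%E) /\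
  (forall x t, 0 < t ->
     derive1 (u x) t - laplacian (u ^~ t) x =
     \sum_(k < d) second_fundamental_form pr (u x t)
                    (partial k (u ^~ t) x) (partial k (u ^~ t) x)).

Section lebesgue_measure_Rd.
Context (R : realType).

Definition cons_pair n (z : measurableTypeR R * n.-tuple (measurableTypeR R)) :=
  [tuple of z.1 :: z.2].

Lemma measurable_cons_pair n : measurable_fun setT (@cons_pair n).
Proof. exact: measurable_cons. Qed.

Definition lebesgue_cons n
    (mu : {measure set (n.-tuple (measurableTypeR R)) -> \bar R}) :=
  pushforward ((@lebesgue_measure R) \x^ mu)%E (@cons_pair n).

Section lebesgue_cons_measure.
Variables (n : nat) (mu : {measure set (n.-tuple (measurableTypeR R)) -> \bar R}).

Let mf := @measurable_cons_pair n.

Let lebesgue_cons0 : lebesgue_cons mu set0 = 0%E.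
Proof. by rewrite /lebesgue_cons /pushforward preimage_set0 measure0. Qed.

Let lebesgue_cons_ge0 A : (0 <= lebesgue_cons mu A)%E.
Proof. exact: measure_ge0. Qed.

Let lebesgue_cons_sigma_additive : semi_sigma_additive (lebesgue_cons mu).
Proof.
move=> F mF tF mUF; rewrite /lebesgue_cons /pushforward preimage_bigcup.
apply: measure_semi_sigma_additive.
- by move=> k; rewrite -[X in measurable X]setTI; exact: mf.
- apply/trivIsetP => /= i j _ _ ij; rewrite -preimage_setI.
  by move/trivIsetP : tF => /(_ _ _ _ _ ij) ->//; rewrite preimage_set0.
- by rewrite -preimage_bigcup -[X in measurable X]setTI; exact: mf.
Qed.

HB.instance Definition _ := isMeasure.Build _ _ _ (lebesgue_cons mu)
  lebesgue_cons0 lebesgue_cons_ge0 lebesgue_cons_sigma_additive.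

End lebesgue_cons_measure.

(* Lebesgue measure on R^n; the library has the product sigma-algebra on
   tuples but not on row vectors. *)
Fixpoint lebesgue_measure_Rn (n : nat) :
    {measure set (n.-tuple (measurableTypeR R)) -> \bar R} :=
  match n with
  | 0 => dirac [tuple]
  | n'.+1 => lebesgue_cons (lebesgue_measure_Rn n')
  end.

End lebesgue_measure_Rd.

Definition row_of_tuple (R : realType) (d : nat)
    (t : d.-tuple (measurableTypeR R)) : 'rV[R]_d :=
  \row_(i < d) (tnth t i : R).

Definition locally_integrable (R : realType) (d : nat)
    (f : 'rV[R]_d -> R) : Prop :=
  forall r : R,
    (lebesgue_measure_Rn R d).-integrable
      [set t | enorm (row_of_tuple t) <= r]
      (fun t => (f (row_of_tuple t))%:E).

Definition test_function (R : realType) (d : nat) (phi : 'rV[R]_d -> R)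
    : Prop :=
  smooth_on setT phi /\
  exists r : R, forall x, r < enorm x -> phi x = 0.

(* g is a distributional gradient of f, with the layout of [grad]. *)
Definition weak_gradient (R : realType) (d m : nat)
    (f : 'rV[R]_d -> 'rV[R]_m) (g : 'rV[R]_d -> 'M[R]_(d, m)) : Prop :=
  [/\ forall j, locally_integrable (fun x => f x 0 j),
      forall k j, locally_integrable (fun x => g x k j) &
      forall (phi : 'rV[R]_d -> R) k j, test_function phi ->
        \int[lebesgue_measure_Rn R d]_t
           (f (row_of_tuple t) 0 j
            * 'D_(basis_vec R k) phi (row_of_tuple t))
        = - \int[lebesgue_measure_Rn R d]_t
              (g (row_of_tuple t) k j * phi (row_of_tuple t))].

Definition Linfty_norm (R : realType) (d p q : nat)
    (f : 'rV[R]_d -> 'M[R]_(p, q)) : \bar R :=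
  Lnorm (lebesgue_measure_Rn R d) +oo%E
    (fun t => (enorm (f (row_of_tuple t)))%:E).

(* The weak gradient is unique almost everywhere, so the infimum ranges over at
   most one value; it is +oo when there is no weak gradient. *)
Definition W1infty_norm (R : realType) (d m : nat)
    (f : 'rV[R]_d -> 'rV[R]_m) : \bar R :=
  ereal_inf [set (Linfty_norm f + Linfty_norm g)%E | g in weak_gradient f].

(* Main.v *)
From HB Require Import structures.
Require Import Defs.
From mathcomp Require Import all_boot all_order all_algebra.
From mathcomp Require Import all_classical all_reals all_analysis.
From mathcomp Require Import measurable_realfun ring lra.
Set Implicit Arguments.
Unset Strict Implicit.
Unset Printing Implicit Defensive.
Import Order.TTheory GRing.Theory Num.Theory.
Import numFieldNormedType.Exports.
Local Open Scope classical_set_scope.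
Local Open Scope ring_scope.

(* Put p = |u - P|^2 and let F be the right-hand side of the flow.  The nearest
   point projection is constant on the normal segments of length delta, hence
   N lies outside the balls of radius delta tangent to it, which bounds the
   second fundamental form: |F| <= |grad u|^2 / delta and, for q in N,
   2 delta^2 |<q - u, F>| <= |q - u|^2 |grad u|^2.  So p is a subsolution of the
   heat equation as long as p <= delta^2, and the maximum principle keeps
   |u - P| below its initial bound for all times.  The gradient is controlled
   through the increments z = |u(. + h) - u|^2, since u has no third derivatives:
   if p <= delta^2 / 64 and lambda = 2 / delta^2, X = z exp (lambda (p + p(. + h))) is a subsolution,
   and for c = exp 1 the function (1 + t) X + c |h|^2 p is one up to o(|h|^2)
   on compact sets, which gives the decay of the gradient as h -> 0.
   This argument is valid for all times, in particular up to exp (b / eps) - 1.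
   The Lipschitz bound on the initial map comes from the weak gradient, tested
   against the convolution of a bump with a segment. *)

(** * Derivatives on the line and the maximum principle *)

(** Comparing the forces at [x + h] and [x] would usually cost a Lipschitz bound on the second
    fundamental form. Here each force is paired separately with the chord [w = u(. + h) - u], whose
    two ends lie on N, so each pairing is already of order |w|^2 |grad u|^2. Let a be the sum of the
    two energies |grad u|^2, at x and x + h. The exponential weight produces the good term - lambda
    z a. Half of it cancels the curvature term z a / delta^2, which forces lambda = 2 / delta^2. The
    other half absorbs the cross term of the two gradients, which requires 16 lambda^2 p <= lambda /
    2, that is p <= delta^2 / 64. The factor c dominates the weight, so X <= c z, which is about c
    |h|^2 |grad u|^2; this is the term produced by differentiating 1 + t, and c |h|^2 p compensates
    it. That comparison is uniform only on compact sets of positive times, while space is unbounded.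
    Hence the maximum principle carries a slack eta, paid by the barrier eta (|x|^2 + (2 d + 1) (t -
    t0)), and is used with eta proportional to |h|^2. *)

Lemma is_deriveP (R : realType) (V W : normedModType R) (f : V -> W) (x v : V) (l : W) :
  is_derive x v f l <-> derivable f x v /\ 'D_v f x = l.
Proof. by split=> [[]//|[h <-]]; exact: derivableP. Qed.

Lemma is_derive_unique (R : realType) (V W : normedModType R) (f : V -> W) (x v : V)
    (l l' : W) : is_derive x v f l -> is_derive x v f l' -> l = l'.
Proof. by move=> /is_deriveP[_ <-] /is_deriveP[_ <-]. Qed.

Lemma is_derive_translate (R : realType) (f : R -> R) (a l : R) :
  is_derive (0 : R) 1 (fun s => f (a + s)) l -> is_derive a 1 f l.
Proof.
move=> h.
have -> : f = (fun s => f (a + s)) \o shift (- a).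
  by apply/funext => y /=; congr f; lra.
rewrite -[l]mulr1.
apply: is_derive1_comp; last exact: is_derive_shift.
by rewrite /= subrr.
Qed.

Lemma derive_eq0_at_max (R : realType) (f : R -> R) (e l : R) :
  0 < e -> (forall s : R, is_derive s 1 f (derive1 f s)) -> is_derive (0 : R) 1 f l ->
  (forall s, `|s| < e -> f s <= f 0) -> l = 0.
Proof.
move=> e0 df dl max0.
have := @derive1_at_max R f (- e) e 0.
have -> : - e <= e by lra.
move=> /(_ isT) h.
have : is_derive (0 : R) 1 f 0.
  apply: h.
  - by move=> t _; by have /is_deriveP[] := df t.
  - by rewrite in_itv /=; lra.
  - by move=> t; rewrite in_itv /= => /andP[a b]; apply: max0; rewrite ltr_norml a b.
by move=> h0; exact: is_derive_unique dl h0.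
Qed.

(** The second derivative is assumed at the single point 0. If c were positive, f1 would be positive
    just to the right of 0, and the mean value theorem would make f increase there. *)
Lemma second_derive_test (R : realType) (f f1 : R -> R) (c : R) :
  (forall s : R, is_derive s 1 f (f1 s)) -> is_derive (0 : R) 1 f1 c ->
  (exists2 e : R, 0 < e & forall s, `|s| < e -> f s <= f 0) ->
  f1 0 = 0 /\ c <= 0.
Proof.
move=> df dc [e e0 max0].
have f10 : f1 0 = 0.
  apply: (derive_eq0_at_max e0 _ (df 0) max0).
  by move=> s; rewrite derive1E; have /is_deriveP[_ ->] := df s; exact: df.
split => //; rewrite leNgt; apply/negP => c0.
have [_ dv] : _ /\ 'D_1 f1 0 = c := (is_deriveP _ _ _ _).1 dc.
have /cvg_ex[l lP] : derivable f1 0 1 by have /is_deriveP[] := dc.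
have lc : l = c by rewrite -dv /derive; apply/esym/cvg_lim.
move: lP; rewrite lc => /cvgrPdist_lt/(_ c c0).
rewrite near_withinE /=; case/nbhs_ballP => e' /= e'0 he'.
pose s := Num.min e e' / 2.
have m0 : 0 < Num.min e e' by rewrite lt_min e0 e'0.
have s0 : 0 < s by rewrite divr_gt0.
have me : Num.min e e' <= e by rewrite ge_min lexx.
have me' : Num.min e e' <= e' by rewrite ge_min lexx orbT.
have [th] := MVT s0 (fun x _ => df x) (derivable_within_continuous
   (fun x _ => ((is_deriveP _ _ _ _).1 (df x)).1)).
rewrite in_itv /= => /andP[th0 ths] fs.
have hs : f s <= f 0 by apply: max0; rewrite gtr0_norm /s; lra.
have th1 : 0 < f1 th.
  have := he' th; rewrite /ball /= sub0r normrN gtr0_norm //.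
  have -> : th < e' by rewrite (lt_trans ths) // /s; lra.
  move=> /(_ isT); rewrite gt_eqF // => /(_ isT).
  rewrite f10 subr0 addr0 /GRing.scale /= mulr1 ltr_norml => /andP[_ h].
  have : 0 < th^-1 * f1 th by lra.
  by rewrite pmulr_rgt0 // invr_gt0.
by move: hs; rewrite -subr_le0 fs subr0 leNgt mulr_gt0.
Qed.

(** One-sided, for the time direction: a maximum over a space-time cylinder may sit at its final
    time, where only earlier times are compared. *)
Lemma derive_ge0_at_left_max (R : realType) (f : R -> R) (a e l : R) :
  0 < e -> is_derive a 1 f l -> (forall s, a - e < s <= a -> f s <= f a) -> 0 <= l.
Proof.
move=> e0 /is_deriveP[/cvg_ex[l' lP] dl] max; rewrite leNgt; apply/negP => l0.
have ll : l' = l by rewrite -dl /derive; apply/esym/cvg_lim.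
move: lP; rewrite ll => /cvgrPdist_lt/(_ (- l)).
rewrite oppr_gt0 => /(_ l0).
rewrite near_withinE /=; case/nbhs_ballP => e' /= e'0 he'.
pose s := Num.min e e' / 2.
have m0 : 0 < Num.min e e' by rewrite lt_min e0 e'0.
have s0 : 0 < s by rewrite divr_gt0.
have me : Num.min e e' <= e by rewrite ge_min lexx.
have me' : Num.min e e' <= e' by rewrite ge_min lexx orbT.
have := he' (- s); rewrite /ball /= sub0r opprK gtr0_norm //.
have -> : s < e' by rewrite /s; lra.
move=> /(_ isT); rewrite oppr_eq0 gt_eqF // => /(_ isT).
rewrite /GRing.scale /= mulr1 ltr_norml => /andP[h _].
have h1 : (- s)^-1 * (f (- s + a) - f a) < 0 by lra.
have h2 : f (- s + a) <= f a by apply: max; rewrite /s; lra.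
move: h1; rewrite invrN mulNr oppr_lt0 pmulr_rgt0 ?invr_gt0 //; lra.
Qed.

Lemma cvg_sumr (R : realType) (T : Type) (F : set_system T) {FF : Filter F} (I : Type)
    (r : seq I) (f : I -> T -> R) (l : I -> R) :
  (forall i, f i @ F --> l i) ->
  (fun z => \sum_(i <- r) f i z) @ F --> \sum_(i <- r) l i.
Proof.
move=> fl; elim: r => [|i r IH].
  rewrite big_nil; under eq_fun do rewrite big_nil; exact: cvg_cst.
by rewrite big_cons; under eq_fun do rewrite big_cons; exact: cvgD.
Qed.

Lemma is_derive_sumr (R : realType) (n : nat) (f : 'I_n -> R -> R) (y : R) (l : 'I_n -> R) :
  (forall i, is_derive y 1 (f i) (l i)) ->
  is_derive y 1 (fun s => \sum_(i < n) f i s) (\sum_(i < n) l i).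
Proof. by move=> df; have := is_derive_sum df; rewrite fct_sumE. Qed.

(* [jv], together with its time derivative [jt] and its pure first and second
   space derivatives [jg k] and [jgg k] along the k-th axis. *)
Record jet (R : realType) (d : nat) := Jet {
  jv : 'rV[R]_d -> R -> R;
  jt : 'rV[R]_d -> R -> R;
  jg : 'I_d -> 'rV[R]_d -> R -> R;
  jgg : 'I_d -> 'rV[R]_d -> R -> R }.

(** What the maximum principle consumes: continuity of the value at all times, for the extreme value
    theorem on compact sets that may touch t = 0, and pointwise pure derivatives at positive times,
    without continuity of these derivatives. *)
Definition is_jet (R : realType) (d : nat) (j : jet R d) : Prop :=
  continuous (fun z : 'rV[R]_d * R => jv j z.1 z.2) /\
  forall x (t : R), 0 < t -> is_derive t 1 (jv j x) (jt j x t) /\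
    forall k,
      is_derive (0 : R) 1 (fun s => jv j (x + s *: basis_vec R k) t) (jg j k x t) /\
      is_derive (0 : R) 1 (fun s => jg j k (x + s *: basis_vec R k) t) (jgg j k x t).

Definition heat (R : realType) (d : nat) (j : jet R d) (x : 'rV[R]_d) (t : R) : R :=
  jt j x t - \sum_(k < d) jgg j k x t.

Definition jadd (R : realType) (d : nat) (a b : jet R d) : jet R d :=
  Jet (fun x t => jv a x t + jv b x t) (fun x t => jt a x t + jt b x t)
    (fun k x t => jg a k x t + jg b k x t) (fun k x t => jgg a k x t + jgg b k x t).

Definition jmul (R : realType) (d : nat) (a b : jet R d) : jet R d :=
  Jet (fun x t => jv a x t * jv b x t)
    (fun x t => jt a x t * jv b x t + jv a x t * jt b x t)
    (fun k x t => jg a k x t * jv b x t + jv a x t * jg b k x t)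
    (fun k x t => jgg a k x t * jv b x t + 2 * jg a k x t * jg b k x t
                  + jv a x t * jgg b k x t).

Definition jexp (R : realType) (d : nat) (a : jet R d) : jet R d :=
  Jet (fun x t => expR (jv a x t)) (fun x t => jt a x t * expR (jv a x t))
    (fun k x t => jg a k x t * expR (jv a x t))
    (fun k x t => (jgg a k x t + jg a k x t ^+ 2) * expR (jv a x t)).

Definition jtime (R : realType) (d : nat) (a b : R) : jet R d :=
  Jet (fun _ t => a + b * t) (fun _ _ => b) (fun _ _ _ => 0) (fun _ _ _ => 0).

Definition jtrans (R : realType) (d : nat) (h : 'rV[R]_d) (a : jet R d) : jet R d :=
  Jet (fun x t => jv a (x + h) t) (fun x t => jt a (x + h) t)
    (fun k x t => jg a k (x + h) t) (fun k x t => jgg a k (x + h) t).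

Definition jsqnorm (R : realType) (d m : nat) (a : 'I_m -> jet R d) : jet R d :=
  Jet (fun x t => \sum_(i < m) jv (a i) x t ^+ 2)
    (fun x t => \sum_(i < m) 2 * jv (a i) x t * jt (a i) x t)
    (fun k x t => \sum_(i < m) 2 * jv (a i) x t * jg (a i) k x t)
    (fun k x t => \sum_(i < m) (2 * jg (a i) k x t ^+ 2 + 2 * jv (a i) x t * jgg (a i) k x t)).

Definition jquad (R : realType) (d : nat) : jet R d :=
  Jet (fun x _ => \sum_(i < d) x 0 i ^+ 2) (fun _ _ => 0)
    (fun k x _ => 2 * x 0 k) (fun _ _ _ => 2).

Lemma is_jet_add (R : realType) (d : nat) (a b : jet R d) :
  is_jet a -> is_jet b -> is_jet (jadd a b).
Proof.
move=> [ca da] [cb db]; split => [z|x t t0] /=; first exact: cvgD (ca z) (cb z).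
have [[ta ka] [tb kb]] := (da x t t0, db x t t0); split => [|k].
  exact: is_deriveD.
have [[? ?] [? ?]] := (ka k, kb k).
by split; apply: is_deriveD.
Qed.

Lemma is_jet_mul (R : realType) (d : nat) (a b : jet R d) :
  is_jet a -> is_jet b -> is_jet (jmul a b).
Proof.
move=> [ca da] [cb db]; split => [z|x t t0] /=; first exact: cvgM (ca z) (cb z).
have [[ta ka] [tb kb]] := (da x t t0, db x t t0); split => [|k].
  by apply: is_derive_eq; rewrite /GRing.scale /=; ring.
have [[? ?] [? ?]] := (ka k, kb k).
split; apply: is_derive_eq; rewrite ?(scale0r, addr0) /GRing.scale /=; ring.
Qed.

Lemma is_jet_exp (R : realType) (d : nat) (a : jet R d) :
  is_jet a -> is_jet (jexp a).
Proof.
move=> [ca da]; split => [z|x t t0] /=.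
  by apply: continuous_comp; [exact: ca|exact: continuous_expR].
have [ta ka] := da x t t0.
have ex (f : R -> R) (y l : R) : is_derive y 1 f l ->
  is_derive y 1 (fun s => expR (f s)) (l * expR (f y)).
  by move=> df; rewrite mulrC; apply: is_derive1_comp.
split => [|k]; first exact: ex.
have [h1 h2] := ka k; have := ex _ _ _ h1; rewrite scale0r addr0 => h3; split => //.
by apply: is_derive_eq; rewrite ?(scale0r, addr0) /GRing.scale /=; ring.
Qed.

Lemma is_jet_time (R : realType) (d : nat) (a b : R) : is_jet (@jtime R d a b).
Proof.
split => [z|x t t0] /=.
  by apply: cvgD; [exact: cvg_cst|apply: cvgM; [exact: cvg_cst|exact: cvg_snd]].
split=> [|k]; last by split; exact: is_derive_cst.
by apply: is_derive_eq; rewrite /GRing.scale /=; ring.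
Qed.

Lemma is_jet_trans (R : realType) (d : nat) (h : 'rV[R]_d) (a : jet R d) :
  is_jet a -> is_jet (jtrans h a).
Proof.
move=> [ca da]; split => [z|x t t0] /=.
  apply: (@continuous2_cvg _ _ _ _ (nbhs z) _ (fun z => z.1 + h) snd (jv a) (z.1 + h) z.2
    (ca (z.1 + h, z.2))); last exact: cvg_snd.
  by apply: cvgD; [exact: cvg_fst|exact: cvg_cst].
have [ta ka] := da (x + h) t t0; split => // k.
have [h1 h2] := ka k.
by split; (under eq_fun do rewrite addrAC).
Qed.

Lemma is_jet_sqnorm (R : realType) (d m : nat) (a : 'I_m -> jet R d) :
  (forall i, is_jet (a i)) -> is_jet (jsqnorm a).
Proof.
move=> ja; split => [z|x t t0] /=.
  by apply: cvg_sumr => i; apply: cvgM; exact: (ja i).1.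
split => [|k].
  apply: is_derive_sumr => i; have [h _] := (ja i).2 x t t0.
  by apply: is_derive_eq; rewrite /GRing.scale /= ?expr1; ring.
split; apply: is_derive_sumr => i; have [h1 h2] := ((ja i).2 x t t0).2 k;
 by apply: is_derive_eq; rewrite ?(scale0r, addr0) /GRing.scale /= ?expr1; ring.
Qed.

Lemma is_jet_quad (R : realType) (d : nat) : is_jet (@jquad R d).
Proof.
split => [z|x t t0] /=.
  apply: cvg_sumr => i.
  have c : (fun z : 'rV[R]_d * R => z.1 0 i) @ z --> z.1 0 i.
    apply: (@continuous_comp _ _ _ fst (fun v : 'rV[R]_d => v 0 i)); first exact: cvg_fst.
    exact: coord_continuous.
  exact: cvgM.
split => [|k]; first exact: is_derive_cst.
have dc (i : 'I_d) : is_derive (0 : R) 1 (fun s : R => (x + s *: basis_vec R k) 0 i) (i == k)%:R.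
  have -> : (fun s : R => (x + s *: basis_vec R k) 0 i) = (fun s => x 0 i + s * (i == k)%:R).
    by apply/funext => s; rewrite !mxE eqxx.
  by apply: is_derive_eq; rewrite /GRing.scale /=; ring.
split.
  have -> : 2 * x 0 k = \sum_(i < d) 2 * x 0 i * (i == k)%:R.
    rewrite (bigD1 k) //= eqxx mulr1 big1 ?addr0 // => i /negPf ->.
    by rewrite mulr0.
  apply: is_derive_sumr => i; have h := dc i.
  by apply: is_derive_eq; rewrite ?(scale0r, addr0) /GRing.scale /= ?expr1; ring.
have h := dc k.
by apply: is_derive_eq; rewrite /GRing.scale /= eqxx mulr1.
Qed.

(** Subtracting the barrier [eta * (|x|^2 + (2 d + 1) (t - t0))] lowers the heat operator by exactly
    eta, because the Laplacian of |x|^2 is 2 d. The difference therefore has a negative heat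
    operator on the cube, whereas at a maximum above B the time derivative is nonnegative and the
    second space derivatives are nonpositive. *)
Lemma heat_max (R : realType) (d : nat) (j : jet R d) (B eta T t0 r : R) :
  is_jet j -> 0 <= t0 -> 0 < eta ->
  (forall x : 'rV[R]_d, jv j x t0 <= B) ->
  (forall (x : 'rV[R]_d) (t : R), t0 <= t <= T -> (exists i, r < `|x 0 i|) ->
     jv j x t <= B + eta * \sum_(i < d) x 0 i ^+ 2) ->
  (forall (x : 'rV[R]_d) (t : R), t0 < t <= T -> (forall i, `|x 0 i| <= r) -> heat j x t < eta) ->
  forall (x : 'rV[R]_d) (t : R), t0 <= t <= T ->
  jv j x t <= B + eta * (\sum_(i < d) x 0 i ^+ 2 + (2 * d%:R + 1) * (t - t0)).
Proof.
move=> jj t00 eta0 init far near x1 t1 t1T.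
rewrite leNgt; apply/negP => x1B.
pose W := jadd j (jadd (jmul (jtime d (- eta) 0) (@jquad R d))
  (jtime d (eta * (2 * d%:R + 1) * t0) (- (eta * (2 * d%:R + 1))))).
have jW : is_jet W.
  apply: is_jet_add => //; apply: is_jet_add; last exact: is_jet_time.
  by apply: is_jet_mul; [exact: is_jet_time|exact: is_jet_quad].
have WE (x : 'rV[R]_d) (t : R) : jv W x t =
    jv j x t - eta * (\sum_(i < d) x 0 i ^+ 2 + (2 * d%:R + 1) * (t - t0)).
  by rewrite /=; ring.
have W1 : B < jv W x1 t1 by rewrite WE; lra.
have d0 : 0 <= eta * (2 * d%:R + 1) by apply: mulr_ge0; rewrite ?ltW // addr_ge0.
have big (x : 'rV[R]_d) (t : R) : t0 <= t <= T -> B < jv W x t -> t0 < t /\ forall i, `|x 0 i| <= r.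
  move=> /andP[t0t tT] WB.
  have tt : t0 < t.
    rewrite lt_neqAle t0t andbT; apply/eqP => tE; move: WB; rewrite ltNge WE -tE.
    have : 0 <= eta * \sum_(i < d) x 0 i ^+ 2.
      by apply: mulr_ge0; [exact: ltW|apply: sumr_ge0 => i _; exact: sqr_ge0].
    by have := init x; lra.
  split => // i; rewrite leNgt; apply/negP => ri.
  have := far x t; rewrite t0t tT => /(_ isT (ex_intro _ i ri)).
  have : 0 <= eta * (2 * d%:R + 1) * (t - t0) by apply: mulr_ge0 => //; lra.
  by move: WB; rewrite WE; lra.
(* The cube is enlarged by 1: values above B occur only in the cube of half-side r, so the maximum
   point has neighbours in K at distance up to 1 along each axis. *)
pose K := [set x : 'rV[R]_d | forall i, `[- (r + 1), r + 1]%classic (x ord0 i)] `*` `[t0, T]%classic.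
have Kc : compact K.
  apply: (@compact_setX 'rV[R]_d R); last exact: segment_compact.
  by apply: (@rV_compact R d (fun=> _)) => i; exact: segment_compact.
have inK (x : 'rV[R]_d) (t : R) : t0 <= t <= T -> (forall i, `|x 0 i| <= r + 1) -> K (x, t).
  by move=> h1 h2; split; rewrite /= ?in_itv //= => i; rewrite in_itv /= -ler_norml.
have K1 : K (x1, t1).
  by apply: inK => // i; have [_ /(_ i)] := big _ _ t1T W1; lra.
have [[x t] xtK max] := @compact_EVT_max _ R (fun z : 'rV[R]_d * R => jv W z.1 z.2) K
  (ex_intro _ _ K1) Kc (continuous_subspaceT jW.1).
have Wxt : B < jv W x t.
  by apply: (lt_le_trans W1); apply: (max (x1, t1)); rewrite inE.
have [tT xr] : t0 <= t <= T /\ (forall i, `|x 0 i| <= r + 1).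
  move: xtK; rewrite inE => -[/= h1]; rewrite /= in_itv /= => h2; split => // i.
  by have := h1 i; rewrite /= in_itv /= -ler_norml.
have [t0t xi] := big _ _ tT Wxt.
have tpos : 0 < t by lra.
have [dt dx] := jW.2 x t tpos.
have tt0 : 0 < t - t0 by lra.
have Wt0 : 0 <= jt W x t.
  apply: (derive_ge0_at_left_max tt0 dt) => s st.
  by apply: (max (x, s)); rewrite inE; apply: inK => //; lra.
have Wkk k : jgg W k x t <= 0.
  have dW (s : R) : is_derive s 1 (fun s => jv W (x + s *: basis_vec R k) t)
      (jg W k (x + s *: basis_vec R k) t).
    apply: is_derive_translate.
    have [_ /(_ k)[h _]] := jW.2 (x + s *: basis_vec R k) t tpos.
    by under eq_fun do rewrite scalerDl addrA.
  apply: (second_derive_test dW (dx k).2 _).2.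
  exists 1 => // s s1; rewrite scale0r addr0.
  apply: (max (_, t)); rewrite inE; apply: inK => // i.
  rewrite !mxE /= (le_trans (ler_normD _ _)) // lerD // normrM.
  case: (i == k); last by rewrite normr0 mulr0.
  by rewrite normr1 mulr1 ltW.
have hW : 0 <= heat W x t.
  by rewrite subr_ge0 (le_trans _ Wt0) // sumr_le0.
have := near x t; rewrite t0t (andP tT).2 => /(_ isT xi).
suff : heat W x t = heat j x t - eta by lra.
rewrite /heat /=.
under [X in _ - X = _]eq_bigr => k _.
  rewrite [X in jgg j k x t + X](_ : _ = - (2 * eta)); last by ring.
  over.
rewrite big_split /= sumr_const card_ord -mulr_natr; ring.
Qed.

(** * The geometry of the nearest point projection *)

Definition dot (R : realType) (m : nat) (a b : 'rV[R]_m) : R :=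
  \sum_(i < m) a 0 i * b 0 i.

Lemma dotC (R : realType) (m : nat) (a b : 'rV[R]_m) : dot a b = dot b a.
Proof. by apply: eq_bigr => i _; rewrite mulrC. Qed.

Lemma dotDl (R : realType) (m : nat) (a b c : 'rV[R]_m) : dot (a + b) c = dot a c + dot b c.
Proof. by rewrite -big_split /=; apply: eq_bigr => i _; rewrite mxE mulrDl. Qed.

Lemma dotZl (R : realType) (m : nat) (k : R) (a c : 'rV[R]_m) : dot (k *: a) c = k * dot a c.
Proof. by rewrite mulr_sumr; apply: eq_bigr => i _; rewrite mxE mulrA. Qed.

Lemma dotNl (R : realType) (m : nat) (a c : 'rV[R]_m) : dot (- a) c = - dot a c.
Proof. by rewrite -scaleN1r dotZl mulN1r. Qed.

Lemma dotDr (R : realType) (m : nat) (a b c : 'rV[R]_m) : dot c (a + b) = dot c a + dot c b.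
Proof. by rewrite dotC dotDl !(dotC c). Qed.

Lemma dotZr (R : realType) (m : nat) (k : R) (a c : 'rV[R]_m) : dot c (k *: a) = k * dot c a.
Proof. by rewrite dotC dotZl dotC. Qed.

Lemma dotNr (R : realType) (m : nat) (a c : 'rV[R]_m) : dot c (- a) = - dot c a.
Proof. by rewrite dotC dotNl dotC. Qed.

Definition dotE := (dotDl, dotDr, dotNl, dotNr, dotZl, dotZr).

Lemma dot_ge0 (R : realType) (m : nat) (a : 'rV[R]_m) : 0 <= dot a a.
Proof. by apply: sumr_ge0 => i _; rewrite -expr2 sqr_ge0. Qed.

Lemma dot_eq0 (R : realType) (m : nat) (a : 'rV[R]_m) : dot a a = 0 -> a = 0.
Proof.
move=> h; apply/rowP => i; rewrite mxE; apply/eqP; rewrite -sqrf_eq0 expr2.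
have /psumr_eq0P : forall i : 'I_m, true -> 0 <= a 0 i * a 0 i.
  by move=> k _; rewrite -expr2 sqr_ge0.
by move=> /(_ h i isT) ->.
Qed.

Lemma sqr_enorm (R : realType) (m : nat) (a : 'rV[R]_m) : enorm a ^+ 2 = dot a a.
Proof.
rewrite sqr_sqrtr; last by do 2 (apply: sumr_ge0 => ? _); exact: sqr_ge0.
by rewrite big_ord1; apply: eq_bigr => i _; rewrite expr2.
Qed.

Lemma enorm_ge0 (R : realType) (p q : nat) (a : 'M[R]_(p, q)) : 0 <= enorm a.
Proof. exact: sqrtr_ge0. Qed.

Lemma enorm_eq0 (R : realType) (m : nat) (a : 'rV[R]_m) : enorm a = 0 -> a = 0.
Proof. by move=> h; apply: dot_eq0; rewrite -sqr_enorm h expr0n. Qed.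

Lemma enormN (R : realType) (m : nat) (a : 'rV[R]_m) : enorm (- a) = enorm a.
Proof.
by apply/eqP; rewrite -(@eqrXn2 _ 2) ?enorm_ge0// !sqr_enorm !dotE opprK.
Qed.

Lemma enormZ (R : realType) (m : nat) (k : R) (a : 'rV[R]_m) : enorm (k *: a) = `|k| * enorm a.
Proof.
apply/eqP; rewrite -(@eqrXn2 _ 2) ?enorm_ge0 ?mulr_ge0 ?enorm_ge0//.
by rewrite exprMn !sqr_enorm !dotE real_normK ?num_real// expr2 mulrA.
Qed.

Lemma dot_le (R : realType) (m : nat) (a b : 'rV[R]_m) : dot a b <= enorm a * enorm b.
Proof.
have [b0|b0] := eqVneq (enorm b) 0.
  by rewrite b0 mulr0 (enorm_eq0 b0) /dot big1 // => i _; rewrite mxE mulr0.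
have [a0|a0] := eqVneq (enorm a) 0.
  by rewrite a0 mul0r (enorm_eq0 a0) /dot big1 // => i _; rewrite mxE mul0r.
have ap : 0 < enorm a by rewrite lt_neqAle eq_sym a0 enorm_ge0.
have bp : 0 < enorm b by rewrite lt_neqAle eq_sym b0 enorm_ge0.
have := dot_ge0 (enorm b *: a - enorm a *: b).
rewrite !dotE (dotC b a) -!sqr_enorm => h.
have : 0 <= 2 * (enorm a * enorm b) * (enorm a * enorm b - dot a b) by nra.
by rewrite pmulr_rge0 ?subr_ge0 // !mulr_gt0.
Qed.

Lemma enormD (R : realType) (m : nat) (a b : 'rV[R]_m) : enorm (a + b) <= enorm a + enorm b.
Proof.
rewrite -(@ler_pXn2r _ 2) ?nnegrE ?addr_ge0 ?enorm_ge0//.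
have := dot_le a b; rewrite sqr_enorm !dotE (dotC b a) -!sqr_enorm; nra.
Qed.

Lemma coord_le_enorm (R : realType) (m : nat) (a : 'rV[R]_m) i : `|a 0 i| <= enorm a.
Proof.
rewrite -(@ler_pXn2r _ 2) ?nnegrE ?enorm_ge0// sqr_enorm real_normK ?num_real//.
rewrite /dot (bigD1 i) //= -expr2 lerDl; apply: sumr_ge0 => j _.
by rewrite -expr2 sqr_ge0.
Qed.

Lemma derive_chain (R : realType) (m p : nat) (f : 'rV[R]_m -> 'rV[R]_p) (c : R -> 'rV[R]_m)
    (s : R) (v : 'rV[R]_m) :
  differentiable f (c s) -> is_derive s 1 c v -> is_derive s 1 (f \o c) ('D_v f (c s)).
Proof.
move=> df dc.
have /is_deriveP[dc' vE] := dc.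
have dcs : differentiable c s by apply/derivable1_diffP.
have dfc : differentiable (f \o c) s by exact: differentiable_comp.
apply/is_deriveP; split; first exact/derivable1_diffP.
by rewrite deriveE // diff_comp // /= -(deriveE _ dcs) vE deriveE.
Qed.

Lemma is_derive_coordP (R : realType) (m : nat) (c : R -> 'rV[R]_m) (s : R) (v : 'rV[R]_m) :
  is_derive s 1 c v <-> forall i, is_derive s 1 (fun t => c t 0 i) (v 0 i).
Proof.
split=> [/is_deriveP[dc <-] i|h].
  rewrite derive_mx // mxE; apply/is_deriveP; split => //.
  by move/derivable_mxP : dc; apply.
have dc : derivable c s 1.
  by apply/derivable_mxP => i j; rewrite ord1; have /is_deriveP[] := h j.
apply/is_deriveP; split => //; rewrite derive_mx //.
apply/rowP => j; rewrite mxE; by have /is_deriveP[] := h j.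
Qed.

Lemma is_derive_line (R : realType) (m : nat) (z v : 'rV[R]_m) (s : R) :
  is_derive s 1 (fun t : R => z + t *: v) v.
Proof.
apply/is_derive_coordP => i; under eq_fun do rewrite mxE mxE.
by apply: is_derive_eq; rewrite /GRing.scale /=; ring.
Qed.

Lemma derive_line (R : realType) (m p : nat) (f : 'rV[R]_m -> 'rV[R]_p)
    (z v : 'rV[R]_m) (s : R) :
  differentiable f (z + s *: v) ->
  forall i, is_derive s 1 (fun t => f (z + t *: v) 0 i) ('D_v f (z + s *: v) 0 i).
Proof.
move=> df; apply/is_derive_coordP.
exact: (@derive_chain _ _ _ f (fun t : R => z + t *: v)  s v df (is_derive_line _ _ _)).
Qed.

(** Along a normal segment the projection is known to be constant on one side only. As the two-sided
    derivative exists, the left maximum test applied to f and - f, both reflected, suffices. *)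
Lemma derive_eq0_right_cst (R : realType) (f : R -> R) (l : R) :
  is_derive (0 : R) 1 f l -> (forall s, 0 <= s <= 1 -> f s = f 0) -> l = 0.
Proof.
move=> df cf.
have dg : is_derive (0 : R) 1 (fun s => f (- s)) (- l).
  have -> : - l = l * -1 by ring.
  by apply: is_derive1_comp; rewrite oppr0.
have dh : is_derive (0 : R) 1 (fun s => - f (- s)) l.
  by rewrite -[l in is_derive _ _ _ l]opprK; exact: is_deriveN.
apply: le_anti; rewrite -oppr_ge0; apply/andP; split.
  by apply: (derive_ge0_at_left_max ltr01 dg) => s s1; rewrite oppr0 cf //; lra.
by apply: (derive_ge0_at_left_max ltr01 dh) => s s1; rewrite oppr0 cf //; lra.
Qed.

Lemma derive_eq0_local_min (R : realType) (f : R -> R) (e l : R) : 0 < e ->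
  is_derive (0 : R) 1 f l -> (forall s, `|s| < e -> f 0 <= f s) -> l = 0.
Proof.
move=> e0 df cf.
have dg : is_derive (0 : R) 1 (fun s => - f (- s)) l.
  rewrite -[l in is_derive _ _ _ l]opprK; apply: is_deriveN.
  have -> : - l = l * -1 by ring.
  by apply: is_derive1_comp; rewrite oppr0.
apply: le_anti; apply/andP; split; last first.
  apply: (derive_ge0_at_left_max e0 dg) => s s1; rewrite oppr0 lerN2 cf //.
  by rewrite ltr_norml; lra.
rewrite -oppr_ge0; apply: (derive_ge0_at_left_max e0 (is_deriveN df)) => s s1.
by rewrite lerN2 cf // ltr_norml; lra.
Qed.

Lemma mem_tubular (R : realType) (m : nat) (N : set 'rV[R]_m) (delta : R) (z q : 'rV[R]_m) :
  N q -> enorm (z - q) < delta -> tubular_nbhd N delta z.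
Proof.
move=> Nq; apply: le_lt_trans; apply: ge_inf; last by exists q.
by exists 0 => _ [y _ <-]; exact: enorm_ge0.
Qed.

Lemma proj_min (R : realType) (m : nat) (N : set 'rV[R]_m) (delta : R)
    (pr : 'rV[R]_m -> 'rV[R]_m) (z q : 'rV[R]_m) :
  nearest_point_projection N delta pr -> tubular_nbhd N delta z -> N q ->
  enorm (z - pr z) <= enorm (z - q).
Proof.
move=> [np _] /np[_ h] Nq; have [->//|qz] := eqVneq q (pr z).
by rewrite ltW // h.
Qed.

Lemma proj_dist (R : realType) (m : nat) (N : set 'rV[R]_m) (delta : R)
    (pr : 'rV[R]_m -> 'rV[R]_m) (z : 'rV[R]_m) :
  nearest_point_projection N delta pr -> tubular_nbhd N delta z -> enorm (z - pr z) < delta.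
Proof.
move=> np tz; have [Npz _] := np.1 _ tz.
have hi : has_inf [set enorm (z - y) | y in N].
  split; first by exists (enorm (z - pr z)), (pr z).
  by exists 0 => _ [y _ <-]; exact: enorm_ge0.
have := tz; rewrite /tubular_nbhd /= -subr_gt0 => /inf_adherent/(_ hi)[_ [q Nq <-]].
rewrite -/(Defs.edist z N) subrKC; exact: le_lt_trans (proj_min np tz Nq).
Qed.

Lemma proj_id (R : realType) (m : nat) (N : set 'rV[R]_m) (delta : R)
    (pr : 'rV[R]_m -> 'rV[R]_m) (y : 'rV[R]_m) :
  0 < delta -> nearest_point_projection N delta pr -> N y ->
  tubular_nbhd N delta y /\ pr y = y.
Proof.
move=> d0 np Ny.
have ty : tubular_nbhd N delta y.
  by apply: (mem_tubular Ny); rewrite subrr -(scale0r 0) enormZ normr0 mul0r.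
split => //; apply/esym/eqP; rewrite -subr_eq0; apply/eqP/enorm_eq0/le_anti.
rewrite enorm_ge0 andbT (le_trans (proj_min np ty Ny)) //.
by rewrite subrr -(scale0r 0) enormZ normr0 mul0r.
Qed.

(** Another nearest point of z' would be strictly closer to z' than [pr z], and by the triangle
    inequality through z' strictly closer to z than [pr z]. *)
Lemma proj_segment (R : realType) (m : nat) (N : set 'rV[R]_m) (delta : R)
    (pr : 'rV[R]_m -> 'rV[R]_m) (z : 'rV[R]_m) (s : R) :
  nearest_point_projection N delta pr -> tubular_nbhd N delta z -> 0 <= s <= 1 ->
  pr (z + s *: (pr z - z)) = pr z.
Proof.
move=> np tz /andP[s0 s1]; set z' := z + _.
have [Npz _] := np.1 _ tz.
have z'p : enorm (z' - pr z) = (1 - s) * enorm (z - pr z).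
  rewrite -[in RHS](@ger0_norm _ (1 - s)) ?subr_ge0 // -enormZ; congr enorm.
  by apply/rowP => i; rewrite !mxE; ring.
have zz' : enorm (z - z') = s * enorm (z - pr z).
  rewrite -[in RHS](@ger0_norm _ s) // -enormZ; congr enorm.
  by apply/rowP => i; rewrite !mxE; ring.
have tz' : tubular_nbhd N delta z'.
  apply: (mem_tubular Npz); rewrite z'p (le_lt_trans _ (proj_dist np tz)) //.
  by rewrite ler_piMl ?enorm_ge0 //; lra.
have [Npz' h] := np.1 _ tz'.
apply/eqP/negP => /negP; rewrite eq_sym => ne.
have := h _ Npz ne; rewrite z'p.
have := proj_min np tz Npz'.
have := enormD (z - z') (z' - pr z'); rewrite addrA subrK zz'; lra.
Qed.

Lemma proj_smooth (R : realType) (m : nat) (N : set 'rV[R]_m) (delta : R)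
    (pr : 'rV[R]_m -> 'rV[R]_m) (z v w : 'rV[R]_m) :
  nearest_point_projection N delta pr -> tubular_nbhd N delta z ->
  [/\ differentiable pr z, differentiable ('D_w pr) z & differentiable ('D_v ('D_w pr)) z].
Proof.
by move=> [_ sm] tz; split; [exact: (sm [::])|exact: (sm [:: w])|exact: (sm [:: v; w])].
Qed.

Lemma derive_basis (R : realType) (m p : nat) (f : 'rV[R]_m -> 'rV[R]_p) (z v : 'rV[R]_m) :
  differentiable f z -> 'D_v f z = \sum_(i < m) v 0 i *: 'D_(basis_vec R i) f z.
Proof.
move=> df; rewrite deriveE // {1}(row_sum_delta v) linear_sum /=.
by apply: eq_bigr => i _; rewrite linearZ /= deriveE.
Qed.

Lemma derive_proj_normal (R : realType) (m : nat) (N : set 'rV[R]_m) (delta : R)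
    (pr : 'rV[R]_m -> 'rV[R]_m) (z : 'rV[R]_m) :
  nearest_point_projection N delta pr -> tubular_nbhd N delta z ->
  'D_(pr z - z) pr z = 0.
Proof.
move=> np tz; have [dp _ _] := proj_smooth 0 0 np tz.
apply/rowP => i; rewrite mxE.
have := @derive_line _ _ _ pr z (pr z - z) 0; rewrite scale0r addr0 => /(_ dp i) /derive_eq0_right_cst.
by apply=> s s01; rewrite scale0r addr0 (proj_segment np tz).
Qed.

Lemma is_derive_dot (R : realType) (m : nat) (a b : R -> 'rV[R]_m) (s : R) (a' b' : 'rV[R]_m) :
  is_derive s 1 a a' -> is_derive s 1 b b' ->
  is_derive s 1 (fun t => dot (a t) (b t)) (dot a' (b s) + dot (a s) b').
Proof.
move=> /is_derive_coordP da /is_derive_coordP db; rewrite -big_split /=.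
apply: is_derive_sumr => i; have := da i; have := db i => hb ha.
by apply: is_derive_eq; rewrite /GRing.scale /=; ring.
Qed.

Lemma tubular_near (R : realType) (m : nat) (N : set 'rV[R]_m) (delta : R)
    (pr : 'rV[R]_m -> 'rV[R]_m) (z w : 'rV[R]_m) :
  nearest_point_projection N delta pr -> tubular_nbhd N delta z ->
  exists2 e : R, 0 < e & forall s, `|s| < e -> tubular_nbhd N delta (z + s *: w).
Proof.
move=> np tz; have [Npz _] := np.1 _ tz; have dz := proj_dist np tz.
have w1 : 0 < enorm w + 1 by have := enorm_ge0 w; lra.
exists ((delta - enorm (z - pr z)) / (enorm w + 1)); first by rewrite divr_gt0 // subr_gt0.
move=> s; rewrite ltr_pdivlMr // => sw; apply: (mem_tubular Npz).
have -> : z + s *: w - pr z = (z - pr z) + s *: w by rewrite addrAC.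
have := enormD (z - pr z) (s *: w); rewrite enormZ.
have := normr_ge0 s; lra.
Qed.

(** First variation: the points [pr (z + s *: w)] all lie on N, so their distance to z is smallest
    at s = 0. *)
Lemma proj_orthogonal (R : realType) (m : nat) (N : set 'rV[R]_m) (delta : R)
    (pr : 'rV[R]_m -> 'rV[R]_m) (z w : 'rV[R]_m) :
  nearest_point_projection N delta pr -> tubular_nbhd N delta z ->
  dot (z - pr z) ('D_w pr z) = 0.
Proof.
move=> np tz; have [dp _ _] := proj_smooth 0 0 np tz.
have [e e0 te] := tubular_near w np tz.
have dl : is_derive (0 : R) 1 (fun s : R => z - pr (z + s *: w)) (- 'D_w pr z).
  apply/is_derive_coordP => i.
  have := @derive_line _ _ _ pr z w 0; rewrite scale0r addr0 => /(_ dp i) h.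
  under eq_fun do rewrite mxE mxE.
  by apply: is_derive_eq; rewrite mxE; ring.
have := derive_eq0_local_min e0 (is_derive_dot dl dl).
rewrite scale0r addr0 dotNl dotNr (dotC _ (z - _)) => h.
suff : - dot (z - pr z) ('D_w pr z) - dot (z - pr z) ('D_w pr z) = 0 by lra.
apply: h => s se; rewrite -!sqr_enorm ler_pXn2r ?nnegrE ?enorm_ge0 //.
by apply: (proj_min np tz); have [] := np.1 _ (te _ se).
Qed.

(** The relation of [proj_orthogonal] is differentiated at y in the direction a; the term with the
    second derivative of [pr] drops because y = pr y. With a = w this makes Dpr(y) behave as an
    orthogonal projection. *)
Lemma proj_orthogonal_tangent (R : realType) (m : nat) (N : set 'rV[R]_m) (delta : R)
    (pr : 'rV[R]_m -> 'rV[R]_m) (y a w : 'rV[R]_m) :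
  0 < delta -> nearest_point_projection N delta pr -> N y ->
  dot (a - 'D_a pr y) ('D_w pr y) = 0.
Proof.
move=> d0 np Ny; have [ty pry] := proj_id d0 np Ny.
have [dp dwp _] := proj_smooth 0 w np ty.
have [e e0 te] := tubular_near a np ty.
have d1 : is_derive (0 : R) 1 (fun s : R => y + s *: a - pr (y + s *: a)) (a - 'D_a pr y).
  apply/is_derive_coordP => i.
  have := @derive_line _ _ _ pr y a 0; rewrite scale0r addr0 => /(_ dp i) h.
  under eq_fun do rewrite 4!mxE.
  by apply: is_derive_eq; rewrite /GRing.scale /= 2!mxE; ring.
have d2 : is_derive (0 : R) 1 (fun s : R => 'D_w pr (y + s *: a)) ('D_a ('D_w pr) y).
  apply/is_derive_coordP => i.
  by have := @derive_line _ _ _ ('D_w pr) y a 0; rewrite scale0r addr0; apply.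
(* The pairing vanishes identically near s = 0, so 0 is trivially a local minimum. *)
have := derive_eq0_local_min e0 (is_derive_dot d1 d2).
rewrite scale0r addr0 pry subrr.
have d00 b : dot (0 : 'rV[R]_m) b = 0 by rewrite /dot big1 // => i _; rewrite mxE mul0r.
rewrite !d00 addr0; apply => s se.
by rewrite (proj_orthogonal w np (te _ se)).
Qed.

(* A function with [s f' <= 2 (1 + K s) f] and [f = o(s^2)] at [0]: the
   integrating factor is [s^-2 exp (- 2 K s)]. *)
Lemma gronwall_singular (R : realType) (f f1 : R -> R) (K s1 : R) :
  0 < s1 -> 0 <= K ->
  (forall s : R, 0 < s <= s1 -> is_derive s 1 f (f1 s)) ->
  (forall s, 0 < s <= s1 -> s * f1 s <= 2 * (1 + K * s) * f s) ->
  (forall e, 0 < e -> exists2 s, 0 < s <= s1 & f s <= e * s ^+ 2) ->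
  f s1 <= 0.
Proof.
move=> s10 K0 df fK fs.
pose G s := f s * (expR (- (2 * K) * s) * (s^-1 * s^-1)).
have dG (s : R) : 0 < s <= s1 -> is_derive s 1 G
    ((s * f1 s - 2 * (1 + K * s) * f s) * (expR (- (2 * K) * s) * (s^-1 ^+ 3))).
  move=> ss; have s0 : s != 0 by rewrite gt_eqF; move/andP: ss => [].
  have d1 := df s ss.
  have d2 : is_derive s 1 (fun s => expR (- (2 * K) * s)) (expR (- (2 * K) * s) * (- (2 * K))).
    by apply: is_derive1_comp; apply: is_derive_eq; rewrite /GRing.scale /=; ring.
  have d3 : is_derive s 1 (fun s : R => s^-1) (- s ^- 2).
    by apply: is_derive_eq; [exact: is_deriveV|rewrite /GRing.scale /= mulr1].
  apply: is_derive_eq; rewrite /GRing.scale /=; field.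
  by [].
have G_le (s : R) : 0 < s < s1 -> G s1 <= G s.
  move=> /andP[s0 ss1].
  have dG' (x : R) : x \in `]s, s1[ -> is_derive x 1 G
      ((x * f1 x - 2 * (1 + K * x) * f x) * (expR (- (2 * K) * x) * (x^-1 ^+ 3))).
    by rewrite in_itv /= => xs; apply: dG; lra.
  have cG : {within `[s, s1], continuous G}.
    apply: derivable_within_continuous => x; rewrite in_itv /= => xs.
    have xs' : 0 < x <= s1 by lra.
    by have /is_deriveP[] := dG x xs'.
  have [x] := MVT ss1 dG' cG.
  rewrite in_itv /= => xs E; rewrite -subr_le0 E mulr_le0_ge0 //; last by lra.
  rewrite mulr_le0_ge0 //; first by rewrite subr_le0 fK //; lra.
  rewrite mulr_ge0 ?expR_ge0 // exprn_ge0 // invr_ge0; lra.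
have c0 (s : R) : 0 < s -> 0 < expR (- (2 * K) * s) * (s^-1 * s^-1).
  by move=> s0; rewrite !mulr_gt0 ?expR_gt0 ?invr_gt0.
suff : G s1 <= 0 by rewrite /G pmulr_lle0 // c0.
apply/ler_addgt0Pl => e e0; rewrite addr0.
have [s /andP[s0 ss1] fe] := fs e e0.
have Gs : G s <= e.
  apply: (@le_trans _ _ (e * s ^+ 2 * (expR (- (2 * K) * s) * (s^-1 * s^-1)))).
    by rewrite ler_pM2r // c0.
  have -> : e * s ^+ 2 * (expR (- (2 * K) * s) * (s^-1 * s^-1)) = e * expR (- (2 * K) * s).
    by field; rewrite gt_eqF.
  apply: ler_piMr; [exact: ltW|]; have : (- (2 * K) * s <= 0) by nra.
  by move=> h; rewrite -[leRHS]expR0 ler_expR.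
move: ss1; rewrite le_eqVlt => /orP[/eqP <-//|ss1].
by apply: le_trans Gs; apply: G_le; rewrite s0.
Qed.

Lemma C1_lipschitz0 (R : realType) (f f1 : R -> R) (s1 : R) :
  0 <= s1 -> (forall s : R, 0 <= s <= s1 -> is_derive s 1 f (f1 s)) ->
  {within `[0, s1], continuous f1} ->
  exists2 K : R, 0 <= K & forall s, 0 <= s <= s1 -> `|f s - f 0| <= K * s.
Proof.
move=> s10 df cf1.
have cn : {within `[0, s1], continuous (fun s => `|f1 s|)}.
  by move=> x; apply: continuous_comp; [exact: cf1|exact: norm_continuous].
have [c _ cmax] := EVT_max s10 cn.
exists `|f1 c| => // s /andP[]; rewrite le_eqVlt => /orP[/eqP <- _|s0 ss1].
  by rewrite subrr normr0 mulr0.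
have [||x] := @MVT _ f f1 0 s s0.
- by move=> x; rewrite in_itv /= => xs; apply: df; lra.
- apply: derivable_within_continuous => x; rewrite in_itv /= => xs.
  have xs' : 0 <= x <= s1 by lra.
  by have /is_deriveP[] := df x xs'.
- rewrite in_itv /= subr0 => xs ->; rewrite normrM (gtr0_norm s0) ler_pM2r //.
  by apply: cmax; rewrite in_itv /=; lra.
Qed.

Lemma coord_le_norm (R : realType) (p q : nat) (a : 'M[R]_(p, q)) i j : `|a i j| <= `|a|.
Proof.
rewrite [`|a|]mx_normrE.
exact: (le_bigmax _ (fun ij : 'I_p * 'I_q => `|a ij.1 ij.2|) (i, j)).
Qed.

(* [w s := pr (y + s nu) - y] solves [s w' = Dpr(y + s nu) w], because
   [Dpr(z) (z - pr z) = 0]; as [w = o(s)] and [Dpr(y)] is a projection, a singular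
   Gronwall argument for [|w|^2] gives [w = 0]. *)
Lemma proj_normal_segment (R : realType) (m : nat) (N : set 'rV[R]_m) (delta : R)
    (pr : 'rV[R]_m -> 'rV[R]_m) (y nu : 'rV[R]_m) (s1 : R) :
  0 < delta -> nearest_point_projection N delta pr -> N y ->
  (forall w, dot nu ('D_w pr y) = 0) -> 0 < s1 -> s1 * enorm nu < delta ->
  pr (y + s1 *: nu) = y.
Proof.
move=> d0 np Ny nuP s10 s1d; have [ty pry] := proj_id d0 np Ny.
have tz s : 0 <= s <= s1 -> tubular_nbhd N delta (y + s *: nu).
  move=> /andP[s0 ss1]; apply: (mem_tubular Ny); rewrite addrC addKr enormZ ger0_norm //.
  by rewrite (le_lt_trans _ s1d) // ler_wpM2r ?enorm_ge0.
have [w wE] : exists w : R -> 'rV[R]_m, w = (fun s => pr (y + s *: nu) - y) by eexists.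
have dw (s : R) : 0 <= s <= s1 -> is_derive s 1 w ('D_nu pr (y + s *: nu)).
  move=> ss; have [dp _ _] := proj_smooth 0 0 np (tz s ss).
  rewrite wE; apply/is_derive_coordP => i; have h := derive_line dp i.
  under eq_fun do rewrite mxE.
  by apply: is_derive_eq; rewrite ?addr0.
have w0 : w 0 = 0 by rewrite wE scale0r addr0 pry subrr.
have Dnu : 'D_nu pr y = 0.
  apply: dot_eq0; have := proj_orthogonal_tangent nu nu d0 np Ny.
  by rewrite dotDl dotNl nuP sub0r => /eqP; rewrite oppr_eq0 => /eqP.
(* The entries of the Jacobian along the segment. Their deviation from s = 0 is at most K s, which
   turns the projection Dpr(y) into the factor 1 + m^2 K s of the Gronwall inequality. *)
pose M i j (s : R) : R := ('D_(basis_vec R i) pr (y + s *: nu)) 0 j.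
have [K K0 KP] : exists2 K : R, 0 <= K &
    forall i j s, 0 <= s <= s1 -> `|M i j s - M i j 0| <= K * s.
  have h (ij : 'I_m * 'I_m) : exists K : R, 0 <= K /\ forall s, 0 <= s <= s1 ->
      `|M ij.1 ij.2 s - M ij.1 ij.2 0| <= K * s.
    case: ij => i j /=.
    have [|||K K0 KP] := @C1_lipschitz0 R (M i j)
      (fun s => 'D_nu ('D_(basis_vec R i) pr) (y + s *: nu) 0 j) s1.
    - exact: ltW.
    - move=> s ss; have [_ dwp _] := proj_smooth 0 (basis_vec R i) np (tz s ss).
      exact: derive_line.
    - apply: derivable_within_continuous => s; rewrite in_itv /= => ss.
      have [_ _ dd] := proj_smooth nu (basis_vec R i) np (tz s ss).
      by have /is_deriveP[] := derive_line dd j.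
    - by exists K.
  have [k kP] := choice h.
  exists (\sum_ij k ij); first by apply: sumr_ge0 => ij _; have [] := kP ij.
  move=> i j s ss; have [_ /(_ s ss) /= h1] := kP (i, j).
  apply: (le_trans h1); rewrite ler_wpM2r //; first by case/andP: ss.
  rewrite (bigD1 (i, j)) //= lerDl; apply: sumr_ge0 => ij _; by have [] := kP ij.
have sq s : 0 <= s <= s1 ->
    s * dot (w s) ('D_nu pr (y + s *: nu)) <= (1 + m%:R ^+ 2 * K * s) * dot (w s) (w s).
  move=> ss; have [dp _ _] := proj_smooth 0 0 np (tz s ss).
  have [dpy _ _] := proj_smooth 0 0 np ty.
  have s0 : 0 <= s by case/andP: ss.
  have Dw : s *: 'D_nu pr (y + s *: nu) = 'D_(w s) pr (y + s *: nu).
    have := derive_proj_normal np (tz s ss).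
    have -> : pr (y + s *: nu) - (y + s *: nu) = w s - s *: nu by rewrite wE opprD addrA.
    rewrite !deriveE // linearB linearZ /= => /eqP; rewrite subr_eq0 => /eqP ->.
    by [].
  rewrite -(dotZr s) Dw.
  (* a - Dpr(y) a is orthogonal to Dpr(y) a, so Dpr(y) does not increase the quadratic form. *)
  have hy (a : 'rV[R]_m) : dot a ('D_a pr y) <= dot a a.
    have := proj_orthogonal_tangent a a d0 np Ny; have := dot_ge0 (a - 'D_a pr y).
    rewrite !dotE (dotC ('D_a pr y) a); lra.
  have {}hy := hy (w s).
  suff : dot (w s) ('D_(w s) pr (y + s *: nu) - 'D_(w s) pr y) <=
         m%:R ^+ 2 * K * s * dot (w s) (w s).
    rewrite dotDr dotNr mulrDl mul1r => h; apply: le_trans (lerD hy h).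
    by rewrite subrKC.
  rewrite (derive_basis _ dp) (derive_basis _ dpy) -sumrB.
  under eq_bigr do rewrite -scalerBr.
  have sumD (D : R) : m%:R ^+ 2 * K * s * D = \sum_(j < m) \sum_(i < m) K * s * D.
    by rewrite !sumr_const card_ord -(mulr_natr (K * s * D)) -(mulr_natr (K * s * D * _)); ring.
  rewrite sumD {sumD}.
  apply: ler_sum => j _; rewrite summxE mulr_sumr; apply: ler_sum => i _.
  rewrite !mxE (le_trans (ler_norm _)) // !normrM.
  have := KP i j s ss; rewrite /M scale0r addr0 => h.
  have hi := coord_le_enorm (w s) i; have hj := coord_le_enorm (w s) j.
  rewrite -sqr_enorm expr2.
  have -> : K * s * (enorm (w s) * enorm (w s)) = enorm (w s) * (enorm (w s) * (K * s)) by ring.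
  by apply: ler_pM => //; apply: ler_pM.
have wsmall e : 0 < e -> exists2 s, 0 < s <= s1 & dot (w s) (w s) <= e * s ^+ 2.
  move=> e0.
  have /is_deriveP[/cvg_ex[l lP] dl] : is_derive (0 : R) 1 w 0.
    by have := dw 0; rewrite scale0r addr0 Dnu; apply; rewrite lexx ltW.
  have l0 : l = 0 by rewrite -dl /derive; apply/esym/cvg_lim.
  move: lP; rewrite l0 => /cvgrPdist_lt.
  (* Capping at 1 gives e1^2 <= e1, so that the sum of m squared coordinates stays below e s^2
     without square roots. *)
  pose e1 := Num.min 1 (e / (m%:R + 1)).
  have m1 : 0 < m%:R + 1 :> R by rewrite ltr_wpDl.
  have e10 : 0 < e1 by rewrite lt_min ltr01 divr_gt0.
  move=> /(_ _ e10); rewrite near_withinE /=; case/nbhs_ballP => e' /= e'0 he'.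
  pose s := Num.min s1 e' / 2.
  have m0 : 0 < Num.min s1 e' by rewrite lt_min s10 e'0.
  have s0 : 0 < s by rewrite divr_gt0.
  have ms1 : Num.min s1 e' <= s1 by rewrite ge_min lexx.
  have me' : Num.min s1 e' <= e' by rewrite ge_min lexx orbT.
  exists s; first by rewrite /s; lra.
  have := he' s; rewrite /ball /= sub0r normrN gtr0_norm //.
  have -> : s < e' by rewrite /s; lra.
  move=> /(_ isT); rewrite gt_eqF // => /(_ isT).
  rewrite w0 subr0 addr0 /GRing.scale /= mulr1 sub0r normrN => h.
  have wi i : (w s) 0 i * (w s) 0 i <= e1 * s ^+ 2.
    have : `|(s^-1 *: w s) 0 i| <= e1 by apply: le_trans (ltW h); exact: coord_le_norm.
    rewrite mxE normrM gtr0_norm ?invr_gt0 // ler_pdivrMl // => h1.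
    have e11 : e1 <= 1 by rewrite ge_min lexx.
    rewrite -expr2 -real_normK ?num_real //.
    have : `|w s 0 i| ^+ 2 <= (s * e1) ^+ 2.
      by rewrite ler_pXn2r ?nnegrE // mulr_ge0 // ltW.
    rewrite exprMn => h2; apply: (le_trans h2).
    rewrite mulrC ler_wpM2r ?sqr_ge0 // expr2; apply: ler_piMr => //; exact: ltW.
  have : dot (w s) (w s) <= \sum_(i < m) e1 * s ^+ 2 by apply: ler_sum => i _; exact: wi.
  rewrite sumr_const card_ord -mulr_natr => h1; apply: (le_trans h1).
  have : e1 * (m%:R + 1) <= e by rewrite -ler_pdivlMr // ge_min lexx orbT.
  have := sqr_ge0 s; nra.
have dff (s : R) : 0 < s <= s1 -> is_derive s 1 (fun s => dot (w s) (w s))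
    (2 * dot (w s) ('D_nu pr (y + s *: nu))).
  move=> ss; have ss' : 0 <= s <= s1 by lra.
  have := is_derive_dot (dw s ss') (dw s ss').
  by rewrite (dotC ('D_nu pr _)) => h; apply: (is_derive_eq h); ring.
have wz : dot (w s1) (w s1) <= 0.
  apply: (gronwall_singular s10 _ dff _ wsmall (K := m%:R ^+ 2 * K)).
    by rewrite mulr_ge0 ?exprn_ge0.
  move=> s ss; have ss' : 0 <= s <= s1 by lra.
  by have := sq s ss'; lra.
have /dot_eq0 : dot (w s1) (w s1) = 0 by apply: le_anti; rewrite wz dot_ge0.
by rewrite wE => /eqP; rewrite subr_eq0 => /eqP.
Qed.

Lemma dotr0 (R : realType) (m : nat) (a : 'rV[R]_m) : dot a 0 = 0.
Proof. by rewrite /dot big1 // => i _; rewrite [X in _ * X]mxE mulr0. Qed.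

(** As long as s |nu| < delta, the nearest point to y + s nu is y. Expanding |y + s nu - q| >= |s
    nu| gives 2 s <q - y, nu> <= |q - y|^2, and s may approach delta / |nu|. *)
Lemma normal_bound (R : realType) (m : nat) (N : set 'rV[R]_m) (delta : R)
    (pr : 'rV[R]_m -> 'rV[R]_m) (y q nu : 'rV[R]_m) :
  0 < delta -> nearest_point_projection N delta pr -> N y -> N q ->
  (forall w, dot nu ('D_w pr y) = 0) ->
  2 * delta * dot (q - y) nu <= dot (q - y) (q - y) * enorm nu.
Proof.
move=> d0 np Ny Nq nuP; set a := dot (q - y) nu; set b := dot (q - y) (q - y).
have b0 : 0 <= b by exact: dot_ge0.
have nu0 := enorm_ge0 nu.
have [a0|a0] := leP a 0.
  by apply: (@le_trans _ _ 0); [nra|rewrite mulr_ge0].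
have nup : 0 < enorm nu.
  rewrite lt_neqAle nu0 andbT eq_sym; apply/eqP => /enorm_eq0 nu00.
  by move: a0; rewrite /a nu00 dotr0 ltxx.
rewrite leNgt; apply/negP => h.
have hs : b / (2 * a) < delta / enorm nu.
  by rewrite ltr_pdivrMr ?mulr_gt0 // mulrAC ltr_pdivlMr //; lra.
(* If the bound failed, there would be room between b / (2 a), beyond which q is strictly closer
   than y, and delta / |nu|, before which y is the nearest point; s is the midpoint. *)
pose s := (b / (2 * a) + delta / enorm nu) / 2.
have s1 : b / (2 * a) < s by rewrite /s; lra.
have s2 : s < delta / enorm nu by rewrite /s; lra.
have s0 : 0 < s by apply: le_lt_trans s1; rewrite divr_ge0 // mulr_ge0 // ltW.
have sd : s * enorm nu < delta by rewrite -ltr_pdivlMr.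
have tz : tubular_nbhd N delta (y + s *: nu).
  by apply: (mem_tubular Ny); rewrite addrC addKr enormZ gtr0_norm.
have := proj_min np tz Nq.
rewrite (proj_normal_segment d0 np Ny nuP s0 sd).
rewrite -(@ler_pXn2r _ 2) ?nnegrE ?enorm_ge0 // !sqr_enorm.
have -> : y + s *: nu - y = s *: nu by rewrite addrC addKr.
have -> : y + s *: nu - q = s *: nu - (q - y).
  by apply/rowP => i; rewrite !mxE; ring.
rewrite [X in _ <= X]dotDl !(dotDr _ (- (q - y))) !dotNl !dotNr (dotC (s *: nu) (q - y)).
rewrite (dotZr s nu (q - y)) -/a -/b.
by move: s1; rewrite ltr_pdivrMr ?mulr_gt0 //; lra.
Qed.

(** * Second fundamental form along curves in N *)

Section curve.
Context (R : realType) (m : nat) (N : set 'rV[R]_m) (delta : R) (pr : 'rV[R]_m -> 'rV[R]_m).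
Context (d0 : 0 < delta) (np : nearest_point_projection N delta pr).
Context (c c1 : R -> 'rV[R]_m) (a : 'rV[R]_m).
Context (Nc : forall s, N (c s)) (dc : forall s : R, is_derive s 1 c (c1 s)).
Context (dc1 : is_derive (0 : R) 1 c1 a).

(** Differentiate c = pr o c twice: a = D^2 pr (c1, c1) + Dpr a. The form is thus minus the normal
    part of the acceleration. Velocities are expanded in the standard basis so that the direction of
    differentiation stays fixed while the base point moves along c. *)
Lemma second_fundamental_form_curve :
  second_fundamental_form pr (c 0) (c1 0) (c1 0) = 'D_a pr (c 0) - a.
Proof.
have [ty pry] := proj_id d0 np (Nc 0); set y := c 0; set v := c1 0.
have [dpy _ _] := proj_smooth 0 0 np ty.
have c1E s : c1 s = \sum_(j < m) c1 s 0 j *: 'D_(basis_vec R j) pr (c s).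
  have [ts _] := proj_id d0 np (Nc s).
  have [dp _ _] := proj_smooth 0 0 np ts.
  rewrite -derive_basis //.
  have h : is_derive s 1 (pr \o c) ('D_(c1 s) pr (c s)) by exact: derive_chain.
  apply: is_derive_unique h.
  suff -> : pr \o c = c by [].
  by apply/funext => t /=; have [] := proj_id d0 np (Nc t).
(* The expansion of Dpr in the basis is available inside the tube only, hence the equality near s =
   0 instead of everywhere. *)
have hv : 'D_v ('D_v pr) y = \sum_(j < m) v 0 j *: 'D_v ('D_(basis_vec R j) pr) y.
  have [_ dvp _] := proj_smooth 0 v np ty.
  have [e e0 te] := tubular_near v np ty.
  apply/rowP => i.
  have := @derive_line _ _ _ ('D_v pr) y v 0; rewrite scale0r addr0 => /(_ dvp i) h1.
  apply: is_derive_unique h1 _.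
  apply: (@near_eq_is_derive _ _ _
    (fun s : R => \sum_(j < m) v 0 j * 'D_(basis_vec R j) pr (y + s *: v) 0 i)).
  - near=> s.
    have ts : tubular_nbhd N delta (y + s *: v).
      apply: te; near: s; apply/nbhs_ballP; exists e => // s /=.
      by rewrite /ball /= sub0r normrN.
    have [dp _ _] := proj_smooth 0 0 np ts.
    rewrite (derive_basis v dp) summxE; apply: eq_bigr => j _; by rewrite mxE.
  rewrite summxE; apply: is_derive_sumr => j.
  have [_ dj _] := proj_smooth 0 (basis_vec R j) np ty.
  have := @derive_line _ _ _ ('D_(basis_vec R j) pr) y v 0.
  rewrite scale0r addr0 => /(_ dj i) h2.
  by apply: is_derive_eq; rewrite mxE /GRing.scale /=; ring.
have := dc1; rewrite (_ : c1 = fun s => \sum_(j < m) c1 s 0 j *: 'D_(basis_vec R j) pr (c s)); last exact/funext.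
move=> /is_derive_coordP h.
rewrite /second_fundamental_form hv (derive_basis a dpy).
apply/rowP => i; rewrite 3!mxE.
suff -> : a 0 i = \sum_(j < m) (a 0 j * 'D_(basis_vec R j) pr y 0 i
     + v 0 j * 'D_v ('D_(basis_vec R j) pr) y 0 i).
  rewrite !summxE big_split /= opprD addrA.
  under [in RHS]eq_bigr do rewrite mxE.
  by rewrite subrr sub0r; congr (- _); apply: eq_bigr => j _; rewrite mxE.
apply: is_derive_unique (h i) _.
under eq_fun do rewrite summxE.
apply: is_derive_sumr => j.
have [_ dj _] := proj_smooth 0 (basis_vec R j) np ty.
have /is_derive_coordP/(_ i) h1 := derive_chain dj (dc 0).
have /is_derive_coordP/(_ j) h2 := dc1.
under eq_fun do rewrite mxE.
by apply: is_derive_eq; rewrite /GRing.scale /=; ring.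
Unshelve. all: by end_near.
Qed.

Lemma sff_normal w :
  dot (second_fundamental_form pr (c 0) (c1 0) (c1 0)) ('D_w pr (c 0)) = 0.
Proof.
rewrite second_fundamental_form_curve -opprB dotNl.
by rewrite (proj_orthogonal_tangent _ _ d0 np (Nc 0)) oppr0.
Qed.

(** By [normal_bound] with q = c s, the function g below is nonpositive and vanishes at s = 0. Its
    second derivative there is 2 delta |F|^2 - 2 |F| |c1 0|^2, and the second derivative test
    concludes. *)
Lemma sff_bound : delta * enorm (second_fundamental_form pr (c 0) (c1 0) (c1 0))
  <= dot (c1 0) (c1 0).
Proof.
set F := second_fundamental_form _ _ _ _.
have nF w : dot (- F) ('D_w pr (c 0)) = 0 by rewrite dotNl sff_normal oppr0.
have dcy (s : R) : is_derive s 1 (fun s => c s - c 0) (c1 s).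
  by apply: is_derive_eq; rewrite subr0.
pose g s := 2 * delta * dot (c s - c 0) (- F) - enorm (- F) * dot (c s - c 0) (c s - c 0).
pose g1 s := 2 * delta * dot (c1 s) (- F) - enorm (- F) * (2 * dot (c1 s) (c s - c 0)).
have cst0 (t : R) : is_derive t 1 (fun _ : R => - F) 0 by exact: is_derive_cst.
have dg (s : R) : is_derive s 1 g (g1 s).
  have h1 := is_derive_dot (dcy s) (cst0 s); have h2 := is_derive_dot (dcy s) (dcy s).
  apply: is_derive_eq; rewrite /g1 /GRing.scale /= dotr0 (dotC (c s - c 0)); ring.
have dg1 : is_derive (0 : R) 1 g1
    (2 * delta * dot a (- F) - enorm (- F) * (2 * dot (c1 0) (c1 0))).
  have h1 := is_derive_dot dc1 (cst0 0); have h2 := is_derive_dot dc1 (dcy 0).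
  apply: is_derive_eq; rewrite /GRing.scale /= subrr !dotr0; ring.
have [|_] := second_derive_test dg dg1.
  exists 1 => // s _; rewrite {2}/g subrr !dotr0 dotC !dotr0 !mulr0 subrr /g subr_le0.
  by rewrite [leRHS]mulrC; exact: (normal_bound d0 np (Nc 0) (Nc s) nF).
rewrite enormN.
(* - F is the normal part of a, and the tangential part is orthogonal to F. *)
have -> : dot a (- F) = enorm F ^+ 2.
  rewrite sqr_enorm -[RHS]opprK -dotNl -dotNr.
  have -> : dot (- F) (- F) = dot (a - 'D_a pr (c 0)) (- F).
    by rewrite /F second_fundamental_form_curve opprB.
  by rewrite dotDl dotNl (dotC ('D_a pr _)) nF subr0.
have [F0 _|F0] := eqVneq (enorm F) 0.
  by rewrite F0 mulr0 dot_ge0.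
have Fp : 0 < enorm F by rewrite lt_neqAle eq_sym F0 enorm_ge0.
move=> h; have : enorm F * (dot (c1 0) (c1 0) - delta * enorm F) >= 0 by nra.
by rewrite pmulr_rge0 // subr_ge0.
Qed.

(** [normal_bound] for F and for - F gains one order in q - c 0 over Cauchy-Schwarz; [sff_bound]
    then replaces |F|. This quadratic dependence on q - c 0 is what controls both p and the
    increments. *)
Lemma sff_dot_bound q : N q ->
  2 * delta ^+ 2 * `|dot (q - c 0) (second_fundamental_form pr (c 0) (c1 0) (c1 0))|
  <= dot (q - c 0) (q - c 0) * dot (c1 0) (c1 0).
Proof.
move=> Nq; have := sff_bound; have := sff_normal.
set F := second_fundamental_form _ _ _ _ => nF bF.
have h1 := normal_bound d0 np (Nc 0) Nq nF.
have nF' w : dot (- F) ('D_w pr (c 0)) = 0 by rewrite dotNl nF oppr0.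
have h2 := normal_bound d0 np (Nc 0) Nq nF'.
have h : 2 * delta * `|dot (q - c 0) F| <= dot (q - c 0) (q - c 0) * enorm F.
  have [?|?] := ger0P (dot (q - c 0) F); first by [].
  by move: h2; rewrite dotNr enormN.
apply: (@le_trans _ _ (delta * (dot (q - c 0) (q - c 0) * enorm F))).
  by rewrite expr2 (mulrC 2) -!mulrA ler_pM2l // mulrCA mulrA.
by rewrite mulrCA ler_wpM2l // dot_ge0.
Qed.

End curve.

(** * The maximum principle for the flow *)

Lemma heat_add (R : realType) (d : nat) (a b : jet R d) x t :
  heat (jadd a b) x t = heat a x t + heat b x t.
Proof. by rewrite /heat /= big_split /= opprD addrACA. Qed.

Lemma heat_time (R : realType) (d : nat) (a b : R) x t : heat (@jtime R d a b) x t = b.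
Proof. by rewrite /heat /= big1 // subr0. Qed.

Lemma heat_trans (R : realType) (d : nat) (h : 'rV[R]_d) (a : jet R d) x t :
  heat (jtrans h a) x t = heat a (x + h) t.
Proof. by []. Qed.

Lemma heat_mul (R : realType) (d : nat) (a b : jet R d) x t :
  heat (jmul a b) x t = heat a x t * jv b x t + jv a x t * heat b x t
    - 2 * \sum_(k < d) jg a k x t * jg b k x t.
Proof.
rewrite /heat /= !big_split /= -mulr_suml -[X in _ - (_ + _ + X)]mulr_sumr.
under [X in _ - (_ + X + _)]eq_bigr do rewrite -mulrA.
rewrite -mulr_sumr; ring.
Qed.

Lemma heat_scale (R : realType) (d : nat) (a : R) (b : jet R d) x t :
  heat (jmul (jtime d a 0) b) x t = a * heat b x t.
Proof.
by rewrite heat_mul heat_time /= big1; [ring|move=> k _; rewrite mul0r].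
Qed.

Lemma heat_exp (R : realType) (d : nat) (a : jet R d) x t :
  heat (jexp a) x t = (heat a x t - \sum_(k < d) jg a k x t ^+ 2) * expR (jv a x t).
Proof. by rewrite /heat /= -mulr_suml big_split /=; ring. Qed.

Lemma heat_sqnorm (R : realType) (d m : nat) (a : 'I_m -> jet R d) x t :
  heat (jsqnorm a) x t = 2 * \sum_(i < m) jv (a i) x t * heat (a i) x t
    - 2 * \sum_(k < d) \sum_(i < m) jg (a i) k x t ^+ 2.
Proof.
rewrite /heat /= exchange_big /= [in RHS]exchange_big /= !mulr_sumr -!sumrB.
apply: eq_bigr => i _; rewrite big_split /= -!mulr_sumr; ring.
Qed.

(** Linear growth is beaten by eta |x|^2 outside a large cube, so [heat_max] applies for every eta >
    0, and eta tends to 0 at the fixed point (x, t). *)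
Lemma max_principle (R : realType) (d : nat) (j : jet R d) (B T t0 A M : R) :
  is_jet j -> 0 <= t0 -> 0 <= M ->
  (forall x : 'rV[R]_d, jv j x t0 <= B) ->
  (forall (x : 'rV[R]_d) (t : R), t0 <= t <= T ->
     jv j x t <= A + M * \sum_(i < d) `|x 0 i|) ->
  (forall (x : 'rV[R]_d) (t : R), t0 < t <= T -> heat j x t <= 0) ->
  forall (x : 'rV[R]_d) (t : R), t0 <= t <= T -> jv j x t <= B.
Proof.
move=> jj t00 M0 init growth sub x t tT.
set W := \sum_(i < d) x 0 i ^+ 2 + (2 * d%:R + 1) * (t - t0).
have W0 : 0 <= W.
  rewrite addr_ge0 ?sumr_ge0 // => [i _|]; first exact: sqr_ge0.
  by rewrite mulr_ge0 ?subr_ge0 ?addr_ge0 //; case/andP: tT.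
apply/ler_addgt0Pr => e e0.
pose eta := e / (W + 1).
have W1 : 0 < W + 1 by lra.
have eta0 : 0 < eta by rewrite divr_gt0.
have etaW : eta * W <= e.
  rewrite /eta mulrAC ler_pdivrMr // ler_pM2l //; lra.
(* By AM-GM, M |y_k| <= (eta / 2) y_k^2 + M^2 / (2 eta). The other half of eta |y|^2 has to exceed
   D, which holds once some |y_i| exceeds r; the summand 1 in r gives |y_i|^2 >= |y_i|. *)
pose D := `|A| + `|B| + d%:R * (M ^+ 2 / (2 * eta)).
pose r := 1 + 2 * D / eta.
have D0 : 0 <= D.
  by rewrite !addr_ge0 ?normr_ge0 // mulr_ge0 // divr_ge0 ?sqr_ge0 // mulr_ge0 // ltW.
have D2 : 0 <= 2 * D / eta by apply: divr_ge0; [exact: mulr_ge0|exact: ltW].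
apply: (le_trans (@heat_max R d j B eta T t0 r jj t00 eta0 init _ _ x t tT)).
- move=> y s ys [i ri].
  apply: (le_trans (growth y s ys)).
  have h1 : M * \sum_(i < d) `|y 0 i| <=
      eta / 2 * \sum_(i < d) y 0 i ^+ 2 + d%:R * (M ^+ 2 / (2 * eta)).
    have sc (c : R) : d%:R * c = \sum_(k < d) c by rewrite sumr_const card_ord mulr_natl.
    rewrite sc !mulr_sumr -big_split /=.
    apply: ler_sum => k _; rewrite -(real_normK (num_real (y 0 k))).
    rewrite -subr_ge0.
    have -> : eta / 2 * `|y 0 k| ^+ 2 + M ^+ 2 / (2 * eta) - M * `|y 0 k| =
      (eta * `|y 0 k| - M) ^+ 2 / (2 * eta) by field; rewrite gt_eqF.
    by rewrite divr_ge0 ?sqr_ge0 // mulr_ge0 // ltW.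
  have h2 : 2 * D / eta <= \sum_(i < d) y 0 i ^+ 2.
    rewrite (bigD1 i) //=; apply: ler_wpDr.
      by apply: sumr_ge0 => k _; exact: sqr_ge0.
    rewrite -(real_normK (num_real (y 0 i))) expr2.
    have h3 : 1 <= `|y 0 i| by move: ri; rewrite /r; lra.
    have h4 : 2 * D / eta <= `|y 0 i| by move: ri; rewrite /r; lra.
    by apply: (le_trans h4); rewrite ler_peMl.
  have h5 : D <= eta / 2 * \sum_(i < d) y 0 i ^+ 2.
    have -> : D = eta / 2 * (2 * D / eta) by field; rewrite gt_eqF.
    by rewrite ler_wpM2l // divr_ge0 // ltW.
  have := ler_norm A; have := ler_norm (- B); rewrite normrN.
  move: h1 h5; rewrite /D; lra.
- by move=> y s ys _; exact: le_lt_trans (sub y s ys) eta0.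
by rewrite lerD2l.
Qed.

Lemma is_derive_dir (R : realType) (V W : normedModType R) (f : V -> W) (x v : V) :
  derivable f x v -> is_derive (0 : R) 1 (fun s : R => f (x + s *: v)) ('D_v f x).
Proof.
have E : (fun h : R => h^-1 *: (((fun s : R => f (x + s *: v)) \o shift 0) (h *: 1)
      - f (x + 0 *: v))) = (fun h : R => h^-1 *: ((f \o shift x) (h *: v) - f x)).
  have x0 : x + 0 *: v = x by rewrite scale0r addr0.
  by apply/funext => h /=; rewrite x0 addr0 [h *: 1]mulr1 [x + _]addrC.
by move=> df; apply/is_deriveP; split; rewrite /derivable ?/derive E.
Qed.

Lemma continuous_time_max (R : realType) (d m : nat) (u : 'rV[R]_d -> R -> 'rV[R]_m) :
  {within [set z : 'rV[R]_d * R | 0 <= z.2], continuous (fun z : 'rV[R]_d * R => u z.1 z.2)} ->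
  continuous (fun z : 'rV[R]_d * R => u z.1 (Num.max z.2 0)).
Proof.
move=> /subspace_continuousP cu z.
pose g (z : 'rV[R]_d * R) := (z.1, Num.max z.2 0).
have g0 y : 0 <= (g y).2 by rewrite /= le_max lexx orbT.
have gc : g @ z --> g z.
  apply: (@cvg_pair _ _ _ (nbhs z) (nbhs z.1) (nbhs (Num.max z.2 0)) _ _ _ fst (fun z => Num.max z.2 0)); first exact: cvg_fst.
  by apply: (@continuous_max R ('rV[R]_d * R)%type snd (cst 0)); [exact: cvg_snd|exact: cvg_cst].
have gw : g @ z --> within [set z : 'rV[R]_d * R | 0 <= z.2] (nbhs (g z)).
  move=> A; rewrite /within /= => /gc; rewrite /= /nbhs /=; apply: filterS => y /=; apply.
  exact: g0.
exact: cvg_comp gw (cu (g z) (g0 z)).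
Qed.

Section flow.
Context (R : realType) (d m : nat) (N : set 'rV[R]_m) (delta : R) (pr : 'rV[R]_m -> 'rV[R]_m).
Context (u0 : 'rV[R]_d -> 'rV[R]_m) (u : 'rV[R]_d -> R -> 'rV[R]_m).
Context (d0 : 0 < delta) (np : nearest_point_projection N delta pr).
Context (hu : harmonic_map_heat_flow N pr u0 u).

(* The truncation of time makes the value continuous on the whole of R^d x R. *)
Definition ujet (j : 'I_m) : jet R d :=
  Jet (fun x t => u x (Num.max t 0) 0 j) (fun x t => derive1 (u x) t 0 j)
    (fun k x t => partial k (u ^~ t) x 0 j)
    (fun k x t => partial k (partial k (u ^~ t)) x 0 j).

Lemma is_jet_u j : is_jet (ujet j).
Proof.
have [[Nu ui cu pu] _] := hu; split => [z|x t t0] /=.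
  apply: (@continuous_comp _ _ _ (fun z : 'rV[R]_d * R => u z.1 (Num.max z.2 0))
    (fun v : 'rV[R]_m => v 0 j)); first exact: continuous_time_max.
  exact: coord_continuous.
have [[dt dk dkl] _] := pu (x, t) t0.
split=> [|k].
  have /is_derive_coordP/(_ j) h : is_derive t 1 (u x) (derive1 (u x) t).
    by rewrite derive1E; apply/is_deriveP.
  apply: near_eq_is_derive h; near=> s.
  rewrite max_l // ltW //; near: s; exact: lt_nbhsr.
rewrite max_l ?ltW //.
split; [have h := is_derive_dir (dk k)|have h := is_derive_dir (dkl k k)].
  by have /is_derive_coordP/(_ j) := h.
by have /is_derive_coordP/(_ j) := h.
Unshelve. all: by end_near.
Qed.

Definition force (x : 'rV[R]_d) (t : R) : 'rV[R]_m :=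
  \sum_(k < d) second_fundamental_form pr (u x t) (partial k (u ^~ t) x) (partial k (u ^~ t) x).

Definition energy (x : 'rV[R]_d) (t : R) : R :=
  \sum_(k < d) dot (partial k (u ^~ t) x) (partial k (u ^~ t) x).

Lemma energy_ge0 x t : 0 <= energy x t.
Proof. by apply: sumr_ge0 => k _; exact: dot_ge0. Qed.

Lemma sqr_enorm_grad x t : enorm (grad (u ^~ t) x) ^+ 2 = energy x t.
Proof.
rewrite sqr_sqrtr; last by do 2 (apply: sumr_ge0 => ? _); exact: sqr_ge0.
by apply: eq_bigr => k _; apply: eq_bigr => j _; rewrite mxE expr2.
Qed.

Lemma heat_u j x t : 0 < t -> heat (ujet j) x t = force x t 0 j.
Proof.
move=> t0; have [_ [_ /(_ x t t0) E]] := hu.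
rewrite /force -E /heat /= /laplacian mxE mxE summxE; congr (_ - _).
Qed.

(** The restrictions of u(., t) to coordinate lines are curves in N with the regularity that the
    curvature bounds ask for, so the force is estimated direction by direction. *)
Lemma curve_u k x t : 0 < t ->
  [/\ forall s, N (u (x + s *: basis_vec R k) t),
  forall s : R, is_derive s 1 (fun s => u (x + s *: basis_vec R k) t)
    (partial k (u ^~ t) (x + s *: basis_vec R k)) &
  is_derive (0 : R) 1 (fun s : R => partial k (u ^~ t) (x + s *: basis_vec R k))
    (partial k (partial k (u ^~ t)) x)].
Proof.
move=> t0; have [[Nu ui cu pu] _] := hu; split=> [s|s|].
- by apply: Nu; exact: ltW.
- apply/is_derive_coordP => j; apply: is_derive_translate.
  have [[_ dk _] _] := pu (x + s *: basis_vec R k, t) t0.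
  have /is_derive_coordP/(_ j) := is_derive_dir (dk k).
  by under eq_fun do rewrite -addrA -scalerDl.
- have [[_ _ dkl] _] := pu (x, t) t0; exact: is_derive_dir.
Qed.

Lemma force_dot x t q : 0 < t -> N q ->
  2 * delta ^+ 2 * `|dot (q - u x t) (force x t)| <= dot (q - u x t) (q - u x t) * energy x t.
Proof.
move=> t0 Nq.
have -> : dot (q - u x t) (force x t) = \sum_(k < d) dot (q - u x t)
    (second_fundamental_form pr (u x t) (partial k (u ^~ t) x) (partial k (u ^~ t) x)).
  rewrite exchange_big /=; apply: eq_bigr => j _.
  by rewrite -mulr_sumr /force summxE.
rewrite mulr_sumr; apply: (@le_trans _ _ (\sum_(k < d) 2 * delta ^+ 2 * `|dot (q - u x t)
    (second_fundamental_form pr (u x t) (partial k (u ^~ t) x) (partial k (u ^~ t) x))|)).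
  by rewrite -mulr_sumr ler_wpM2l ?ler_norm_sum // mulr_ge0 // exprn_ge0 // ltW.
apply: ler_sum => k _; have [h1 h2 h3] := curve_u k x t0.
have := @sff_dot_bound _ _ _ _ _ d0 np _ _ _ h1 h2 h3 q Nq.
by rewrite scale0r addr0.
Qed.

Lemma force_bound x t j : 0 < t -> delta * `|force x t 0 j| <= energy x t.
Proof.
move=> t0; rewrite /force summxE.
apply: (@le_trans _ _ (\sum_(k < d) delta * `|(second_fundamental_form pr (u x t)
    (partial k (u ^~ t) x) (partial k (u ^~ t) x)) 0 j|)).
  by rewrite -mulr_sumr ler_wpM2l ?ler_norm_sum // ltW.
apply: ler_sum => k _; have [h1 h2 h3] := curve_u k x t0.
have := @sff_bound _ _ _ _ _ d0 np _ _ _ h1 h2 h3.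
rewrite scale0r addr0; apply: le_trans.
by rewrite ler_pM2l // coord_le_enorm.
Qed.

End flow.

(** One coordinate is moved at a time, with the mean value theorem on each axis; whence the l^1 norm
    of x. *)
Lemma lipschitz_of_partials (R : realType) (d : nat) (f : 'rV[R]_d -> R)
    (g : 'I_d -> 'rV[R]_d -> R) (M : R) :
  (forall x k, is_derive (0 : R) 1 (fun s => f (x + s *: basis_vec R k)) (g k x)) ->
  (forall k x, `|g k x| <= M) ->
  forall x, `|f x - f 0| <= M * \sum_(i < d) `|x 0 i|.
Proof.
move=> df gM x.
have line k y s : `|f (y + s *: basis_vec R k) - f y| <= M * `|s|.
  have dl (r : R) : is_derive r 1 (fun s => f (y + s *: basis_vec R k)) (g k (y + r *: basis_vec R k)).
    have h := df (y + r *: basis_vec R k) k.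
    have e : (fun s => f (y + r *: basis_vec R k + s *: basis_vec R k)) =
        (fun q => f (y + (r + q) *: basis_vec R k)).
      by apply/funext => q; rewrite scalerDl addrA.
    rewrite e in h.
    exact: is_derive_translate h.
  have cl a b : {within `[a, b], continuous (fun s => f (y + s *: basis_vec R k))}.
    by apply: derivable_within_continuous => r _; have /is_deriveP[] := dl r.
  have y0 : y = y + 0 *: basis_vec R k by rewrite scale0r addr0.
  have [s0|s0|<-] := ltgtP 0 s; last by rewrite -y0 subrr normr0 mulr0.
    have [c _] := MVT s0 (fun r _ => dl r) (cl _ _).
    by rewrite -y0 => ->; rewrite subr0 normrM ler_wpM2r.
  have [c _] := MVT s0 (fun r _ => dl r) (cl _ _).
  by rewrite -y0 distrC => ->; rewrite sub0r normrM normrN ler_wpM2r.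
rewrite {1}(row_sum_delta x).
elim: (index_enum _) => [|k r IH]; first by rewrite !big_nil subrr normr0 mulr0.
rewrite !big_cons mulrDr; set y := \sum_(j <- r) _ in IH *.
rewrite [X in f X]addrC -/(basis_vec R k).
rewrite -(subrK (f y) (f (y + x 0 k *: basis_vec R k))) -addrA.
by apply: (le_trans (ler_normD _ _)); apply: lerD => //; exact: line.
Qed.

Section flow.
Context (R : realType) (d m : nat) (N : set 'rV[R]_m) (delta : R) (pr : 'rV[R]_m -> 'rV[R]_m).
Context (u0 : 'rV[R]_d -> 'rV[R]_m) (u : 'rV[R]_d -> R -> 'rV[R]_m) (P : 'rV[R]_m).
Context (d0 : 0 < delta) (np : nearest_point_projection N delta pr).
Context (hu : harmonic_map_heat_flow N pr u0 u) (NP : N P).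

Definition deviation (j : 'I_m) : jet R d := jadd (ujet u j) (jtime d (- P 0 j) 0).

Definition sqdeviation : jet R d := jsqnorm deviation.

Lemma is_jet_deviation j : is_jet (deviation j).
Proof. by apply: is_jet_add; [exact: is_jet_u hu j|exact: is_jet_time]. Qed.

Lemma is_jet_sqdeviation : is_jet sqdeviation.
Proof. exact: is_jet_sqnorm is_jet_deviation. Qed.

Lemma deviation_v j x t : 0 <= t -> jv (deviation j) x t = (u x t - P) 0 j.
Proof. by move=> t0 /=; rewrite max_l // mul0r addr0 !mxE. Qed.

Lemma sqdeviation_v x t : 0 <= t -> jv sqdeviation x t = dot (u x t - P) (u x t - P).
Proof.
by move=> t0; apply: eq_bigr => j _; rewrite -/(jv (deviation j) x t) deviation_v // expr2.
Qed.

Lemma heat_deviation j x t : 0 < t -> heat (deviation j) x t = force pr u x t 0 j.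
Proof. by move=> t0; rewrite heat_add heat_time addr0 (heat_u hu). Qed.

Lemma heat_sqdeviation x t : 0 < t ->
  heat sqdeviation x t = 2 * dot (u x t - P) (force pr u x t) - 2 * energy u x t.
Proof.
move=> t0; rewrite heat_sqnorm; congr (2 * _ - 2 * _).
  by apply: eq_bigr => j _; rewrite deviation_v ?ltW // heat_deviation.
by apply: eq_bigr => k _; apply: eq_bigr => j _; rewrite /= addr0 expr2.
Qed.

(** [force_dot] with q = P bounds the reaction term 2 <u - P, F> by p |grad u|^2 / delta^2, hence by
    half of the dissipation. The remaining half, - |grad u|^2, is what later absorbs the errors in
    the gradient estimate. *)
Lemma heat_sqdeviation_le x t : 0 < t -> jv sqdeviation x t <= delta ^+ 2 -> heat sqdeviation x t <= - energy u x t.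
Proof.
move=> t0; rewrite (sqdeviation_v x (ltW t0)) heat_sqdeviation // => pd.
have := force_dot d0 np hu x t0 NP.
have -> : P - u x t = - (u x t - P) by rewrite opprB.
rewrite !dotNl !dotNr opprK normrN => h.
have e0 := energy_ge0 u x t.
have h2 : delta ^+ 2 * (2 * `|dot (u x t - P) (force pr u x t)|) <= delta ^+ 2 * energy u x t.
  by rewrite mulrCA mulrA; apply: (le_trans h); rewrite ler_wpM2r.
move: h2; rewrite ler_pM2l ?exprn_gt0 // => h2.
have := ler_norm (dot (u x t - P) (force pr u x t)); lra.
Qed.

Lemma gradient_bound T : exists2 M : R, 0 <= M &
  forall x t, 0 < t <= T -> energy u x t <= M ^+ 2.
Proof.
have [_ [/(_ T)[M MP] _]] := hu; exists `|M| => // x t tT.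
have /ereal_supP/(_ (enorm (grad (u ^~ t) x))%:E) := MP t tT.
move=> /(_ (ex_intro2 _ _ x I erefl)); rewrite lee_fin => h.
rewrite -(sqr_enorm_grad u) ler_pXn2r ?nnegrE ?enorm_ge0 //.
exact: le_trans (ler_norm M).
Qed.

Context (e : R) (e0 : 0 <= e) (ue : forall x, dot (u0 x - P) (u0 x - P) <= e ^+ 2).

Lemma dot_coord_le (v : 'rV[R]_m) (j : 'I_m) (r : R) :
  0 <= r -> dot v v <= r ^+ 2 -> `|v 0 j| <= r.
Proof.
move=> r0 vr; apply: (le_trans (coord_le_enorm v j)).
by rewrite -(@ler_pXn2r _ 2) ?nnegrE ?enorm_ge0 // sqr_enorm.
Qed.

(** The growth condition of [max_principle]: the value at the origin is bounded by compactness of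
    [0, T], and the gradient bound propagates it linearly in x. *)
Lemma flow_growth T : 0 <= T -> exists A M : R, 0 <= M /\
  forall j x t, 0 <= t <= T -> `|jv (deviation j) x t| <= A + M * \sum_(i < d) `|x 0 i|.
Proof.
move=> T0; have [M M0 MP] := gradient_bound T.
have [[Nu ui cu pu] _] := hu.
have h j : exists A : R, 0 <= A /\ forall t, 0 <= t <= T -> `|jv (deviation j) 0 t| <= A.
  have cn : {within `[0, T], continuous (fun t => `|jv (deviation j) 0 t|)}.
    apply: continuous_subspaceT => t; apply: continuous_comp; last exact: norm_continuous.
    exact: (@continuous2_cvg R _ _ _ (nbhs t) _ (cst (0 : 'rV[R]_d)) id (jv (deviation j)) 0 t
      ((is_jet_deviation j).1 (0, t)) (cvg_cst _) cvg_id).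
  have [c _ cP] := EVT_max T0 cn.
  by exists `|jv (deviation j) 0 c|; split => // t tT; apply: cP; rewrite in_itv.
have [A AP] := choice h.
have As j : A j <= \sum_i A i.
  by rewrite (bigD1 j) //= lerDl; apply: sumr_ge0 => i _; have [] := AP i.
have S0 (x : 'rV[R]_d) : 0 <= M * \sum_(i < d) `|x 0 i| by rewrite mulr_ge0 ?sumr_ge0.
have A0 : 0 <= \sum_i A i by apply: sumr_ge0 => i _; have [] := AP i.
(* The gradient bound covers positive times only; at t = 0 the initial bound e takes over. *)
exists (e + \sum_i A i), M; split => // j x t /andP[]; rewrite le_eqVlt => /orP[/eqP <- _|t0 tT].
  rewrite deviation_v // ui; have := S0 x; have := dot_coord_le j e0 (ue x); lra.
have [_ /(_ t) A1] := AP j.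
have {A1} : `|jv (deviation j) 0 t| <= A j by apply: A1; rewrite ltW.
have := As j.
suff : `|jv (deviation j) x t - jv (deviation j) 0 t| <= M * \sum_(i < d) `|x 0 i|.
  have := ler_normD (jv (deviation j) x t - jv (deviation j) 0 t) (jv (deviation j) 0 t).
  rewrite subrK => h1 h2 h3 h4; apply: (le_trans h1); rewrite addrC lerD //.
  by apply: (le_trans h4); apply: (le_trans h3); rewrite lerDr.
apply: (@lipschitz_of_partials _ _ (fun x => jv (deviation j) x t) (fun k x => jg (deviation j) k x t) M).
  by move=> y k; have [_ /(_ k)[]] := (is_jet_deviation j).2 y t t0.
move=> k y; rewrite /= addr0; apply: dot_coord_le => //.
apply: le_trans (MP y t _); last by rewrite t0.
by rewrite /energy (bigD1 k) //= lerDl; apply: sumr_ge0 => i _; exact: dot_ge0.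
Qed.

Context (ed : e <= delta / (2 * (m%:R + 1))).

(* A continuity argument would need [p] to be small uniformly at infinity; instead,
   [|F| <= M^2 / delta] keeps [p] below [delta^2] on time steps of fixed length. *)
Lemma flow_close_step (T M t0 : R) : 0 <= M -> 0 <= t0 ->
  (forall x t, 0 < t <= T -> energy u x t <= M ^+ 2) ->
  (forall x, jv sqdeviation x t0 <= e ^+ 2) ->
  forall x t, t0 <= t <= T -> t - t0 <= delta ^+ 2 / (2 * (m%:R + 1) * (M ^+ 2 + 1)) ->
  jv sqdeviation x t <= e ^+ 2.
Proof.
move=> M0 t00 MP init x t /andP[t0t tT] tt.
have T0 : 0 <= T by lra.
have [A [K [K0 grow]]] := flow_growth T0.
have m1 : 0 < m%:R + 1 :> R by rewrite ltr_wpDl.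
have M1 : 0 < M ^+ 2 + 1 by rewrite ltr_wpDl ?sqr_ge0.
have c0 : 0 <= M ^+ 2 / delta by rewrite divr_ge0 ?sqr_ge0 // ltW.
have one (sg : R) : `|sg| = 1 -> forall j x t, t0 <= t <= T ->
    sg * jv (deviation j) x t <= e + M ^+ 2 / delta * (t - t0).
  move=> sg1 j {x t t0t tT tt} x t tT.
  (* Each signed coordinate satisfies a heat equation with right-hand side at most M^2 / delta;
     removing this linear drift in time leaves a subsolution. *)
  pose J := jadd (jmul (jtime d sg 0) (deviation j)) (jtime d (M ^+ 2 / delta * t0) (- (M ^+ 2 / delta))).
  have jJ : is_jet J.
    apply: is_jet_add; last exact: is_jet_time.
    by apply: is_jet_mul; [exact: is_jet_time|exact: is_jet_deviation].
  have JE y s : jv J y s = sg * jv (deviation j) y s - M ^+ 2 / delta * (s - t0) by rewrite /=; ring.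
  suff : jv J x t <= e by rewrite JE; lra.
  apply: (@max_principle R d J e T t0 A K jJ t00 K0) => //.
  - move=> y; rewrite JE subrr mulr0 subr0; apply: (le_trans (ler_norm _)).
    rewrite normrM sg1 mul1r deviation_v //; apply: dot_coord_le => //.
    by rewrite -sqdeviation_v.
  - move=> y s /andP[s0 sT]; rewrite JE.
    have : 0 <= M ^+ 2 / delta * (s - t0) by rewrite mulr_ge0 ?subr_ge0.
    have := ler_norm (sg * jv (deviation j) y s); rewrite normrM sg1 mul1r.
    have := grow j y s; have -> : 0 <= s <= T by lra.
    by move=> /(_ isT); lra.
  - move=> y s /andP[s0 sT]; have sp : 0 < s by lra.
    rewrite heat_add heat_scale heat_time heat_deviation // subr_le0.
    apply: (le_trans (ler_norm _)); rewrite normrM sg1 mul1r.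
    rewrite ler_pdivlMr // mulrC; apply: (le_trans (force_bound d0 np hu y j sp)).
    by apply: MP; rewrite sp.
(* Each coordinate stays below delta / (m + 1), half of it from e and half from the step length, so
   that p <= m delta^2 / (m + 1)^2. *)
have pd y s : t0 <= s <= t -> jv sqdeviation y s <= delta ^+ 2.
  move=> /andP[s0 st]; have sT : t0 <= s <= T by lra.
  have sp : 0 <= s by lra.
  have b j : `|jv (deviation j) y s| <= delta / (m%:R + 1).
    have h1 : M ^+ 2 / delta * (s - t0) <= delta / (2 * (m%:R + 1)).
      apply: (@le_trans _ _ (M ^+ 2 / delta * (delta ^+ 2 / (2 * (m%:R + 1) * (M ^+ 2 + 1))))).
        by rewrite ler_wpM2l //; lra.
      have -> : M ^+ 2 / delta * (delta ^+ 2 / (2 * (m%:R + 1) * (M ^+ 2 + 1))) =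
         delta / (2 * (m%:R + 1)) * (M ^+ 2 / (M ^+ 2 + 1)).
        by field; rewrite !gt_eqF.
      apply: ler_piMr; first by rewrite divr_ge0 ?ltW // mulr_gt0.
      by rewrite ler_pdivrMr // mul1r lerDl.
    have h2 := one 1 (normr1 _) j y s sT; have h3 := one (-1) (normrN1 _) j y s sT.
    have -> : delta / (m%:R + 1) = delta / (2 * (m%:R + 1)) + delta / (2 * (m%:R + 1)).
      by field; rewrite gt_eqF.
    move: h1 h2 h3 ed; set D := delta / _; set v := jv (deviation j) y s.
    set c := M ^+ 2 / delta * (s - t0); move=> h1 h2 h3 h4.
    by rewrite ler_norml; apply/andP; split; lra.
  apply: (@le_trans _ _ (\sum_(j < m) (delta / (m%:R + 1)) ^+ 2)).
    apply: ler_sum => j _; rewrite -(real_normK (num_real (jv (deviation j) y s))).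
    by rewrite ler_pXn2r ?nnegrE ?divr_ge0 // ltW.
  rewrite sumr_const card_ord -(mulr_natr ((delta / _) ^+ 2)) expr_div_n mulrAC ler_pdivrMr ?exprn_gt0 //.
  rewrite ler_pM2l ?exprn_gt0 // expr2; have : 0 <= m%:R :> R by []; nra.
apply: (@max_principle R d sqdeviation (e ^+ 2) t t0 (delta ^+ 2) 0 is_jet_sqdeviation t00 (lexx _) init).
- by move=> y s sT; rewrite mul0r addr0; exact: pd.
- move=> y s /andP[s0 st]; apply: (le_trans (heat_sqdeviation_le _ _)); first lra.
    by apply: pd; lra.
  by rewrite oppr_le0; exact: energy_ge0.
- lra.
Qed.

(** The step length tau depends only on the gradient bound on [0, t], and each step returns the same
    bound e^2, so finitely many steps reach t without loss. *)
Lemma flow_close x t : 0 <= t -> dot (u x t - P) (u x t - P) <= e ^+ 2.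
Proof.
move=> t0; rewrite -sqdeviation_v //; move: x.
have [M M0 MP] := gradient_bound t.
set tau := delta ^+ 2 / (2 * (m%:R + 1) * (M ^+ 2 + 1)).
have tau0 : 0 < tau.
  have m1 : 0 < m%:R + 1 :> R by rewrite ltr_wpDl.
  have M1 : 0 < M ^+ 2 + 1 by rewrite ltr_wpDl ?sqr_ge0.
  by rewrite divr_gt0 ?exprn_gt0 // !mulr_gt0.
have [[Nu ui cu pu] _] := hu.
suff h n : forall x s, 0 <= s <= t -> s <= n%:R * tau -> jv sqdeviation x s <= e ^+ 2.
  move=> x; apply: (h (Num.truncn (t / tau)).+1); first by rewrite t0 lexx.
  by rewrite -ler_pdivrMr // ltW // truncnS_gt.
elim: n => [|n IH] x s /andP[s0 st] sn.
  have -> : s = 0 by lra.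
  by rewrite sqdeviation_v // ui.
have [sn'|sn'] := leP s (n%:R * tau); first by apply: IH => //; rewrite s0.
have n0 : 0 <= n%:R * tau by rewrite mulr_ge0 // ltW.
apply: (@flow_close_step t M (n%:R * tau) M0 n0 MP).
- by move=> y; apply: IH => //; rewrite n0 /=; lra.
- by rewrite st andbT ltW.
- by move: sn; rewrite -/tau -natr1; lra.
Qed.

End flow.

(** * Gradient decay by difference quotients *)

Lemma row_subE (R : realType) (m : nat) (a b : 'rV[R]_m) j : (a - b) 0 j = a 0 j - b 0 j.
Proof. by rewrite mxE mxE. Qed.

Lemma normr_dot_le (R : realType) (m : nat) (a b : 'rV[R]_m) : `|dot a b| <= enorm a * enorm b.
Proof.
have h1 := dot_le a b; have := dot_le (- a) b.
by rewrite dotNl enormN => h2; rewrite ler_norml lerNl h1 h2.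
Qed.

(* Cauchy-Schwarz and AM-GM, so that the cross term of [heat_mul] is absorbed
   by the good term [- 2 |W|^2] of [heat_sqincrement]. *)
Lemma cross_term_le (R : realType) (m : nat) (w W a1 a2 b1 b2 : 'rV[R]_m) (e l : R) :
  0 <= e -> 0 <= l -> dot a1 a1 <= e ^+ 2 -> dot a2 a2 <= e ^+ 2 ->
  - (2 * (2 * dot w W) * (l * (2 * dot a1 b1 + 2 * dot a2 b2))) <=
  2 * dot W W + 16 * l ^+ 2 * e ^+ 2 * dot w w * (dot b1 b1 + dot b2 b2).
Proof.
move=> e0 l0; rewrite -!sqr_enorm !ler_pXn2r ?nnegrE ?enorm_ge0 // => a1e a2e.
set Z := enorm w; set D := enorm W; set al := enorm b1; set be := enorm b2.
have [Z0 D0 al0 be0] : [/\ 0 <= Z, 0 <= D, 0 <= al & 0 <= be] by split; exact: enorm_ge0.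
have hX : `|dot w W| <= Z * D by exact: normr_dot_le.
have hY : `|dot a1 b1 + dot a2 b2| <= e * (al + be).
  apply: (le_trans (ler_normD _ _)); rewrite mulrDr; apply: lerD.
    by apply: (le_trans (normr_dot_le _ _)); rewrite ler_wpM2r.
  by apply: (le_trans (normr_dot_le _ _)); rewrite ler_wpM2r.
apply: (@le_trans _ _ (8 * l * (Z * D * (e * (al + be))))).
  have -> : - (2 * (2 * dot w W) * (l * (2 * dot a1 b1 + 2 * dot a2 b2))) =
     8 * l * (- (dot w W * (dot a1 b1 + dot a2 b2))) by ring.
  apply: ler_wpM2l; first by rewrite mulr_ge0.
  by apply: (le_trans (ler_norm _)); rewrite normrN normrM ler_pM.
rewrite -subr_ge0.
have -> : 2 * D ^+ 2 + 16 * l ^+ 2 * e ^+ 2 * Z ^+ 2 * (al ^+ 2 + be ^+ 2)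
    - 8 * l * (Z * D * (e * (al + be))) =
    2 * (D - 2 * l * e * Z * (al + be)) ^+ 2 + 8 * (l * e * Z * (al - be)) ^+ 2 by ring.
by rewrite addr_ge0 // mulr_ge0 // sqr_ge0.
Qed.

Lemma two_sided_le (R : realType) (A B c z a b : R) : 0 <= c ->
  2 * c * `|A| <= z * a -> 2 * c * `|B| <= z * b -> c * (2 * (A - B)) <= z * (a + b).
Proof.
move=> c0 h1 h2; rewrite [leRHS]mulrDr; apply: le_trans (lerD h1 h2).
rewrite -[leRHS]mulrDr mulrA [c * 2]mulrC; apply: ler_wpM2l; first exact: mulr_ge0.
by apply: (le_trans (ler_norm _)); exact: ler_normB.
Qed.

(** Up to the exponential factor, the heat operator is heat z + l z heat s - l^2 z |grad s|^2 - 2 l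
    <grad z, grad s>. The term - l z a coming from heat s is split in two halves, against the bad
    part of heat z and, together with - 2 D, against the cross term. *)
Lemma heat_twisted_le (R : realType) (d : nat) (z s : jet R d) (l D a : R) x t :
  0 <= l -> 0 <= jv z x t ->
  heat z x t <= l / 2 * (jv z x t * a) - 2 * D ->
  heat s x t <= - a ->
  - (2 * \sum_(k < d) jg z k x t * (l * jg s k x t)) <= 2 * D + l / 2 * (jv z x t * a) ->
  heat (jmul z (jexp (jmul (jtime d l 0) s))) x t <= 0.
Proof.
move=> l0 z0 hz hs hc.
rewrite heat_mul heat_exp heat_scale; set E := jv (jexp _) x t.
have E0 : 0 <= E by exact: expR_ge0.
have -> : expR (jv (jmul (jtime d l 0) s) x t) = E by [].
have -> : \sum_(k < d) jg z k x t * jg (jexp (jmul (jtime d l 0) s)) k x t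
  = (\sum_(k < d) jg z k x t * (l * jg s k x t)) * E.
  rewrite mulr_suml; apply: eq_bigr => k _; rewrite -mulrA; congr (_ * _).
  rewrite /E /=; ring.
set S := \sum_(k < d) _ ^+ 2; have S0 : 0 <= S by apply: sumr_ge0 => k _; exact: sqr_ge0.
set C := \sum_(k < d) _ in hc *.
have -> : heat z x t * E + jv z x t * ((l * heat s x t - S) * E) - 2 * (C * E) =
  (heat z x t + jv z x t * l * heat s x t - jv z x t * S - 2 * C) * E by ring.
rewrite mulr_le0_ge0 //.
have h1 := ler_wpM2l (mulr_ge0 z0 l0) hs.
have h2 := mulr_ge0 z0 S0.
have -> : 0 = (l / 2 * (jv z x t * a) - 2 * D) + jv z x t * l * - a - 0
    + (2 * D + l / 2 * (jv z x t * a)) :> R by field.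
by apply: lerD => //; apply: lerB => //; apply: lerD.
Qed.

Section flow.
Context (R : realType) (d m : nat) (N : set 'rV[R]_m) (delta : R) (pr : 'rV[R]_m -> 'rV[R]_m).
Context (u0 : 'rV[R]_d -> 'rV[R]_m) (u : 'rV[R]_d -> R -> 'rV[R]_m) (P : 'rV[R]_m).
Context (d0 : 0 < delta) (np : nearest_point_projection N delta pr).
Context (hu : harmonic_map_heat_flow N pr u0 u) (NP : N P).

Definition increment (h : 'rV[R]_d) (j : 'I_m) : jet R d :=
  jadd (jtrans h (ujet u j)) (jmul (jtime d (-1) 0) (ujet u j)).

Definition sqincrement (h : 'rV[R]_d) : jet R d := jsqnorm (increment h).

Lemma is_jet_increment h j : is_jet (increment h j).
Proof.
apply: is_jet_add; first by apply: is_jet_trans; exact: is_jet_u hu j.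
by apply: is_jet_mul; [exact: is_jet_time|exact: is_jet_u hu j].
Qed.

Lemma is_jet_sqincrement h : is_jet (sqincrement h).
Proof. exact: is_jet_sqnorm (is_jet_increment h). Qed.

Lemma increment_v h j x t : 0 <= t -> jv (increment h j) x t = (u (x + h) t - u x t) 0 j.
Proof. by move=> t0 /=; rewrite max_l // row_subE mul0r addr0 mulN1r. Qed.

Lemma sqincrement_v h x t : 0 <= t -> jv (sqincrement h) x t = dot (u (x + h) t - u x t) (u (x + h) t - u x t).
Proof.
by move=> t0; apply: eq_bigr => j _; rewrite -/(jv (increment h j) x t) increment_v // expr2.
Qed.

Definition increment_partial (h : 'rV[R]_d) (k : 'I_d) (x : 'rV[R]_d) (t : R) : 'rV[R]_m :=
  partial k (u ^~ t) (x + h) - partial k (u ^~ t) x.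

Lemma increment_g h j k x t : jg (increment h j) k x t = increment_partial h k x t 0 j.
Proof. by rewrite /increment_partial row_subE /= mul0r add0r mul0r addr0 mulN1r. Qed.

Lemma sqincrement_g h k x t : 0 <= t ->
  jg (sqincrement h) k x t = 2 * dot (u (x + h) t - u x t) (increment_partial h k x t).
Proof.
move=> t0; rewrite mulr_sumr; apply: eq_bigr => j _.
by rewrite -/(jg (increment h j) k x t) increment_v // increment_g mulrA.
Qed.

Lemma sqdeviation_g k x t : 0 <= t ->
  jg (sqdeviation u P) k x t = 2 * dot (u x t - P) (partial k (u ^~ t) x).
Proof.
move=> t0; rewrite mulr_sumr; apply: eq_bigr => j _.
by rewrite -/(jg (deviation u P j) k x t) deviation_v //= addr0 mulrA.
Qed.

(** The force at x + h is tested with the point u(x) of N and the force at x with u(x + h), so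
    [force_dot] makes both pairings quadratic in the increment. *)
Lemma heat_sqincrement h x t : 0 < t -> delta ^+ 2 * heat (sqincrement h) x t <=
  jv (sqincrement h) x t * (energy u (x + h) t + energy u x t)
    - delta ^+ 2 * (2 * \sum_(k < d) dot (increment_partial h k x t) (increment_partial h k x t)).
Proof.
move=> t0; have [[Nu _ _ _] _] := hu.
rewrite (sqincrement_v h x (ltW t0)) heat_sqnorm mulrBr.
set D := \sum_(k < d) dot _ _.
have -> : \sum_(k < d) \sum_(i < m) jg (increment h i) k x t ^+ 2 = D.
  by apply: eq_bigr => k _; apply: eq_bigr => j _; rewrite increment_g expr2.
rewrite lerD2r.
set w := u (x + h) t - u x t.
have -> : \sum_(i < m) jv (increment h i) x t * heat (increment h i) x t =
    dot w (force pr u (x + h) t - force pr u x t).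
  apply: eq_bigr => j _; rewrite increment_v ?ltW // heat_add heat_trans heat_scale.
  by rewrite (heat_u hu j (x + h) t0) (heat_u hu j x t0) (row_subE (force _ _ _ _)) mulN1r.
have h1 := force_dot d0 np hu (x + h) t0 (Nu x t (ltW t0)).
have h2 := force_dot d0 np hu x t0 (Nu (x + h) t (ltW t0)).
move: h1; have -> : u x t - u (x + h) t = - w by rewrite opprB.
rewrite dotNl !(dotNl, dotNr) opprK normrN => h1.
rewrite dotDr dotNr.
exact: (two_sided_le (sqr_ge0 delta) h1 h2).
Qed.

Context (e : R) (e0 : 0 <= e) (ue : forall x, dot (u0 x - P) (u0 x - P) <= e ^+ 2).
Context (ed : e <= delta / (2 * (m%:R + 1))) (ed8 : e <= delta / 8).

Definition sqdeviation_pair (h : 'rV[R]_d) : jet R d := jadd (sqdeviation u P) (jtrans h (sqdeviation u P)).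

Definition twisted (h : 'rV[R]_d) : jet R d :=
  jmul (sqincrement h) (jexp (jmul (jtime d (2 / delta ^+ 2) 0) (sqdeviation_pair h))).

Lemma is_jet_sqdeviation_pair h : is_jet (sqdeviation_pair h).
Proof.
by apply: is_jet_add; [exact: is_jet_sqdeviation hu|apply: is_jet_trans; exact: is_jet_sqdeviation hu].
Qed.

Lemma is_jet_twisted h : is_jet (twisted h).
Proof.
apply: is_jet_mul; first exact: is_jet_sqincrement.
by apply: is_jet_exp; apply: is_jet_mul; [exact: is_jet_time|exact: is_jet_sqdeviation_pair].
Qed.

Lemma sqdeviation_le x t : 0 <= t -> 0 <= jv (sqdeviation u P) x t <= e ^+ 2.
Proof.
by move=> t0; rewrite sqdeviation_v // dot_ge0 (flow_close d0 np hu NP e0 ue ed).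
Qed.

Lemma e2_le : e ^+ 2 <= delta ^+ 2 / 64.
Proof.
have -> : delta ^+ 2 / 64 = (delta / 8) ^+ 2 by field.
by rewrite ler_pXn2r ?nnegrE // divr_ge0 // ltW.
Qed.

Lemma sqdeviation_pair_g h k x t : 0 <= t -> jg (sqdeviation_pair h) k x t =
  2 * dot (u x t - P) (partial k (u ^~ t) x)
  + 2 * dot (u (x + h) t - P) (partial k (u ^~ t) (x + h)).
Proof. by move=> t0; rewrite -(sqdeviation_g k x t0) -(sqdeviation_g k (x + h) t0). Qed.

Lemma heat_twisted h x t : 0 < t -> heat (twisted h) x t <= 0.
Proof.
move=> t0; have t0' := ltW t0.
set l := 2 / delta ^+ 2; have l0 : 0 <= l by rewrite divr_ge0 // sqr_ge0.
have d2 : 0 < delta ^+ 2 by rewrite exprn_gt0.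
have e2 := e2_le.
have z0 : 0 <= jv (sqincrement h) x t by rewrite sqincrement_v // dot_ge0.
have a0 : 0 <= energy u (x + h) t + energy u x t by rewrite addr_ge0 // energy_ge0.
have pd y : jv (sqdeviation u P) y t <= delta ^+ 2.
  have /andP[_ h1] := sqdeviation_le y t0'; apply: (le_trans h1); apply: (le_trans e2).
  by rewrite ler_pdivrMr // ler_peMr ?sqr_ge0 // ler1n.
apply: (@heat_twisted_le _ _ (sqincrement h) (sqdeviation_pair h) l
  (\sum_(k < d) dot (increment_partial h k x t) (increment_partial h k x t)) (energy u (x + h) t + energy u x t)) => //.
- rewrite -(ler_pM2l d2); apply: (le_trans (heat_sqincrement h x t0)); rewrite [leRHS]mulrBr lerD2r.
  move: (jv _ x t * _) => q; rewrite /l.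
  have -> : delta ^+ 2 * (2 / delta ^+ 2 / 2 * q) = q by field; rewrite gt_eqF.
  by [].
- rewrite [leRHS]opprD [leRHS]addrC.
  have -> : heat (sqdeviation_pair h) x t = heat (sqdeviation u P) x t + heat (sqdeviation u P) (x + h) t.
    exact: heat_add.
  exact: lerD (heat_sqdeviation_le d0 np hu NP t0 (pd x)) (heat_sqdeviation_le d0 np hu NP t0 (pd (x + h))).
(* With l = 2 / delta^2 this is exactly e^2 <= delta^2 / 64: the cross term fits in half of the
   budget. *)
have hl : 16 * l ^+ 2 * e ^+ 2 <= l / 2.
  have -> : l / 2 = 16 * l ^+ 2 * (delta ^+ 2 / 64) by rewrite /l; field; rewrite gt_eqF.
  by rewrite ler_wpM2l // mulr_ge0 // sqr_ge0.
have hl2 := ler_wpM2r (mulr_ge0 z0 a0) hl.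
apply: (le_trans _ (lerD (lexx _) hl2)).
rewrite {hl2 hl z0} sqincrement_v //.
apply: (@le_trans _ _ (\sum_(k < d) (2 * dot (increment_partial h k x t) (increment_partial h k x t) +
    16 * l ^+ 2 * e ^+ 2 * dot (u (x + h) t - u x t) (u (x + h) t - u x t) *
    (dot (partial k (u ^~ t) x) (partial k (u ^~ t) x) +
     dot (partial k (u ^~ t) (x + h)) (partial k (u ^~ t) (x + h)))))).
  rewrite mulr_sumr -sumrN; apply: ler_sum => k _.
  rewrite sqincrement_g // sqdeviation_pair_g // mulrA; apply: cross_term_le => //.
    by rewrite -sqdeviation_v //; have /andP[] := sqdeviation_le x t0'.
  by rewrite -sqdeviation_v //; have /andP[] := sqdeviation_le (x + h) t0'.
rewrite big_split /= -!mulr_sumr big_split /= lerD2l.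
by rewrite [energy u (x + h) t + _]addrC mulrA.
Qed.

End flow.

(** Uniform continuity along one axis. The shifted points may leave K, so continuity is taken in the
    whole space at the points of K, and a covering argument yields a common s. *)
Lemma compact_axis_continuity (R : realType) (d : nat) (k : 'I_d) (K : set ('rV[R]_d * R))
    (g : 'rV[R]_d * R -> R) (w : R) :
  0 < w -> compact K -> (forall z, K z -> {for z, continuous g}) ->
  \forall s \near (0 : R), forall z, K z -> forall r : R, `|r| <= `|s| ->
    g (z.1 + r *: basis_vec R k, z.2) <= g z + w.
Proof.
move=> w0 /compact_near_coveringP Kc gc.
apply: (Kc R (nbhs (0 : R)) (fun s z => forall r : R, `|r| <= `|s| ->
    g (z.1 + r *: basis_vec R k, z.2) <= g z + w)) => z /gc.
move=> /cvgrPdist_lt /(_ (w / 2)); rewrite divr_gt0 // => /(_ isT).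
case/nbhs_ballP => r /= r0 hr.
have r2 : 0 < r / 2 by rewrite divr_gt0.
exists (ball z (r / 2), ball (0 : R) (r / 2)); first by split; exact: nbhsx_ballx.
case=> -[x' t'] s [/= [/= bx bt]]; rewrite /ball /= sub0r normrN => hs q qs.
have h1 : `|g z - g (x', t')| < w / 2.
  apply: hr; split => /=; [apply: le_ball bx|apply: le_ball bt]; lra.
have h2 : `|g z - g (x' + q *: basis_vec R k, t')| < w / 2.
  apply: hr; split => /=; last by apply: le_ball bt; lra.
  rewrite (splitr r); apply: (ball_triangle bx).
  split=> // i j; rewrite /ball /= !mxE opprD addrA subrr sub0r normrN normrM.
  apply: le_lt_trans (le_lt_trans qs hs).
  by case: (_ && _); rewrite ?normr1 ?normr0 ?mulr1 ?mulr0.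
move: h1 h2; rewrite !ltr_distl; lra.
Qed.

Lemma limit_quotient_le (R : realType) (m : nat) (c : R -> 'rV[R]_m) (l : 'rV[R]_m) (D : R) :
  is_derive (0 : R) 1 c l ->
  (\forall s \near (0 : R)^', dot (c s - c 0) (c s - c 0) <= s ^+ 2 * D) -> dot l l <= D.
Proof.
move=> /is_derive_coordP dc hD.
have q i : (fun s : R => s^-1 * (c s 0 i - c 0 0 i)) @ (0 : R)^' --> l 0 i.
  have /is_deriveP[/cvg_ex[l' lP] dl] := dc i.
  have <- : l' = l 0 i by rewrite -dl /derive; apply/esym/cvg_lim.
  have := lP; under eq_fun do rewrite /= addr0 [_ *: 1]mulr1.
  by [].
have qs : (fun s : R => \sum_(i < m) (s^-1 * (c s 0 i - c 0 0 i)) * (s^-1 * (c s 0 i - c 0 0 i)))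
    @ (0 : R)^' --> \sum_(i < m) l 0 i * l 0 i.
  by apply: cvg_sumr => i; apply: cvgM.
rewrite /dot -(cvg_lim _ qs) //; apply: limr_le; first exact: cvgP qs.
move: hD; rewrite !near_withinE; apply: filterS => s hs sn0.
have := hs sn0; rewrite /dot => {}hs.
have s2 : 0 < s ^+ 2 by rewrite exprn_even_gt0.
rewrite -(ler_pM2l s2) mulr_sumr; apply: le_trans hs; apply: ler_sum => i _.
rewrite !mxE; have -> : s ^+ 2 * (s^-1 * (c s 0 i - c 0 0 i) * (s^-1 * (c s 0 i - c 0 0 i))) =
  (c s 0 i - c 0 0 i) * (c s 0 i - c 0 0 i) by field.
by [].
Qed.

Section flow.
Context (R : realType) (d m : nat) (N : set 'rV[R]_m) (delta : R) (pr : 'rV[R]_m -> 'rV[R]_m).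
Context (u0 : 'rV[R]_d -> 'rV[R]_m) (u : 'rV[R]_d -> R -> 'rV[R]_m) (P : 'rV[R]_m).
Context (d0 : 0 < delta) (np : nearest_point_projection N delta pr).
Context (hu : harmonic_map_heat_flow N pr u0 u) (NP : N P).

Lemma partial_continuous (k : 'I_d) (j : 'I_m) (z : 'rV[R]_d * R) : 0 < z.2 ->
  {for z, continuous (fun z : 'rV[R]_d * R => (partial k (u ^~ z.2) z.1 0 j) ^+ 2)}.
Proof.
move=> z0; have [[_ _ _ pu] _] := hu; have [_ [_ ck _]] := pu z z0.
have h : {for z, continuous (fun z : 'rV[R]_d * R => partial k (u ^~ z.2) z.1 0 j)}.
  apply: (@continuous_comp _ _ _ (fun z : 'rV[R]_d * R => partial k (u ^~ z.2) z.1)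
    (fun v : 'rV[R]_m => v 0 j)); first exact: ck.
  exact: coord_continuous.
exact: (cvgM h h).
Qed.

(** By the mean value theorem each coordinate of the increment is s times a partial derivative at an
    intermediate point, which is compared with the one at x uniformly on a compact set. The lower
    bound t0 > 0 is there because the gradient is continuous at positive times only. *)
Lemma difference_quotient_le (k : 'I_d) (r t0 T w : R) : 0 < w -> 0 < t0 ->
  \forall s \near (0 : R), forall (x : 'rV[R]_d) (t : R), (forall i, `|x 0 i| <= r) -> t0 <= t <= T ->
  jv (sqincrement u (s *: basis_vec R k)) x t <= s ^+ 2 * (energy u x t + w).
Proof.
move=> w0 t00.
have m1 : 0 < m%:R + 1 :> R by rewrite ltr_wpDl.
have w1 : 0 < w / (m%:R + 1) by rewrite divr_gt0.
pose K := [set x : 'rV[R]_d | forall i, `[- r, r]%classic (x ord0 i)] `*` `[t0, T]%classic.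
have Kc : compact K.
  apply: (@compact_setX 'rV[R]_d R); last exact: segment_compact.
  by apply: (@rV_compact R d (fun=> _)) => i; exact: segment_compact.
have Kp z : K z -> 0 < z.2 by case=> _; rewrite /= in_itv /= => /andP[h _]; lra.
have : \forall s \near (0 : R), forall j, forall z, K z -> forall q : R, `|q| <= `|s| ->
    (partial k (u ^~ z.2) (z.1 + q *: basis_vec R k) 0 j) ^+ 2 <=
    (partial k (u ^~ z.2) z.1 0 j) ^+ 2 + w / (m%:R + 1).
  apply: (@filter_forall R 'I_m (fun j s => forall z, K z -> forall q : R, `|q| <= `|s| ->
    (partial k (u ^~ z.2) (z.1 + q *: basis_vec R k) 0 j) ^+ 2 <=
    (partial k (u ^~ z.2) z.1 0 j) ^+ 2 + w / (m%:R + 1)) (nbhs (0 : R))) => j.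
  apply: (compact_axis_continuity k (g := fun z => (partial k (u ^~ z.2) z.1 0 j) ^+ 2) w1 Kc).
  by move=> z /Kp; exact: partial_continuous.
apply: filterS => s hs x t xr tT.
have tp : 0 < t by lra.
have Kx : K (x, t) by split => [i|] /=; rewrite in_itv //= -ler_norml.
have [_ dc _] := curve_u hu k x tp.
rewrite (sqincrement_v _ _ _ (ltW tp)).
have e1 : dot (partial k (u ^~ t) x) (partial k (u ^~ t) x) <= energy u x t.
  by rewrite /energy (bigD1 k) //= lerDl; apply: sumr_ge0 => i _; exact: dot_ge0.
apply: (@le_trans _ _ (s ^+ 2 * (dot (partial k (u ^~ t) x) (partial k (u ^~ t) x) + w))); last first.
  by rewrite ler_wpM2l ?sqr_ge0 // lerD2r.
apply: (@le_trans _ _ (\sum_(j < m) s ^+ 2 * ((partial k (u ^~ t) x 0 j) ^+ 2 + w / (m%:R + 1)))); last first.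
  rewrite -mulr_sumr ler_wpM2l ?sqr_ge0 // big_split /= sumr_const card_ord.
  apply: lerD; first by rewrite /dot; apply: ler_sum => j _; rewrite expr2.
  rewrite -(mulr_natr (w / _)) mulrAC ler_pdivrMr // ler_pM2l //; lra.
apply: ler_sum => j _; rewrite -expr2 row_subE.
pose f q := u (x + q *: basis_vec R k) t 0 j.
have df (q : R) : is_derive q 1 f (partial k (u ^~ t) (x + q *: basis_vec R k) 0 j).
  by have /is_derive_coordP/(_ j) := dc q.
have f0 : u x t 0 j = f 0 by rewrite /f scale0r addr0.
have cl a b : {within `[a, b], continuous f}.
  by apply: derivable_within_continuous => q _; have /is_deriveP[] := df q.
rewrite f0 -/(f s).
have fin c : `|c| <= `|s| -> f s - f 0 = partial k (u ^~ t) (x + c *: basis_vec R k) 0 j * s ->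
    (f s - f 0) ^+ 2 <= s ^+ 2 * (partial k (u ^~ t) x 0 j ^+ 2 + w / (m%:R + 1)).
  move=> cs ->; rewrite exprMn mulrC ler_wpM2l ?sqr_ge0 //.
  exact: (hs j _ Kx c cs).
have [s0|s0|s0] := ltgtP s 0.
- have [c] := MVT s0 (fun q _ => df q) (cl _ _); rewrite in_itv /= => /andP[c1 c2] E.
  apply: (fin c); first by rewrite !ltr0_norm // lerN2 ltW.
  by rewrite -opprB E sub0r mulrN opprK.
- have [c] := MVT s0 (fun q _ => df q) (cl _ _); rewrite in_itv /= => /andP[c1 c2] E.
  apply: (fin c); first by rewrite !gtr0_norm // ltW.
  by rewrite E subr0.
- by rewrite s0 subrr expr0n /= mul0r.
Qed.

Context (e L : R) (e0 : 0 <= e) (ue : forall x, dot (u0 x - P) (u0 x - P) <= e ^+ 2).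
Context (ed : e <= delta / (2 * (m%:R + 1))) (ed8 : e <= delta / 8).
Context (uL : forall (k : 'I_d) (x : 'rV[R]_d) (s : R), dot (u0 (x + s *: basis_vec R k) - u0 x)
  (u0 (x + s *: basis_vec R k) - u0 x) <= (L * s) ^+ 2).

Lemma sqincrement_le_twisted h x t : 0 <= t ->
  jv (sqincrement u h) x t <= jv (twisted delta u P h) x t <= expR 1 * jv (sqincrement u h) x t.
Proof.
move=> t0; have z0 : 0 <= jv (sqincrement u h) x t by rewrite sqincrement_v // dot_ge0.
have -> : jv (twisted delta u P h) x t =
  jv (sqincrement u h) x t * expR ((2 / delta ^+ 2 + 0 * t) * (jv (sqdeviation u P) x t + jv (sqdeviation u P) (x + h) t)) by [].
rewrite mul0r addr0.
have /andP[p1 p2] := sqdeviation_le d0 np hu NP e0 ue ed x t0.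
have /andP[p3 p4] := sqdeviation_le d0 np hu NP e0 ue ed (x + h) t0.
have d2 : 0 < delta ^+ 2 by rewrite exprn_gt0.
have ee := e2_le d0 e0 ed8.
have l0 : 0 <= 2 / delta ^+ 2 by rewrite divr_ge0 // sqr_ge0.
apply/andP; split.
  rewrite ler_peMr // -[leLHS]expR0 ler_expR; apply: mulr_ge0 => //; exact: addr_ge0.
rewrite mulrC ler_wpM2r // ler_expR.
(* Both deviations are at most delta^2 / 64, so the exponent is at most 1 / 16, well below 1. *)
apply: (@le_trans _ _ (2 / delta ^+ 2 * (delta ^+ 2 / 64 + delta ^+ 2 / 64))).
  by rewrite ler_wpM2l // lerD // (le_trans _ ee).
have -> : 2 / delta ^+ 2 * (delta ^+ 2 / 64 + delta ^+ 2 / 64) = 16^-1 by field; rewrite gt_eqF.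
by rewrite invf_le1 // ler1n.
Qed.

Lemma sqincrement_bounded h x t : 0 <= t -> jv (sqincrement u h) x t <= 4 * e ^+ 2.
Proof.
move=> t0; rewrite sqincrement_v //.
have h1 := flow_close d0 np hu NP e0 ue ed x t0.
have h2 := flow_close d0 np hu NP e0 ue ed (x + h) t0.
have -> : u (x + h) t - u x t = (u (x + h) t - P) - (u x t - P) by rewrite opprB addrA subrK.
move: (u (x + h) t - P) (u x t - P) h1 h2 => a b h1 h2.
have := dot_ge0 (a + b); rewrite !dotE (dotC b a); lra.
Qed.

(** The Lipschitz bound without decay. In [gradient_decay] it bounds the weighted sum at the
    starting time t0 and outside a large cube. *)
Lemma twisted_le k s x t : 0 <= t ->
  jv (twisted delta u P (s *: basis_vec R k)) x t <= expR 1 * (L * s) ^+ 2.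
Proof.
move=> t0; have [[_ ui _ _] _] := hu.
apply: (@max_principle R d (twisted delta u P (s *: basis_vec R k)) (expR 1 * (L * s) ^+ 2) t 0
  (expR 1 * (4 * e ^+ 2)) 0 (is_jet_twisted delta P hu (s *: basis_vec R k)) (lexx 0) (lexx 0) _ _ _ x t).
- move=> y; have /andP[_ h1] := sqincrement_le_twisted (s *: basis_vec R k) y (lexx 0).
  apply: (le_trans h1); rewrite ler_wpM2l ?expR_ge0 // sqincrement_v // !ui; exact: uL.
- move=> y q /andP[q0 _]; have /andP[_ h1] := sqincrement_le_twisted (s *: basis_vec R k) y q0.
  rewrite mul0r addr0; apply: (le_trans h1).
  by rewrite ler_wpM2l ?expR_ge0 // sqincrement_bounded.
- by move=> y q /andP[q0 _]; exact: (heat_twisted d0 np hu NP e0 ue ed ed8).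
- by rewrite t0 lexx.
Qed.

End flow.

Definition weighted_sum (R : realType) (d : nat) (c : R) (a b : jet R d) : jet R d :=
  jadd (jmul (jtime d 1 1) a) (jmul (jtime d c 0) b).

Lemma weighted_sum_v (R : realType) (d : nat) (c : R) (a b : jet R d) x t :
  jv (weighted_sum c a b) x t = (1 + t) * jv a x t + c * jv b x t.
Proof. by rewrite /=; ring. Qed.

Lemma heat_weighted_sum (R : realType) (d : nat) (c : R) (a b : jet R d) x t :
  heat (weighted_sum c a b) x t = jv a x t + (1 + t) * heat a x t + c * heat b x t.
Proof.
rewrite heat_add heat_scale heat_mul heat_time big1 => [|k _]; last exact: mul0r.
by rewrite /=; ring.
Qed.

Lemma is_jet_weighted_sum (R : realType) (d : nat) (c : R) (a b : jet R d) :
  is_jet a -> is_jet b -> is_jet (weighted_sum c a b).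
Proof.
by move=> ja jb; apply: is_jet_add; apply: is_jet_mul => //; exact: is_jet_time.
Qed.

Section flow.
Context (R : realType) (d m : nat) (N : set 'rV[R]_m) (delta : R) (pr : 'rV[R]_m -> 'rV[R]_m).
Context (u0 : 'rV[R]_d -> 'rV[R]_m) (u : 'rV[R]_d -> R -> 'rV[R]_m) (P : 'rV[R]_m).
Context (d0 : 0 < delta) (np : nearest_point_projection N delta pr).
Context (hu : harmonic_map_heat_flow N pr u0 u) (NP : N P).
Context (e L : R) (e0 : 0 <= e) (ue : forall x, dot (u0 x - P) (u0 x - P) <= e ^+ 2).
Context (ed : e <= delta / (2 * (m%:R + 1))) (ed8 : e <= delta / 8).
Context (uL : forall (k : 'I_d) (x : 'rV[R]_d) (s : R), dot (u0 (x + s *: basis_vec R k) - u0 x)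
  (u0 (x + s *: basis_vec R k) - u0 x) <= (L * s) ^+ 2).

(** In the heat operator of (1 + t) X + c s^2 p, with c = exp 1, the weight contributes X, at most c
    s^2 (energy + w) on the cube, and p contributes at most - c s^2 energy. Only c s^2 w remains,
    below the slack of [heat_max]; dividing by s^2 and letting s tend to 0 gives the derivative. *)
Lemma gradient_decay k x t : 0 < t ->
  (1 + t) * dot (partial k (u ^~ t) x) (partial k (u ^~ t) x) <= expR 1 * (2 * L ^+ 2 + e ^+ 2).
Proof.
move=> tp; set E1 : R := expR 1; have E10 : 0 < E1 by exact: expR_gt0.
have t1 : 0 < 1 + t by lra.
have L2 : 0 <= L ^+ 2 by exact: sqr_ge0.
apply/ler_addgt0Pr => eta eta0.
pose W := \sum_(i < d) x 0 i ^+ 2 + (2 * d%:R + 1) * t.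
have W0 : 0 <= W.
  rewrite addr_ge0 ?sumr_ge0 // => [i _|]; first exact: sqr_ge0.
  by rewrite mulr_ge0 ?addr_ge0 // ltW.
(* The slack is s^2 h, so the barrier costs at most s^2 eta at the given point (x, t). *)
pose h := eta / (W + 1).
have W1 : 0 < W + 1 by lra.
have h0 : 0 < h by rewrite divr_gt0.
have hW : h * W <= eta by rewrite /h mulrAC ler_pdivrMr // ler_pM2l //; lra.
(* Positive, so that gradients are continuous on [t0, t]; at most 1, so that the weight 1 + t0 at
   the starting time is at most 2. *)
pose t0 := Num.min 1 (t / 2).
have [t00 t01 t0t] : [/\ 0 < t0, t0 <= 1 & t0 < t].
  have h1 : t0 <= 1 by rewrite ge_min lexx.
  have h2 : t0 <= t / 2 by rewrite ge_min lexx orbT.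
  by split => //; [rewrite lt_min ltr01 divr_gt0|lra].
(* The uncancelled error E1 s^2 w is then half of the slack s^2 h. *)
pose w := h / (2 * E1).
have w0 : 0 < w by rewrite divr_gt0 // mulr_gt0.
(* Beyond r the barrier h |y|^2 exceeds (1 + t) E1 L^2, the bound of (1 + t) X divided by s^2. None
   of these parameters depends on s. *)
pose r := 1 + (1 + t) * E1 * L ^+ 2 / h.
have q0 : 0 <= (1 + t) * E1 * L ^+ 2 / h.
  apply: divr_ge0; last exact: ltW.
  by apply: mulr_ge0 => //; apply: mulr_ge0; exact: ltW.
rewrite mulrC -ler_pdivlMr //.
have [Nu du _] := curve_u hu k x tp.
apply: (limit_quotient_le (c := fun s => u (x + s *: basis_vec R k) t)).
  by have := du 0; rewrite scale0r addr0.
have := difference_quotient_le hu k r t w0 t00.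
rewrite near_withinE; apply: filterS => s hs sn0.
have s2 : 0 < s ^+ 2 by rewrite exprn_even_gt0.
rewrite scale0r addr0 -(sqincrement_v u (s *: basis_vec R k) x (ltW tp)).
set H := s *: basis_vec R k.
pose Y := weighted_sum (E1 * s ^+ 2) (twisted delta u P H) (sqdeviation u P).
have jY : is_jet Y.
  by apply: is_jet_weighted_sum; [exact: (is_jet_twisted delta P hu H)|exact: (is_jet_sqdeviation P hu)].
have Xle y q : 0 <= q -> jv (twisted delta u P H) y q <= E1 * (L * s) ^+ 2.
  exact: (twisted_le d0 np hu NP e0 ue ed ed8 uL).
have pe y q : 0 <= q -> 0 <= jv (sqdeviation u P) y q <= e ^+ 2.
  exact: (sqdeviation_le d0 np hu NP e0 ue ed).
have cs : 0 <= E1 * s ^+ 2 by rewrite mulr_ge0 // ltW.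
(* Used with c = 1 + t0 at the starting time and with c = 1 + t far from the origin. *)
have YB y q c : 0 <= q -> 1 + q <= c ->
    jv Y y q <= c * (E1 * (L * s) ^+ 2) + E1 * s ^+ 2 * e ^+ 2.
  move=> q0' qc; rewrite weighted_sum_v; apply: lerD; last first.
    by apply: ler_wpM2l => //; have /andP[] := pe y q q0'.
  have q1 : 0 <= 1 + q by lra.
  apply: (le_trans (ler_wpM2l q1 (Xle y q q0'))).
  by apply: ler_wpM2r => //; rewrite mulr_ge0 ?sqr_ge0 // ltW.
pose B := (1 + t0) * (E1 * (L * s) ^+ 2) + E1 * s ^+ 2 * e ^+ 2.
have key := @heat_max R d Y B (s ^+ 2 * h) t t0 r jY (ltW t00) (mulr_gt0 s2 h0) _ _ _ x t.
have {key} : jv Y x t <= B + s ^+ 2 * h * (\sum_(i < d) x 0 i ^+ 2 + (2 * d%:R + 1) * (t - t0)).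
  apply: key; last by rewrite lexx ltW.
  - by move=> y; apply: YB; [exact: ltW|].
  - move=> y q /andP[q1 q2] [i ri].
    apply: (le_trans (YB y q (1 + t) _ _)); [lra|lra|].
    have yr : r <= \sum_(i < d) y 0 i ^+ 2.
      rewrite (bigD1 i) //=; apply: ler_wpDr.
        by apply: sumr_ge0 => l _; exact: sqr_ge0.
      rewrite -(real_normK (num_real (y 0 i))) expr2.
      apply: (le_trans (ltW ri)); rewrite ler_peMl //.
      by apply: le_trans (ltW ri); rewrite /r lerDl.
    have h1 : (1 + t) * E1 * L ^+ 2 <= h * \sum_(i < d) y 0 i ^+ 2.
      rewrite [h * _]mulrC -ler_pdivrMr //; apply: le_trans yr; rewrite /r lerDr //.
    have h2 := ler_wpM2l (ltW s2) h1.
    have b0 : 0 <= (1 + t0) * (E1 * (L * s) ^+ 2).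
      apply: mulr_ge0; first by rewrite addr_ge0 // ltW.
      by apply: mulr_ge0; [exact: ltW|exact: sqr_ge0].
    have -> : (1 + t) * (E1 * (L * s) ^+ 2) = s ^+ 2 * ((1 + t) * E1 * L ^+ 2) by ring.
    apply: (le_trans (lerD h2 (lexx (E1 * s ^+ 2 * e ^+ 2)))).
    by rewrite /B -[s ^+ 2 * h * _]mulrA [leRHS]addrAC lerD2r lerDr.
  - move=> y q /andP[q1 q2] yr; have qp : 0 < q by lra.
    rewrite heat_weighted_sum.
    have /andP[_ x1] := sqincrement_le_twisted d0 np hu NP e0 ue ed ed8 H y (ltW qp).
    have hX := heat_twisted d0 np hu NP e0 ue ed ed8 H y qp.
    have pd : jv (sqdeviation u P) y q <= delta ^+ 2.
      have /andP[_ p2] := pe y q (ltW qp); apply: (le_trans p2).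
      apply: (le_trans (e2_le d0 e0 ed8)).
      by rewrite ler_pdivrMr // ler_peMr ?sqr_ge0 // ler1n.
    have hp := ler_wpM2l cs (heat_sqdeviation_le d0 np hu NP qp pd).
    have q1' : 0 <= 1 + q by lra.
    have hX' : (1 + q) * heat (twisted delta u P H) y q <= 0 by exact: mulr_ge0_le0.
    have tq : t0 <= q <= t by rewrite (ltW q1).
    have x2 := ler_wpM2l (ltW E10) (hs y q yr tq).
    (* The energy coming from the weight cancels against the one dissipated by p. *)
    apply: (@le_lt_trans _ _ (E1 * (s ^+ 2 * (energy u y q + w)) + 0 + E1 * s ^+ 2 * - energy u y q)).
      by apply: lerD => //; apply: lerD => //; exact: le_trans x1 x2.
    have -> : E1 * (s ^+ 2 * (energy u y q + w)) + 0 + E1 * s ^+ 2 * - energy u y q = s ^+ 2 * h / 2.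
      by rewrite /w; move: (energy u y q) => en; field; rewrite gt_eqF.
    by move: (mulr_gt0 s2 h0); move: (s ^+ 2 * h) => v; lra.
move=> yb.
have /andP[zX _] := sqincrement_le_twisted d0 np hu NP e0 ue ed ed8 H x (ltW tp).
apply: (le_trans zX); rewrite mulrA ler_pdivlMr // mulrC.
have c0 := mulr_ge0 cs (andP (pe x t (ltW tp))).1.
have : (1 + t) * jv (twisted delta u P H) x t <= jv Y x t by rewrite weighted_sum_v lerDl.
move=> xy; apply: (le_trans xy); apply: (le_trans yb).
have hW' : h * (\sum_(i < d) x 0 i ^+ 2 + (2 * d%:R + 1) * (t - t0)) <= eta.
  apply: le_trans hW; apply: ler_wpM2l; first exact: ltW.
  rewrite /W lerD2l; apply: ler_wpM2l; first by rewrite addr_ge0.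
  lra.
have h2 := ler_wpM2l (ltW s2) hW'.
rewrite -[s ^+ 2 * h * _]mulrA [leRHS]mulrDr; apply: lerD => //.
rewrite /B exprMn.
have -> : (1 + t0) * (E1 * (L ^+ 2 * s ^+ 2)) + E1 * s ^+ 2 * e ^+ 2 =
  s ^+ 2 * (E1 * ((1 + t0) * L ^+ 2 + e ^+ 2)) by ring.
apply: ler_wpM2l; first exact: ltW.
apply: ler_wpM2l; first exact: ltW.
rewrite lerD2r; apply: ler_wpM2r => //; lra.
Qed.

Lemma gradient_initial k x : dot (partial k (u ^~ 0) x) (partial k (u ^~ 0) x) <= L ^+ 2.
Proof.
have [[_ ui _ _] _] := hu.
have -> : u ^~ 0 = u0 by apply/funext.
(* The initial map is only known to be Lipschitz. Where a partial derivative does not exist its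
   default value 0 satisfies the bound. *)
have [df|/partial_default ->] := pselect (derivable u0 x (basis_vec R k)); last first.
  by rewrite dotr0 sqr_ge0.
apply: (limit_quotient_le (c := fun s : R => u0 (x + s *: basis_vec R k))).
  exact: is_derive_dir.
by near=> s; rewrite scale0r addr0 -exprMn mulrC; exact: uL.
Unshelve. all: by end_near.
Qed.

End flow.

(** * Lipschitz bound for the initial map *)

Definition box (R : realType) (n : nat) (r : R) : set (n.-tuple (measurableTypeR R)) :=
  [set t | forall j : 'I_n, `[- r, r]%classic (tnth t j)].

Lemma measurable_box (R : realType) (n : nat) (r : R) : measurable (@box R n r).
Proof.
have -> : @box R n r = \bigcap_(j in [set: 'I_n]) ((fun t => tnth t j) @^-1` `[- r, r]%classic).
  by apply/seteqP; split => t h j => [_|]; exact: h.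
apply: fin_bigcap_measurable => // j _.
by rewrite -[X in measurable X]setTI; apply: measurable_tnth => //; exact: measurable_itv.
Qed.

Lemma lebesgue_measure_Rn_box (R : realType) (n : nat) (r : R) :
  (lebesgue_measure_Rn R n (@box R n r) < +oo)%E.
Proof.
elim: n => [|n IH]; first by rewrite /= /dirac /= indicE ltry.
rewrite /= /lebesgue_cons /pushforward.
have -> : @cons_pair R n @^-1` (@box R n.+1 r) = `[- r, r]%classic `*` @box R n r.
  apply/seteqP; split => -[x t] /=.
    move=> h; split; first by have := h ord0.
    by move=> j; have := h (lift ord0 j); rewrite tnthS.
  move=> [h1 h2] j; case: (unliftP ord0 j) => [i ->|->]; last exact: h1.
  by rewrite tnthS; exact: h2.
rewrite product_measure2E //; last exact: measurable_box.
apply: lte_mul_pinfty => //; rewrite ge0_fin_numE //.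
have := @lebesgue_measure_itv R `[- r, r]; rewrite /= => ->.
by case: ifP => _; rewrite ?ltry // -EFinB ltry.
Qed.

Lemma sigma_finite_Rn (R : realType) (n : nat) :
  sigma_finite setT (lebesgue_measure_Rn R n).
Proof.
exists (fun k => @box R n k%:R).
  apply/esym; rewrite -subTset => t _.
  exists (\sum_j (Num.truncn `|tnth t j|).+1)%N => // j.
  rewrite /= in_itv /= -ler_norml.
  have := truncnS_gt `|tnth t j|; move/ltW/le_trans; apply.
  by rewrite ler_nat (bigD1 j) //= leq_addr.
by move=> k; split; [exact: measurable_box|exact: lebesgue_measure_Rn_box].
Qed.

(** A constant to which the sigma-finite structure required by Fubini-Tonelli can be attached, since
    [lebesgue_measure_Rn] itself is a fixpoint returning a bundled measure. *)
Definition sigma_finite_lebesgue_Rn (R : realType) (n : nat) :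
    set (n.-tuple (measurableTypeR R)) -> \bar R := lebesgue_measure_Rn R n.

HB.instance Definition _ (R : realType) (n : nat) :=
  Measure.copy (@sigma_finite_lebesgue_Rn R n) (lebesgue_measure_Rn R n).

HB.instance Definition _ (R : realType) (n : nat) :=
  Measure_isSigmaFinite.Build _ _ _ (@sigma_finite_lebesgue_Rn R n) (sigma_finite_Rn R n).

Lemma integral_Rn_S (R : realType) (n : nat) (F : n.+1.-tuple (measurableTypeR R) -> \bar R) :
  measurable_fun [set: n.+1.-tuple (measurableTypeR R)] F -> (forall t, 0 <= F t)%E ->
  (\int[lebesgue_measure_Rn R n.+1]_t F t =
   \int[lebesgue_measure_Rn R n]_t \int[lebesgue_measure]_x F [tuple of x :: t])%E.
Proof.
move=> mF F0.
pose M := @sigma_finite_lebesgue_Rn R n.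
have mc := @measurable_cons_pair R n.
rewrite /= /lebesgue_cons ge0_integral_pushforward //.
rewrite preimage_setT.
(* The measure is built with the product [\x^], whereas Tonelli's theorem is applied to [\x]; they
   agree on rectangles, hence everywhere. *)
transitivity (\int[(@lebesgue_measure R \x M)%E]_z (F \o @cons_pair R n) z)%E.
  apply: eq_measure_integral => A mA _.
  apply/esym/product_measure_unique => // B C mB mC.
  by rewrite -product_measure2E.
have mFc : measurable_fun setT (F \o @cons_pair R n) by exact: measurableT_comp.
rewrite (fubini_tonelli2 (F \o @cons_pair R n) mFc) => [|z]; last exact: F0.
exact: eq_measure_integral.
Qed.

Lemma measurable_coord_prod (R : realType) (n : nat) (a : 'I_n -> R -> R) :
  (forall j, measurable_fun setT (a j)) ->
  measurable_fun [set: n.-tuple (measurableTypeR R)] (fun t => \prod_(j < n) a j (tnth t j)).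
Proof.
move=> ma; apply: measurable_prod => j _.
apply: measurableT_comp; [exact: ma|exact: measurable_tnth].
Qed.

Lemma integral_coord_prod (R : realType) (n : nat) (a : 'I_n -> R -> R) (I : 'I_n -> R) :
  (forall j x, 0 <= a j x) -> (forall j, measurable_fun setT (a j)) ->
  (forall j, \int[lebesgue_measure]_x (a j x)%:E = (I j)%:E)%E ->
  (\int[lebesgue_measure_Rn R n]_t (\prod_(j < n) a j (tnth t j))%:E = (\prod_(j < n) I j)%:E)%E.
Proof.
elim: n a I => [|n IH] a I a0 ma aI.
  under eq_integral do rewrite big_ord0.
  by rewrite integral_cst // mul1e big_ord0 /= /dirac indicE mem_set.
have mprod := measurable_coord_prod ma.
have prod0 (t : n.+1.-tuple (measurableTypeR R)) : 0 <= \prod_(j < n.+1) a j (tnth t j).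
  by apply: prodr_ge0.
rewrite integral_Rn_S //; last exact/measurable_EFinP.
have tail0 (t : n.-tuple (measurableTypeR R)) : 0 <= \prod_(j < n) a (lift ord0 j) (tnth t j).
  by apply: prodr_ge0.
have inner (t : n.-tuple (measurableTypeR R)) :
    (\int[lebesgue_measure]_x (\prod_(j < n.+1) a j (tnth [tuple of x :: t] j))%:E =
     (I ord0)%:E * (\prod_(j < n) a (lift ord0 j) (tnth t j))%:E)%E.
  transitivity (\int[lebesgue_measure]_x ((a ord0 x)%:E *
      (\prod_(j < n) a (lift ord0 j) (tnth t j))%:E))%E.
    apply: eq_integral => x _; rewrite big_ord_recl tnth0 -EFinM; congr (_ * _)%:E.
    by apply: eq_bigr => j _; rewrite tnthS.
  rewrite ge0_integralZr ?aI //.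
  - by apply/measurable_EFinP; exact: ma.
  - by move=> x _; rewrite lee_fin.
  - by rewrite lee_fin.
rewrite (eq_integral _ _ (fun t _ => inner t)).
rewrite ge0_integralZl //; last 3 first.
- by apply/measurable_EFinP; exact: (measurable_coord_prod (a := fun j => a (lift ord0 j)) (fun j => ma _)).
- by move=> t _; rewrite lee_fin.
- by rewrite -aI integral_ge0 // => x _; rewrite lee_fin.
rewrite (IH (fun j => a (lift ord0 j)) (fun j => I (lift ord0 j))) //.
by rewrite -EFinM big_ord_recl.
Qed.

(** * Smooth steps and bumps *)

Lemma is_derive0_quadratic (R : realType) (f : R -> R) (C : R) :
  (forall h, `|f h| <= C * h ^+ 2) -> is_derive (0 : R) 1 f 0.
Proof.
move=> fC; have f0 : f 0 = 0.
  by apply/eqP; rewrite -normr_le0; apply: le_trans (fC 0) _; rewrite expr0n mulr0.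
have C0 : 0 <= C by have := fC 1; rewrite expr1n mulr1; exact: le_trans.
have h : (fun h : R => h^-1 *: ((f \o shift 0) (h *: 1) - f 0)) @ (0 : R)^' --> (0 : R).
  apply/cvgrPdist_lt => e e0; rewrite near_withinE.
  apply/nbhs_ballP; exists (e / (C + 1)) => /=; first by rewrite divr_gt0 // ltr_wpDl.
  move=> y; rewrite /ball /= sub0r normrN => ye yn0.
  rewrite f0 subr0 sub0r normrN addr0 [y *: 1]mulr1 normrZ normfV.
  have y0 : 0 < `|y| by rewrite normr_gt0.
  rewrite mulrC ltr_pdivrMr //; apply: (le_lt_trans (fC y)).
  rewrite -(real_normK (num_real y)) expr2 mulrA ltr_pM2r //.
  move: ye; rewrite ltr_pdivlMr ?ltr_wpDl //; nra.
apply/is_deriveP; split; first by apply: cvgP h.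
exact: cvg_lim h.
Qed.

(* [x^-k exp (-1/x)] for [0 < x], extended by [0]; these functions span the
   derivatives of the first of them. *)
Definition flat (R : realType) (k : nat) (x : R) : R :=
  if 0 < x then x^-1 ^+ k * expR (- x^-1) else 0.

Lemma flat_ge0 (R : realType) (k : nat) (x : R) : 0 <= flat k x.
Proof.
rewrite /flat; case: ifP => // x0.
by rewrite mulr_ge0 ?expR_ge0 // exprn_ge0 // invr_ge0 ltW.
Qed.

Lemma flat_gt0 (R : realType) (k : nat) (x : R) : 0 < x -> 0 < flat k x.
Proof. by move=> x0; rewrite /flat x0 mulr_gt0 ?expR_gt0 // exprn_gt0 // invr_gt0. Qed.

Lemma flat_le0 (R : realType) (k : nat) (x : R) : x <= 0 -> flat k x = 0.
Proof. by rewrite /flat leNgt => /negbTE ->. Qed.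

(** With y = 1/x, exp y >= y^(k+2) / (k+2)!. The quadratic bound makes [flat k] differentiable at 0
    with derivative 0. *)
Lemma flat_quadratic (R : realType) (k : nat) (x : R) :
  `|flat k x| <= (k.+2)`!%:R * x ^+ 2.
Proof.
rewrite ger0_norm ?flat_ge0 // /flat; case: ifPn => [x0|_]; last first.
  by rewrite mulr_ge0 // sqr_ge0.
have y0 : 0 < x^-1 by rewrite invr_gt0.
have := expR_ge1Dxn k.+1 (ltW y0) => h.
have fk : 0 < (k.+2)`!%:R :> R by rewrite ltr0n fact_gt0.
rewrite expRN ler_pdivrMr ?expR_gt0 //.
apply: (@le_trans _ _ ((k.+2)`!%:R * x ^+ 2 * (x^-1 ^+ k.+2 / (k.+2)`!%:R))).
  rewrite -addn2 exprD; set y := x^-1 ^+ k.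
  have -> : (k + 2)`!%:R * x ^+ 2 * (y * x^-1 ^+ 2 / (k + 2)`!%:R) = y.
    by field; rewrite !gt_eqF // addn2.
  by [].
apply: ler_wpM2l; first by rewrite mulr_ge0 // sqr_ge0.
by apply: le_trans h; rewrite lerDr.
Qed.

Lemma is_derive_flat (R : realType) (k : nat) (x : R) :
  is_derive x 1 (@flat R k) (flat k.+2 x - k%:R * flat k.+1 x).
Proof.
have [x0|x0|->] := ltgtP x 0.
- rewrite !flat_le0 ?ltW // mulr0 subr0.
  apply: near_eq_is_derive (is_derive_cst (0 : R) x 1).
  by near=> y; rewrite flat_le0 // ltW //; near: y; exact: lt_nbhsl.
- have xn0 : x != 0 by rewrite gt_eqF.
  have d1 : is_derive x 1 (fun y : R => y^-1) (- x ^- 2).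
    by apply: is_derive_eq; [exact: is_deriveV|rewrite /GRing.scale /= mulr1].
  have d2 : is_derive x 1 (fun y : R => expR (- y^-1)) (expR (- x^-1) * x ^- 2).
    by apply: is_derive1_comp; apply: is_derive_eq; rewrite opprK.
  have d3 : is_derive x 1 (fun y : R => y^-1 ^+ k * expR (- y^-1))
      (flat k.+2 x - k%:R * flat k.+1 x).
    have dk : is_derive x 1 (fun y : R => y^-1 ^+ k) (k%:R * x^-1 ^+ k.-1 * - x ^- 2).
      elim: {d2} k => [|k IHk].
        rewrite !mul0r; under eq_fun do rewrite expr0; exact: is_derive_cst.
      under eq_fun do rewrite exprS.
      apply: is_derive_eq; rewrite /GRing.scale /= -natr1.
      case: k {IHk} => [|k] /=; first by rewrite !expr0; ring.
      by rewrite [x^-1 ^+ k.+1]exprS; ring.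
    apply: (is_derive_eq (is_deriveM dk d2)); rewrite /flat x0 /GRing.scale /=.
    move: (expR _) => E; case: k {dk} => [|k] /=; first by rewrite !mul0r; field.
    by rewrite !exprS; field.
  apply: near_eq_is_derive d3.
  by near=> y; rewrite /flat ifT //; near: y; exact: lt_nbhsr.
- rewrite !flat_le0 // mulr0 subr0.
  exact: is_derive0_quadratic (@flat_quadratic R k).
Unshelve. all: by end_near.
Qed.

(** A class of expressions closed under differentiation: smoothness then follows by induction on the
    number of derivatives, with no formula for the iterated ones. [smooth_rV] below is its analogue
    in several variables. *)
Inductive smooth_class (R : realType) : (R -> R) -> Prop :=
| smooth_flat k (a b : R) : smooth_class (fun x => flat k (a * x + b))
| smooth_cst (c : R) : smooth_class (fun=> c)
| smooth_add f g : smooth_class f -> smooth_class g -> smooth_class (fun x => f x + g x)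
| smooth_mul f g : smooth_class f -> smooth_class g -> smooth_class (fun x => f x * g x)
| smooth_inv f : (forall x, f x != 0) -> smooth_class f -> smooth_class (fun x => (f x)^-1).

Lemma smooth_class_derive (R : realType) (f : R -> R) : smooth_class f ->
  exists2 f', smooth_class f' & forall x : R, is_derive x 1 f (f' x).
Proof.
elim=> [k a b|c|g h _ [g' sg' dg] _ [h' sh' dh]|g h sg [g' sg' dg] sh [h' sh' dh]|g gn0 sg [g' sg' dg]].
- exists (fun x => (flat k.+2 (a * x + b) + - k%:R * flat k.+1 (a * x + b)) * a).
    apply: smooth_mul; last exact: smooth_cst.
    apply: smooth_add; first exact: smooth_flat.
    by apply: smooth_mul; [exact: smooth_cst|exact: smooth_flat].
  move=> x; rewrite mulNr; apply: is_derive1_comp; last first.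
    by apply: is_derive_eq; rewrite /GRing.scale /=; ring.
  exact: is_derive_flat.
- by exists (fun=> 0); [exact: smooth_cst|move=> x; exact: is_derive_cst].
- by exists (fun x => g' x + h' x); [exact: smooth_add|move=> x; exact: is_deriveD].
- exists (fun x => g x * h' x + h x * g' x); last by move=> x; exact: is_deriveM.
  by apply: smooth_add; exact: smooth_mul.
- exists (fun x => - 1 * g' x * ((g x)^-1 * (g x)^-1)).
    apply: smooth_mul; last by apply: smooth_mul; exact: smooth_inv.
    by apply: smooth_mul => //; exact: smooth_cst.
  move=> x; apply: (is_derive_eq (is_deriveV (gn0 x) (dg x))).
  by rewrite /GRing.scale /=; field.
Qed.

Inductive smooth_rV (R : realType) (d : nat) : ('rV[R]_d -> R) -> Prop :=
| smooth_rV_coord j f : smooth_class f -> smooth_rV (fun y => f (y 0 j))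
| smooth_rV_cst (c : R) : smooth_rV (fun=> c)
| smooth_rV_add f g : smooth_rV f -> smooth_rV g -> smooth_rV (fun x => f x + g x)
| smooth_rV_mul f g : smooth_rV f -> smooth_rV g -> smooth_rV (fun x => f x * g x).

Lemma derive_along_line (R : realType) (d : nat) (f : 'rV[R]_d -> R) (x v : 'rV[R]_d) (l : R) :
  differentiable f x -> is_derive (0 : R) 1 (fun s : R => f (x + s *: v)) l -> 'D_v f x = l.
Proof. by move=> /diff_derivable-/(_ v)/is_derive_dir h; exact: is_derive_unique h. Qed.

Lemma smooth_rV_derive (R : realType) (d : nat) (f : 'rV[R]_d -> R) : smooth_rV f ->
  (forall x, differentiable f x) /\ forall v, smooth_rV ('D_v f).
Proof.
elim=> [j g sg|c|g h _ [dg sdg] _ [dh sdh]|g h sg [dg sdg] sh [dh sdh]].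
- have [g' sg' dg] := smooth_class_derive sg.
  have df x : differentiable (fun y : 'rV[R]_d => g (y 0 j)) x.
    apply: differentiable_comp; first exact: differentiable_coord.
    by apply/derivable1_diffP; have /is_deriveP[] := dg (x 0 j).
  split => // v.
  have -> : 'D_v (fun y : 'rV[R]_d => g (y 0 j)) = (fun y => v 0 j * g' (y 0 j)).
    apply/funext => x; apply: derive_along_line => //.
    under eq_fun do rewrite mxE mxE.
    rewrite mulrC; apply: is_derive1_comp; first by rewrite mul0r addr0.
    by apply: is_derive_eq; rewrite /GRing.scale /=; ring.
  by apply: smooth_rV_mul; [exact: smooth_rV_cst|exact: smooth_rV_coord].
- split => [x|v]; first exact: differentiable_cst.
  have -> : 'D_v (fun=> c) = (fun=> 0) :> ('rV[R]_d -> R) by apply/funext => x; exact: derive_cst.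
  exact: smooth_rV_cst.
- split => [x|v]; first exact: differentiableD.
  have -> : 'D_v (fun x => g x + h x) = (fun x => 'D_v g x + 'D_v h x).
    by apply/funext => x; rewrite deriveD //; exact: diff_derivable.
  by apply: smooth_rV_add.
- split => [x|v]; first exact: differentiableM.
  have -> : 'D_v (fun x => g x * h x) = (fun x => g x * 'D_v h x + h x * 'D_v g x).
    by apply/funext => x; rewrite deriveM //; exact: diff_derivable.
  by apply: smooth_rV_add; exact: smooth_rV_mul.
Qed.

Lemma smooth_rV_smooth_on (R : realType) (d : nat) (f : 'rV[R]_d -> R) :
  smooth_rV f -> smooth_on setT f.
Proof.
move=> sf vs x _; have : smooth_rV (foldr (fun v (g : 'rV[R]_d -> R) => 'D_v g) f vs).
  by elim: vs => //= v vs IH; have [_] := smooth_rV_derive IH.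
by case/smooth_rV_derive.
Qed.

Lemma smooth_rV_prod (R : realType) (d : nat) (r : seq 'I_d) (a : 'I_d -> R -> R) :
  (forall j, smooth_class (a j)) -> smooth_rV (fun y => \prod_(j <- r) a j (y 0 j)).
Proof.
move=> sa; elim: r => [|j r IH].
  by under eq_fun do rewrite big_nil; exact: smooth_rV_cst.
under eq_fun do rewrite big_cons.
by apply: smooth_rV_mul => //; exact: smooth_rV_coord.
Qed.

Lemma derive_prod (R : realType) (d : nat) (a : 'I_d -> R -> R) (k : 'I_d) (a' : R -> R) y :
  (forall j, smooth_class (a j)) -> (forall x : R, is_derive x 1 (a k) (a' x)) ->
  'D_(basis_vec R k) (fun y : 'rV[R]_d => \prod_(j < d) a j (y 0 j)) y =
  a' (y 0 k) * \prod_(j < d | j != k) a j (y 0 j).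
Proof.
move=> sa da; apply: derive_along_line.
  by have [] := smooth_rV_derive (smooth_rV_prod (index_enum _) sa).
rewrite (_ : (fun s => _) = (fun s => a k (y 0 k + s) * \prod_(j < d | j != k) a j (y 0 j))).
  have h : is_derive (0 : R) 1 (fun s => a k (y 0 k + s)) (a' (y 0 k)).
    rewrite -[a' _]mulr1; apply: is_derive1_comp; first by rewrite addr0.
    by apply: is_derive_eq; rewrite add0r.
  by apply: is_derive_eq; rewrite /GRing.scale /=; ring.
apply/funext => s; rewrite (bigD1 k) //=; congr (_ * _).
  by rewrite !mxE !eqxx mulr1.
by apply: eq_bigr => j jk; rewrite !mxE (negbTE jk) andbF mulr0 addr0.
Qed.

Definition smooth_step (R : realType) (x : R) : R :=
  flat 0 x / (flat 0 x + flat 0 (1 - x)).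

(** The derivative of [smooth_step], written out by the quotient rule with [flat 2] as the
    derivative of [flat 0]; it is supported in [0, 1] and has integral 1. *)
Definition step_bump (R : realType) (x : R) : R :=
  (flat 2 x * flat 0 (1 - x) + flat 0 x * flat 2 (1 - x)) / (flat 0 x + flat 0 (1 - x)) ^+ 2.

Lemma step_denom_gt0 (R : realType) (x : R) : 0 < flat 0 x + flat 0 (1 - x).
Proof.
have [x0|x0] := ltP 0 x; first by rewrite ltr_wpDr ?flat_ge0 // flat_gt0.
by rewrite ltr_wpDl ?flat_ge0 // flat_gt0; lra.
Qed.

Lemma smooth_step_itv (R : realType) (x : R) : 0 <= smooth_step x <= 1.
Proof.
have h := step_denom_gt0 x; apply/andP; split; first by rewrite divr_ge0 ?flat_ge0 // ltW.
by rewrite ler_pdivrMr // mul1r lerDl flat_ge0.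
Qed.

Lemma smooth_step_le0 (R : realType) (x : R) : x <= 0 -> smooth_step x = 0.
Proof. by move=> x0; rewrite /smooth_step flat_le0 // mul0r. Qed.

Lemma smooth_step_ge1 (R : realType) (x : R) : 1 <= x -> smooth_step x = 1.
Proof.
move=> x1; rewrite /smooth_step (flat_le0 0 (x := 1 - x)) ?addr0 ?subr_le0 //.
by rewrite divff // gt_eqF // flat_gt0; lra.
Qed.

Lemma step_bump_ge0 (R : realType) (x : R) : 0 <= step_bump x.
Proof.
by rewrite divr_ge0 ?sqr_ge0 // addr_ge0 // mulr_ge0 // flat_ge0.
Qed.

Lemma step_bump_out (R : realType) (x : R) : ~~ (0 < x < 1) -> step_bump x = 0.
Proof.
rewrite negb_and -!leNgt => /orP[x0|x1]; rewrite /step_bump.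
  by rewrite !(flat_le0 _ x0) !mul0r addr0 mul0r.
by rewrite !(flat_le0 _ (x := 1 - x)) ?subr_le0 // !mulr0 addr0 mul0r.
Qed.

Lemma is_derive_smooth_step (R : realType) (x : R) :
  is_derive x 1 (@smooth_step R) (step_bump x).
Proof.
have h := step_denom_gt0 x.
have d1 := is_derive_flat 0 x; rewrite mul0r subr0 in d1.
have d2 : is_derive x 1 (fun y : R => flat 0 (1 - y)) (- flat 2 (1 - x)).
  have -> : - flat 2 (1 - x) = (flat 2 (1 - x) - 0%:R * flat 1 (1 - x)) * (- 1) by ring.
  apply: is_derive1_comp; first exact: is_derive_flat.
  by apply: is_derive_eq; ring.
have d3 := is_deriveD d1 d2.
have d4 : is_derive x 1 (fun y : R => (flat 0 y + flat 0 (1 - y))^-1)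
   (- (flat 0 x + flat 0 (1 - x)) ^- 2 *: (flat 2 x - flat 2 (1 - x))).
  have hn : flat 0 x + flat 0 (1 - x) != 0 by rewrite gt_eqF.
  exact: (is_deriveV (f := fun y : R => flat 0 y + flat 0 (1 - y)) hn d3).
apply: (is_derive_eq (is_deriveM d1 d4)).
by rewrite /step_bump /GRing.scale /=; field; rewrite gt_eqF.
Qed.

Lemma smooth_class_step_bump (R : realType) (a b : R) :
  smooth_class (fun x => smooth_step (a * x + b)) /\
  smooth_class (fun x => step_bump (a * x + b)).
Proof.
have fl k : smooth_class (fun x => flat k (1 - (a * x + b))).
  have -> : (fun x => flat k (1 - (a * x + b))) = (fun x => flat k (- a * x + (1 - b))).
    by apply/funext => x; congr flat; ring.
  exact: smooth_flat.
have den : smooth_class (fun x => (flat 0 (a * x + b) + flat 0 (1 - (a * x + b)))^-1).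
  apply: smooth_inv => [x|]; first by rewrite gt_eqF // step_denom_gt0.
  by apply: smooth_add => //; exact: smooth_flat.
split; first by apply: smooth_mul => //; exact: smooth_flat.
rewrite /step_bump; under eq_fun do rewrite -exprVn expr2.
apply: smooth_mul; last exact: smooth_mul.
by apply: smooth_add; apply: smooth_mul => //; exact: smooth_flat.
Qed.

Lemma smooth_class_continuous (R : realType) (f : R -> R) : smooth_class f -> continuous f.
Proof.
move=> /smooth_class_derive[f' _ df] x; apply: differentiable_continuous.
by apply/derivable1_diffP; have /is_deriveP[] := df x.
Qed.

Lemma smooth_class_measurable (R : realType) (f : R -> R) :
  smooth_class f -> measurable_fun [set: R] f.
Proof. by move=> /smooth_class_continuous cf; exact: continuous_measurable_fun. Qed.

Lemma smooth_step_nondecreasing (R : realType) (x y : R) :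
  x <= y -> smooth_step x <= smooth_step y.
Proof.
rewrite le_eqVlt => /orP[/eqP ->//|xy].
have [c _ E] := MVT xy (fun z _ => is_derive_smooth_step z)
  (derivable_within_continuous (fun z _ => ((is_deriveP _ _ _ _).1 (is_derive_smooth_step z)).1)).
by rewrite -subr_ge0 E mulr_ge0 ?step_bump_ge0 // subr_ge0 ltW.
Qed.

Lemma step_bump_support (R : realType) (r b y : R) : 0 < r ->
  ~~ (- b * r <= y <= - b * r + r) -> step_bump (r^-1 * y + b) = 0.
Proof.
move=> r0 h; apply: step_bump_out; apply: contra h.
have -> : r^-1 * y + b = (y + b * r) / r by field; rewrite gt_eqF.
rewrite pmulr_lgt0 ?invr_gt0 // ltr_pdivrMr // mul1r => /andP[h1 h2].
by apply/andP; split; lra.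
Qed.

Lemma integral_step_bump (R : realType) (r b : R) : 0 < r ->
  (\int[lebesgue_measure]_y (step_bump (r^-1 * y + b)%R)%:E = r%:E)%E.
Proof.
move=> r0; set A := - b * r.
have [_ sb] := smooth_class_step_bump r^-1 b.
have cb := smooth_class_continuous sb.
transitivity (\int[lebesgue_measure]_(y in `[A, (A + r)%R]) (step_bump (r^-1 * y + b))%:E)%E.
  rewrite [RHS]integral_mkcond; apply: eq_integral => y _.
  rewrite patchE; case: ifPn => // yA; rewrite step_bump_support //.
  by apply: contra yA => h; rewrite inE /= in_itv.
pose F y := r * smooth_step (r^-1 * y + b).
have dF (y : R) : is_derive y 1 F (step_bump (r^-1 * y + b)).
  have -> : step_bump (r^-1 * y + b) = r * (step_bump (r^-1 * y + b) * r^-1).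
    by field; rewrite gt_eqF.
  have h : is_derive y 1 (fun y => smooth_step (r^-1 * y + b)) (step_bump (r^-1 * y + b) * r^-1).
    apply: is_derive1_comp; first exact: is_derive_smooth_step.
    by apply: is_derive_eq; rewrite /GRing.scale /=; ring.
  by apply: is_derive_eq; rewrite /GRing.scale /=; ring.
have cF : continuous F.
  move=> y; apply: differentiable_continuous; apply/derivable1_diffP.
  by have /is_deriveP[] := dF y.
have Ar : A < A + r by rewrite ltrDl.
rewrite (@continuous_FTC2 R _ F A (A + r) Ar).
- rewrite /F; have -> : r^-1 * (A + r) + b = 1 by rewrite /A; field; rewrite gt_eqF.
  have -> : r^-1 * A + b = 0 by rewrite /A; field; rewrite gt_eqF.
  by rewrite smooth_step_ge1 // smooth_step_le0 // mulr0 mulr1 sube0.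
- exact: continuous_subspaceT.
- split.
  + by move=> y _; have /is_deriveP[] := dF y.
  + exact: cvg_at_right_filter (cF A).
  + exact: cvg_at_left_filter (cF _).
- by move=> y _; rewrite derive1E; have /is_deriveP[] := dF y.
Qed.

Lemma step_difference_itv (R : realType) (r b s y : R) : 0 < r -> 0 <= s ->
  0 <= smooth_step (r^-1 * y + b) - smooth_step (r^-1 * y + (b - s / r)) <= 1.
Proof.
move=> r0 s0; have sr : 0 <= s / r by rewrite divr_ge0 // ltW.
apply/andP; split; first by rewrite subr_ge0 smooth_step_nondecreasing //; lra.
have /andP[_ h1] := smooth_step_itv (r^-1 * y + b).
by have /andP[h2 _] := smooth_step_itv (r^-1 * y + (b - s / r)); lra.
Qed.

Lemma step_difference_support (R : realType) (r b s y : R) : 0 < r -> 0 <= s ->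
  ~~ (- b * r <= y <= - b * r + (s + r)) ->
  smooth_step (r^-1 * y + b) - smooth_step (r^-1 * y + (b - s / r)) = 0.
Proof.
move=> r0 s0; set A := - b * r.
have Ey : r^-1 * y + b = (y - A) / r by rewrite /A; field; rewrite gt_eqF.
have Ey2 : r^-1 * y + (b - s / r) = (y - A - s) / r by rewrite /A; field; rewrite gt_eqF.
rewrite negb_and -!ltNge => /orP[yA|yA].
  rewrite !smooth_step_le0 ?subrr // ?Ey ?Ey2 pmulr_lle0 ?invr_gt0 //; lra.
rewrite !smooth_step_ge1 ?subrr // ?Ey ?Ey2 ler_pdivlMr //; lra.
Qed.

(** The exact value is s. The length s + r of the support is a sufficient bound, because r is taken
    arbitrarily small in the end. *)
Lemma integral_step_difference (R : realType) (r b s : R) : 0 < r -> 0 <= s ->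
  exists2 I : R, 0 <= I <= s + r &
  (\int[lebesgue_measure]_y (smooth_step (r^-1 * y + b) - smooth_step (r^-1 * y + (b - s / r)))%:E
   = I%:E)%E.
Proof.
move=> r0 s0; set A := - b * r.
set H := fun y => smooth_step (r^-1 * y + b) - smooth_step (r^-1 * y + (b - s / r)).
have H01 y : 0 <= H y <= 1 by exact: step_difference_itv.
have H0 y : 0 <= H y by case/andP: (H01 y).
have H1 y : H y <= 1 by case/andP: (H01 y).
have mH : measurable_fun [set: R] H.
  by apply: measurable_funB; apply: smooth_class_measurable; apply: (smooth_class_step_bump _ _).1.
have Hout y : ~~ (A <= y <= A + (s + r)) -> H y = 0 by exact: step_difference_support.
have HI : (\int[lebesgue_measure]_y (H y)%:E <= (s + r)%:E)%E.
  have -> : (s + r)%:E = (\int[lebesgue_measure]_y (\1_(`[A, (A + (s + r))%R]%classic : set R) y)%:E)%E.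
    rewrite integral_indic // setIT; have := @lebesgue_measure_itv R `[A, A + (s + r)].
    rewrite /= lte_fin ltrDl ltr_wpDl // => ->.
    by rewrite -EFinB; congr EFin; ring.
  apply: ge0_le_integral => //.
  - by move=> y _; rewrite lee_fin.
  - exact/measurable_EFinP.
  - by apply/measurable_EFinP; exact: measurable_indic.
  - move=> y _; rewrite lee_fin indicE; have [yA|yA] := boolP (A <= y <= A + (s + r)).
      by rewrite mem_set //= in_itv.
    by rewrite Hout.
have H00 : (0 <= \int[lebesgue_measure]_y (H y)%:E)%E.
  by apply: integral_ge0 => y _; rewrite lee_fin.
exists (fine (\int[lebesgue_measure]_y (H y)%:E)%E); last first.
  by rewrite fineK // ge0_fin_numE //; apply: le_lt_trans HI _; rewrite ltry.
rewrite fine_ge0 //= -lee_fin fineK // ge0_fin_numE //.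
by apply: le_lt_trans HI _; rewrite ltry.
Qed.

(** * Averages against bumps *)

Lemma integrable_cutoff (R : realType) (dd : measure_display) (T : measurableType dd)
    (mu : {measure set T -> \bar R}) (D : set T) (F Phi : T -> R) (M : R) :
  measurable D -> mu.-integrable D (EFin \o F) -> measurable_fun [set: T] Phi ->
  (forall t, `|Phi t| <= M) -> (forall t, ~ D t -> Phi t = 0) ->
  mu.-integrable [set: T] (EFin \o (fun t => F t * Phi t)).
Proof.
move=> mD iF mPhi bPhi out.
have mPhiD : measurable_fun D Phi by apply: measurable_funTS.
have bD : [bounded Phi t | t in D].
  by exists M; split => [|N MN t _]; [exact: num_real|apply: le_trans (bPhi t) (ltW MN)].
have := integrableMl mD iF mPhiD bD.
move=> /(integrable_mkcond _ mD).1; congr (_.-integrable _ _).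
apply/funext => t; rewrite patchE /=; case: ifPn => // tD.
rewrite out ?mulr0 // => Dt; move/negP : tD; apply; exact: mem_set.
Qed.

Lemma bump_average_near (R : realType) (dd : measure_display) (T : measurableType dd)
    (mu : {measure set T -> \bar R}) (F Phi : T -> R) (v eta I : R) :
  measurable_fun [set: T] Phi -> (forall t, 0 <= Phi t) ->
  (\int[mu]_t (Phi t)%:E = I%:E)%E ->
  mu.-integrable [set: T] (EFin \o (fun t => F t * Phi t)) ->
  (forall t, Phi t != 0 -> `|F t - v| <= eta) ->
  `|\int[mu]_t (F t * Phi t) - v * I| <= eta * I.
Proof.
move=> mPhi Phi0 PhiI iF Fv.
have iPhi : mu.-integrable [set: T] (EFin \o Phi).
  apply/integrableP; split; first exact/measurable_EFinP.
  under eq_integral do rewrite /= ger0_norm //.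
  by rewrite PhiI ltry.
have RI : \int[mu]_t Phi t = I by rewrite /Rintegral PhiI.
have iv : mu.-integrable [set: T] (EFin \o (fun t => v * Phi t)).
  by have := integrableZl measurableT v iPhi; under eq_fun do rewrite -EFinM.
have ie : mu.-integrable [set: T] (EFin \o (fun t => eta * Phi t)).
  by have := integrableZl measurableT eta iPhi; under eq_fun do rewrite -EFinM.
rewrite -RI -!RintegralZl // -RintegralB //.
have id : mu.-integrable [set: T] (EFin \o (fun t => F t * Phi t - v * Phi t)).
  by have := integrableB measurableT iF iv; apply: eq_integrable.
apply: (le_trans (le_normr_Rintegral measurableT id)).
apply: le_Rintegral => //.
  by have := integrable_norm id.
move=> t _; rewrite -mulrBl normrM (ger0_norm (Phi0 t)).
have [->|Pt] := eqVneq (Phi t) 0; first by rewrite !mulr0.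
by rewrite ler_wpM2r // Fv.
Qed.

Lemma ae_bound_Rintegral (R : realType) (dd : measure_display) (T : measurableType dd)
    (mu : {measure set T -> \bar R}) (G Phi : T -> R) (c I : R) :
  measurable_fun [set: T] Phi -> (forall t, 0 <= Phi t) -> 0 <= c ->
  (\int[mu]_t (Phi t)%:E = I%:E)%E ->
  mu.-integrable [set: T] (EFin \o (fun t => G t * Phi t)) ->
  (\forall t \ae mu, `|G t| <= c) ->
  `|\int[mu]_t (G t * Phi t)| <= c * I.
Proof.
move=> mPhi Phi0 c0 PhiI iG Gc.
rewrite -lee_fin EFin_normr_Rintegral //.
have [mG _] := integrableP _ _ _ iG.
apply: (le_trans (le_abse_integral mu measurableT mG)).
rewrite EFinM -PhiI -ge0_integralZl //; last 2 first.
- exact/measurable_EFinP.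
- by move=> t _; rewrite lee_fin.
apply: ae_ge0_le_integral => //.
- exact: measurableT_comp.
- by move=> t _; rewrite mule_ge0 // lee_fin.
- by apply: measurable_funeM; exact/measurable_EFinP.
apply: filterS Gc => t Gt _; rewrite -EFinM lee_fin normrM (ger0_norm (Phi0 t)).
by rewrite ler_wpM2r.
Qed.

(** Replaces the density of sets of full measure: a function with positive integral cannot vanish
    almost everywhere. *)
Lemma ae_witness (R : realType) (dd : measure_display) (T : measurableType dd)
    (mu : {measure set T -> \bar R}) (Phi : T -> R) (I : R) (Q : T -> Prop) :
  measurable_fun [set: T] Phi -> (forall t, 0 <= Phi t) -> 0 < I ->
  (\int[mu]_t (Phi t)%:E = I%:E)%E -> (\forall t \ae mu, Q t) ->
  exists2 t, Phi t != 0 & Q t.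
Proof.
move=> mPhi Phi0 I0 PhiI aeQ; apply: contrapT => h.
suff : (\int[mu]_t (Phi t)%:E = 0)%E.
  by rewrite PhiI => -[] I00; move: I0; rewrite I00 ltxx.
have -> : (\int[mu]_t (Phi t)%:E = \int[mu]_t `|(Phi t)%:E|)%E.
  by apply: eq_integral => t _; rewrite gee0_abs // lee_fin.
apply/(ae_eq_integral_abs mu measurableT); first exact/measurable_EFinP.
apply: filterS aeQ => t Qt _; congr EFin; apply/eqP/negP => /negP Pt.
by apply: h; exists t.
Qed.

Lemma Linfty_ae (R : realType) (d p q : nat) (h : 'rV[R]_d -> 'M[R]_(p, q)) (c : R) : 0 <= c ->
  (Linfty_norm h <= c%:E)%E ->
  \forall t \ae lebesgue_measure_Rn R d, enorm (h (row_of_tuple t)) <= c.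
Proof.
move=> c0; rewrite /Linfty_norm unlock /=; case: ifPn => [mu0|mu0 _].
  move=> /ess_sup_inf.ess_supP; apply: filterS => t /=.
  by rewrite lee_fin ger0_norm // enorm_ge0.
(* The remaining case is that of a null measure, where the whole space is negligible. *)
exists setT; split => //.
by apply: le_anti; rewrite measure_ge0 andbT leNgt.
Qed.

(** The norm is an infimum, so a weak gradient is extracted from a strict inequality; the factor 2
    provides the room. *)
Lemma W1infty_weak_gradient (R : realType) (d m : nat) (f : 'rV[R]_d -> 'rV[R]_m) (e : R) :
  0 < e -> (W1infty_norm f <= e%:E)%E ->
  exists g, [/\ weak_gradient f g,
    \forall t \ae lebesgue_measure_Rn R d, enorm (f (row_of_tuple t)) <= 2 * e &
    \forall t \ae lebesgue_measure_Rn R d, enorm (g (row_of_tuple t)) <= 2 * e].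
Proof.
move=> e0 fe.
have : (W1infty_norm f < (2 * e)%:E)%E by apply: (le_lt_trans fe); rewrite lte_fin; lra.
move=> /ereal_inf_lt[_ [g wg <-] lt2].
have e20 : 0 <= 2 * e by lra.
have fg0 : (0 <= Linfty_norm f)%E /\ (0 <= Linfty_norm g)%E by split; exact: Lnorm_ge0.
exists g; split => //; apply: Linfty_ae => //; apply: le_trans (ltW lt2).
  by rewrite leeDl //; case: fg0.
by rewrite leeDr //; case: fg0.
Qed.

Lemma step_bump_bounded (R : realType) : exists M : R, forall x, step_bump x <= M.
Proof.
have cb : continuous (@step_bump R).
  have -> : @step_bump R = (fun x => step_bump (1 * x + 0)).
    by apply/funext => x; rewrite mul1r addr0.
  exact: smooth_class_continuous (smooth_class_step_bump 1 0).2.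
have [c _ cP] := @EVT_max R (@step_bump R) 0 1 ler01 (continuous_subspaceT cb).
exists (step_bump c) => x; have [x01|x01] := boolP (0 < x < 1).
  by apply: cP; rewrite in_itv /=; lra.
by rewrite (step_bump_out x01) step_bump_ge0.
Qed.

(** Any explicit radius will do to enclose a support in a ball; a <= a^2 + 1 avoids the square
    root. *)
Lemma enorm_box (R : realType) (d : nat) (v : 'rV[R]_d) (M : R) :
  (forall j, `|v 0 j| <= M) -> enorm v <= d%:R * M ^+ 2 + 1.
Proof.
move=> vM; have h : enorm v ^+ 2 <= d%:R * M ^+ 2.
  rewrite sqr_enorm; apply: (@le_trans _ _ (\sum_(j < d) M ^+ 2)).
    apply: ler_sum => j _; rewrite -expr2 -(real_normK (num_real (v 0 j))).
    by rewrite ler_pXn2r ?nnegrE //; apply: le_trans (vM j).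
  by rewrite sumr_const card_ord mulr_natl.
have := sqr_ge0 (enorm v - 1); have := sqr_ge0 (enorm v); rewrite sqrrB; lra.
Qed.

Lemma measurable_ball_tuple (R : realType) (d : nat) (r : R) :
  measurable [set t : d.-tuple (measurableTypeR R) | enorm (row_of_tuple t) <= r].
Proof.
have mf : measurable_fun [set: d.-tuple (measurableTypeR R)] (fun t => enorm (row_of_tuple t)).
  apply: measurableT_comp; first by apply: continuous_measurable_fun; exact: sqrt_continuous.
  apply: measurable_sum => i; apply: measurable_sum => j.
  under eq_fun do rewrite mxE.
  by apply: measurable_funX; exact: measurable_tnth.
have := mf measurableT `]-oo, r]%classic (measurable_itv _); rewrite setTI.
by congr measurable; apply/seteqP; split => t; rewrite /= in_itv.
Qed.

(** A bump on the cube with lower corner x and side r, of total mass r^d. *)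
Definition cube_bump (R : realType) (d : nat) (x : 'rV[R]_d) (r : R)
    (t : d.-tuple (measurableTypeR R)) : R :=
  \prod_(j < d) step_bump (r^-1 * tnth t j + - x 0 j / r).

Section cube.
Context (R : realType) (d : nat) (x : 'rV[R]_d) (r : R) (r0 : 0 < r).

Lemma cube_bump_ge0 t : 0 <= cube_bump x r t.
Proof. by apply: prodr_ge0 => j _; exact: step_bump_ge0. Qed.

Lemma measurable_cube_bump : measurable_fun [set: d.-tuple (measurableTypeR R)] (cube_bump x r).
Proof.
apply: (measurable_coord_prod (a := fun j y => step_bump (r^-1 * y + - x 0 j / r))) => j.
exact: smooth_class_measurable (smooth_class_step_bump _ _).2.
Qed.

Lemma integral_cube_bump :
  (\int[lebesgue_measure_Rn R d]_t (cube_bump x r t)%:E = (r ^+ d)%:E)%E.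
Proof.
have -> : r ^+ d = \prod_(j < d) r by rewrite prodr_const card_ord.
apply: (integral_coord_prod (a := fun j y => step_bump (r^-1 * y + - x 0 j / r))).
- by move=> j y; exact: step_bump_ge0.
- by move=> j; exact: smooth_class_measurable (smooth_class_step_bump _ _).2.
- by move=> j; exact: integral_step_bump.
Qed.

Lemma cube_bump_support t j : cube_bump x r t != 0 -> x 0 j <= tnth t j <= x 0 j + r.
Proof.
move=> /prodf_neq0/(_ j isT); apply: contraNT => h.
rewrite step_bump_support //; have -> // : - (- x 0 j / r) * r = x 0 j by field; rewrite gt_eqF.
Qed.

Lemma cube_bump_bounded : exists M : R, forall t, `|cube_bump x r t| <= M.
Proof.
have [M MP] := step_bump_bounded R; exists (M ^+ d) => t.
rewrite ger0_norm ?cube_bump_ge0 //.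
have -> : M ^+ d = \prod_(j < d) M by rewrite prodr_const card_ord.
by apply: ler_prod => j _; rewrite step_bump_ge0 MP.
Qed.

Lemma integrable_cube_bump (F : 'rV[R]_d -> R) : Defs.locally_integrable F ->
  (lebesgue_measure_Rn R d).-integrable [set: d.-tuple (measurableTypeR R)]
    (EFin \o (fun t => F (row_of_tuple t) * cube_bump x r t)).
Proof.
move=> lF; pose M := \sum_(j < d) `|x 0 j| + r.
have [B BP] := cube_bump_bounded.
apply: (integrable_cutoff (measurable_ball_tuple (d%:R * M ^+ 2 + 1)) (lF _)
  measurable_cube_bump BP) => t; apply: contra_notP => /eqP tn0.
apply: enorm_box => j; rewrite mxE.
have := cube_bump_support j tn0.
have : `|x 0 j| <= \sum_(i < d) `|x 0 i|.
  by rewrite (bigD1 j) //= lerDl sumr_ge0.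
move=> h1 h2; have h3 := ler_norm (x 0 j); have h4 := ler_norm (- x 0 j).
rewrite normrN in h4; move: h1 h2 h3 h4; rewrite /M.
set S := \sum_(i < d) _; set a := `|_| => h1 h2 h3 h4.
by rewrite ler_norml; apply/andP; split; lra.
Qed.

End cube.

Lemma continuous_cube (R : realType) (d m : nat) (f : 'rV[R]_d -> 'rV[R]_m) (x : 'rV[R]_d) (eta : R) :
  continuous f -> 0 < eta -> exists2 r : R, 0 < r &
  forall y : 'rV[R]_d, (forall j, x 0 j <= y 0 j <= x 0 j + r) -> forall i, `|f y 0 i - f x 0 i| <= eta.
Proof.
move=> /(_ x) /cvgrPdist_lt /(_ eta) cf eta0; have := cf eta0.
case/nbhs_ballP => r /= r0 hr; exists (r / 2); first by rewrite divr_gt0.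
move=> y xy i; rewrite distrC -row_subE.
apply: (le_trans (coord_le_norm _ _ _)); apply: ltW; apply: hr.
split=> // a j; rewrite ord1 /ball /= ltr_distl; have := xy j; lra.
Qed.

(** Almost everywhere becomes everywhere by continuity: each small cube at x carries a bump of
    positive mass, hence contains a point where the bound holds. *)
Lemma initial_bound (R : realType) (d m : nat) (f : 'rV[R]_d -> 'rV[R]_m) (c : R) :
  continuous f -> (\forall t \ae lebesgue_measure_Rn R d, enorm (f (row_of_tuple t)) <= c) ->
  forall x i, `|f x 0 i| <= c.
Proof.
move=> cf fc x i; apply/ler_addgt0Pr => eta eta0.
have [r r0 hr] := continuous_cube x cf eta0.
have [t tn0 ft] := ae_witness (measurable_cube_bump x r) (cube_bump_ge0 x r)
  (exprn_gt0 d r0) (integral_cube_bump x r0) fc.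
have h : `|f (row_of_tuple t) 0 i - f x 0 i| <= eta.
  by apply: hr => j; rewrite mxE; exact: cube_bump_support tn0.
have := le_trans (coord_le_enorm (f (row_of_tuple t)) i) ft.
have := ler_distD (f (row_of_tuple t) 0 i) (f x 0 i) 0; rewrite !subr0 distrC; lra.
Qed.

Lemma entry_le_enorm (R : realType) (p q : nat) (a : 'M[R]_(p, q)) i j : `|a i j| <= enorm a.
Proof.
rewrite -(@ler_pXn2r _ 2) ?nnegrE ?enorm_ge0 // real_normK ?num_real // sqr_sqrtr; last first.
  by do 2 (apply: sumr_ge0 => ? _); exact: sqr_ge0.
rewrite (bigD1 i) //= (bigD1 j) //= -addrA lerDl addr_ge0 //.
  by apply: sumr_ge0 => ? _; exact: sqr_ge0.
by do 2 (apply: sumr_ge0 => ? _); exact: sqr_ge0.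
Qed.

Section lipschitz.
Context (R : realType) (d m : nat) (f : 'rV[R]_d -> 'rV[R]_m) (g : 'rV[R]_d -> 'M[R]_(d, m)).
Context (c : R) (c0 : 0 <= c) (cf : continuous f) (wg : weak_gradient f g).
Context (gc : \forall t \ae lebesgue_measure_Rn R d, enorm (g (row_of_tuple t)) <= c).

Definition slab_factor (x : 'rV[R]_d) (k : 'I_d) (r s : R) (j : 'I_d) (y : R) : R :=
  if j == k then smooth_step (r^-1 * y + - x 0 j / r) - smooth_step (r^-1 * y + (- x 0 j / r - s / r))
  else step_bump (r^-1 * y + - x 0 j / r).

(* The convolution of [cube_bump] with the segment from [x] to
   [x + s *: basis_vec R k], up to a constant factor. *)
Definition slab (x : 'rV[R]_d) (k : 'I_d) (r s : R) (y : 'rV[R]_d) : R :=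
  \prod_(j < d) slab_factor x k r s j (y 0 j).

Section slab.
Context (x : 'rV[R]_d) (k : 'I_d) (r s : R) (r0 : 0 < r) (s0 : 0 < s).

Lemma smooth_slab_factor j : smooth_class (slab_factor x k r s j).
Proof.
rewrite /slab_factor; case: (j == k) => /=; last exact: (smooth_class_step_bump _ _).2.
have -> : (fun y => smooth_step (r^-1 * y + - x 0 j / r) - smooth_step (r^-1 * y + (- x 0 j / r - s / r)))
  = (fun y => smooth_step (r^-1 * y + - x 0 j / r) + -1 * smooth_step (r^-1 * y + (- x 0 j / r - s / r))).
  by apply/funext => y; rewrite mulN1r.
apply: smooth_add; first exact: (smooth_class_step_bump _ _).1.
by apply: smooth_mul; [exact: smooth_cst|exact: (smooth_class_step_bump _ _).1].
Qed.

Lemma slab_factor_ge0 j y : 0 <= slab_factor x k r s j y.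
Proof.
rewrite /slab_factor; case: ifP => _; last exact: step_bump_ge0.
by have /andP[] := step_difference_itv (- x 0 j / r) y r0 (ltW s0).
Qed.

Lemma slab_factor_support j y :
  slab_factor x k r s j y != 0 -> x 0 j <= y <= x 0 j + (s + r).
Proof.
have E : - (- x 0 j / r) * r = x 0 j by field; rewrite gt_eqF.
rewrite /slab_factor; case: ifP => _; apply: contraNT => h.
  by rewrite step_difference_support ?E // ltW.
rewrite step_bump_support // E; apply: contra h => /andP[h1 h2].
by have h3 := s0; apply/andP; split; lra.
Qed.

Lemma slab_support y : slab x k r s y != 0 ->
  enorm y <= d%:R * (\sum_(j < d) `|x 0 j| + (s + r)) ^+ 2 + 1.
Proof.
move=> /prodf_neq0 h; apply: enorm_box => j.
have := slab_factor_support (h j isT).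
have : `|x 0 j| <= \sum_(i < d) `|x 0 i| by rewrite (bigD1 j) //= lerDl sumr_ge0.
move=> h1 h2; have h3 := ler_norm (x 0 j); have h4 := ler_norm (- x 0 j).
rewrite normrN in h4; move: h1 h2 h3 h4.
set S := \sum_(i < d) _; set a := `|_| => h1 h2 h3 h4.
have h5 := s0; have h6 := r0; by rewrite ler_norml; apply/andP; split; lra.
Qed.

Lemma test_slab : test_function (slab x k r s).
Proof.
split; first exact: smooth_rV_smooth_on (smooth_rV_prod _ smooth_slab_factor).
exists (d%:R * (\sum_(j < d) `|x 0 j| + (s + r)) ^+ 2 + 1) => y.
by move=> h; apply/eqP; apply: contraTT h; rewrite -leNgt; exact: slab_support.
Qed.

(** Differentiating the difference of two steps gives two bumps at distance s, so the weak gradient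
    tested against [slab] compares averages of f over two translated cubes. *)
Lemma derive_slab (t : d.-tuple (measurableTypeR R)) :
  'D_(basis_vec R k) (slab x k r s) (row_of_tuple t) =
  r^-1 * (cube_bump x r t - cube_bump (x + s *: basis_vec R k) r t).
Proof.
have q (b : R) (y : R) : is_derive y 1 (fun y => smooth_step (r^-1 * y + b)) (step_bump (r^-1 * y + b) * r^-1).
  apply: is_derive1_comp; first exact: is_derive_smooth_step.
  by apply: is_derive_eq; rewrite /GRing.scale /=; ring.
have dk (y : R) : is_derive y 1 (slab_factor x k r s k)
    (step_bump (r^-1 * y + - x 0 k / r) * r^-1 - step_bump (r^-1 * y + (- x 0 k / r - s / r)) * r^-1).
  rewrite /slab_factor eqxx; exact: (is_deriveB (q _ y) (q _ y)).
have cb (z : 'rV[R]_d) : cube_bump z r t = step_bump (r^-1 * tnth t k + - z 0 k / r) *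
    \prod_(j < d | j != k) step_bump (r^-1 * tnth t j + - z 0 j / r).
  by rewrite /cube_bump (bigD1 k).
rewrite (derive_prod _ smooth_slab_factor dk) !cb.
rewrite [row_of_tuple t 0 k]mxE.
have -> : \prod_(j < d | j != k) slab_factor x k r s j (row_of_tuple t 0 j) =
    \prod_(j < d | j != k) step_bump (r^-1 * tnth t j + - x 0 j / r).
  by apply: eq_bigr => j jk; rewrite /slab_factor (negbTE jk) mxE.
have -> : \prod_(j < d | j != k) step_bump (r^-1 * tnth t j + - (x + s *: basis_vec R k) 0 j / r) =
    \prod_(j < d | j != k) step_bump (r^-1 * tnth t j + - x 0 j / r).
  by apply: eq_bigr => j jk; rewrite !mxE (negbTE jk) andbF mulr0 addr0.
have -> : - (x + s *: basis_vec R k) 0 k / r = - x 0 k / r - s / r.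
  by rewrite !mxE !eqxx mulr1 opprD mulrDl mulNr mulNr.
ring.
Qed.

Lemma slab_bounded : exists M : R, forall y, `|slab x k r s y| <= M.
Proof.
have [M MP] := step_bump_bounded R; exists ((M + 1) ^+ d) => y.
rewrite ger0_norm; last by apply: prodr_ge0 => j _; exact: slab_factor_ge0.
have -> : (M + 1) ^+ d = \prod_(j < d) (M + 1) by rewrite prodr_const card_ord.
have M0 : 0 <= M by apply: le_trans (MP 0); exact: step_bump_ge0.
apply: ler_prod => j _; rewrite slab_factor_ge0 /= /slab_factor; case: ifP => _.
  by have /andP[_ h] := step_difference_itv (- x 0 j / r) (y 0 j) r0 (ltW s0); lra.
by have := MP (r^-1 * y 0 j + - x 0 j / r); lra.
Qed.

Lemma measurable_slab :
  measurable_fun [set: d.-tuple (measurableTypeR R)] (fun t => slab x k r s (row_of_tuple t)).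
Proof.
rewrite /slab; under eq_fun do under eq_bigr do rewrite mxE.
by apply: measurable_coord_prod => j; exact: smooth_class_measurable (smooth_slab_factor j).
Qed.

Lemma integral_slab : exists2 I : R, 0 <= I <= s + r &
  (\int[lebesgue_measure_Rn R d]_t (slab x k r s (row_of_tuple t))%:E =
  (I * \prod_(j < d | j != k) r)%:E)%E.
Proof.
have [I I0 IE] := integral_step_difference (- x 0 k / r) r0 (ltW s0).
exists I => //.
have -> : I * \prod_(j < d | j != k) r = \prod_(j < d) (if j == k then I else r).
  rewrite [RHS](bigD1 k) //= eqxx; congr (_ * _).
  by apply: eq_bigr => j /negbTE ->.
rewrite -(@integral_coord_prod R d (slab_factor x k r s) (fun j => if j == k then I else r)).
- by apply: eq_integral => t _; congr EFin; apply: eq_bigr => j _; rewrite mxE.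
- exact: slab_factor_ge0.
- by move=> j; exact: smooth_class_measurable (smooth_slab_factor j).
- move=> j; rewrite /slab_factor; case: ifP => [/eqP ->|_] //; exact: integral_step_bump.
Qed.

End slab.

(** The averages of f over the cubes at x and x' are within eta of f x and f x'. Their difference is
    the integral of the weak gradient against [slab] up to the factor r, at most c (s + r) r^d
    before division by the mass r^d. *)
Lemma initial_lipschitz_pos (x : 'rV[R]_d) (k : 'I_d) (s : R) (i : 'I_m) : 0 < s ->
  `|f (x + s *: basis_vec R k) 0 i - f x 0 i| <= c * s.
Proof.
move=> s0; apply/ler_addgt0Pr => e e0; set x' := x + s *: basis_vec R k.
have c2 : 0 < c + 2 by rewrite ltr_wpDl.
(* The total error is c r + 2 eta, and r <= eta makes it at most (c + 2) eta = e. *)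
pose eta := e / (c + 2); have eta0 : 0 < eta by rewrite divr_gt0.
have [r1 r10 hr1] := continuous_cube x cf eta0.
have [r2 r20 hr2] := continuous_cube x' cf eta0.
pose r := Num.min eta (Num.min r1 r2).
have r0 : 0 < r by rewrite !lt_min eta0 r10.
have reta : r <= eta by rewrite ge_min lexx.
have rr1 : r <= r1 by rewrite /r !ge_min lexx orbT.
have rr2 : r <= r2 by rewrite /r !ge_min lexx !orbT.
have [lf lg wk] := wg.
pose Q : R := \prod_(j < d | j != k) r.
have Q0 : 0 < Q by apply: prodr_gt0.
have rQ : r ^+ d = r * Q by rewrite /Q -[d in r ^+ d]card_ord -prodr_const (bigD1 k).
have i1 := integrable_cube_bump x r0 (lf i).
have i2 := integrable_cube_bump x' r0 (lf i).
have near1 t : cube_bump x r t != 0 -> `|f (row_of_tuple t) 0 i - f x 0 i| <= eta.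
  move=> tn0; apply: hr1 => j; have /andP[h1 h2] := cube_bump_support r0 j tn0.
  by rewrite [row_of_tuple _ _ _]mxE h1 (le_trans h2) // lerD2l.
have near2 t : cube_bump x' r t != 0 -> `|f (row_of_tuple t) 0 i - f x' 0 i| <= eta.
  move=> tn0; apply: hr2 => j; have /andP[h1 h2] := cube_bump_support r0 j tn0.
  by rewrite [row_of_tuple _ _ _]mxE h1 (le_trans h2) // lerD2l.
have {near1}b1 := bump_average_near (measurable_cube_bump x r) (cube_bump_ge0 x r)
  (integral_cube_bump x r0) i1 near1.
have {near2}b2 := bump_average_near (measurable_cube_bump x' r) (cube_bump_ge0 x' r)
  (integral_cube_bump x' r0) i2 near2.
set A1 := Rintegral _ _ _ in b1; set A2 := Rintegral _ _ _ in b2.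
have wE := wk _ k i (test_slab x k r0 s0).
have DE : Rintegral (lebesgue_measure_Rn R d) setT (fun t => f (row_of_tuple t) 0 i *
    'D_(basis_vec R k) (slab x k r s) (row_of_tuple t)) = r^-1 * (A1 - A2).
  rewrite /A1 /A2 -RintegralB // -RintegralZl //; last first.
    by have := integrableB measurableT i1 i2; apply: eq_integrable.
  by apply: eq_Rintegral => t _; rewrite derive_slab // -/x'; ring.
rewrite DE in wE.
have [B BP] := slab_bounded x k r0 s0.
have [I /andP[I0 Isr] IE] := integral_slab x k r0 s0.
have ig : (lebesgue_measure_Rn R d).-integrable [set: d.-tuple (measurableTypeR R)]
    (EFin \o (fun t => g (row_of_tuple t) k i * slab x k r s (row_of_tuple t))).
  apply: (integrable_cutoff (measurable_ball_tuple _) (lg k i _) (measurable_slab x k r s)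
    (fun t => BP (row_of_tuple t))) => t; apply: contra_notP => /eqP.
  exact: slab_support.
have gk : \forall t \ae lebesgue_measure_Rn R d, `|g (row_of_tuple t) k i| <= c.
  by apply: filterS gc => t; apply: le_trans; exact: entry_le_enorm.
have slab0 t : 0 <= slab x k r s (row_of_tuple t).
  by apply: prodr_ge0 => j _; exact: slab_factor_ge0.
have b3 := ae_bound_Rintegral (measurable_slab x k r s) slab0 c0 IE ig gk.
(* Turns the bound on the integral of the weak gradient into |A1 - A2| <= r (c I Q), where r Q is
   the mass of a cube bump. *)
rewrite -normrN -wE -/Q normrM gtr0_norm ?invr_gt0 // ler_pdivrMl // in b3.
rewrite rQ in b1 b2.
have rQ0 : 0 < r * Q by rewrite mulr_gt0.
have h : `|f x' 0 i - f x 0 i| * (r * Q) <= (c * (s + r) + 2 * eta) * (r * Q).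
  have -> : `|f x' 0 i - f x 0 i| * (r * Q) = `|(f x' 0 i - f x 0 i) * (r * Q)|.
    by rewrite normrM (gtr0_norm rQ0).
  have -> : (f x' 0 i - f x 0 i) * (r * Q) =
    (A1 - f x 0 i * (r * Q)) - (A2 - f x' 0 i * (r * Q)) - (A1 - A2) by ring.
  apply: (le_trans (ler_normB _ _)); apply: (le_trans (lerD (ler_normB _ _) b3)).
  apply: (le_trans (lerD (lerD b1 b2) (lexx _))).
  have : c * I <= c * (s + r) by rewrite ler_wpM2l.
  move=> /(ler_wpM2r (ltW rQ0)) h1.
  have -> : (c * (s + r) + 2 * eta) * (r * Q) =
    eta * (r * Q) + eta * (r * Q) + c * (s + r) * (r * Q) by ring.
  rewrite lerD2l; apply: le_trans h1; rewrite le_eqVlt; apply/orP; left; apply/eqP; ring.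
rewrite ler_pM2r // in h; apply: (le_trans h).
have : (c + 2) * eta = e by rewrite /eta mulrC divfK // gt_eqF.
have : c * r <= c * eta by rewrite ler_wpM2l.
rewrite mulrDr mulrDl; lra.
Qed.

Lemma initial_lipschitz (x : 'rV[R]_d) (k : 'I_d) (s : R) (i : 'I_m) :
  `|f (x + s *: basis_vec R k) 0 i - f x 0 i| <= c * `|s|.
Proof.
have [s0|s0|<-] := ltgtP 0 s.
- by rewrite (gtr0_norm s0); exact: initial_lipschitz_pos.
- have ns : 0 < - s by rewrite oppr_gt0.
  have := initial_lipschitz_pos (x + s *: basis_vec R k) k i ns.
  by rewrite -addrA -scalerDl subrr scale0r addr0 distrC (ltr0_norm s0).
- by rewrite scale0r addr0 subrr normr0 mulr0.
Qed.

End lipschitz.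

(** * Assembly of the estimates *)

Lemma continuous_initial (R : realType) (d m : nat) (N : set 'rV[R]_m) (pr : 'rV[R]_m -> 'rV[R]_m)
    (u0 : 'rV[R]_d -> 'rV[R]_m) (u : 'rV[R]_d -> R -> 'rV[R]_m) :
  harmonic_map_heat_flow N pr u0 u -> continuous u0.
Proof.
move=> [[_ ui cu _] _] x.
have -> : u0 = (fun y => u y (Num.max 0 0)) by apply/funext => y; rewrite maxxx ui.
have pairc : (fun y : 'rV[R]_d => (y, (0 : R))) @ x --> (x, (0 : R)).
  exact: (@cvg_pair _ _ _ (nbhs x) (nbhs x) (nbhs (0 : R)) _ _ _ id (cst 0) cvg_id (cvg_cst _)).
exact: (cvg_comp _ _ pairc (@continuous_time_max _ _ _ _ cu (x, 0))).
Qed.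

Lemma dot_box (R : realType) (m : nat) (v : 'rV[R]_m) (r : R) : 0 <= r ->
  (forall j, `|v 0 j| <= r) -> dot v v <= ((m%:R + 1) * r) ^+ 2.
Proof.
move=> r0 vr; apply: (@le_trans _ _ (\sum_(j < m) r ^+ 2)).
  apply: ler_sum => j _; rewrite -expr2 -(real_normK (num_real (v 0 j))).
  by rewrite ler_pXn2r ?nnegrE.
rewrite sumr_const card_ord -(mulr_natl (r ^+ 2)) exprMn ler_wpM2r ?sqr_ge0 //.
have : 0 <= m%:R :> R by []. nra.
Qed.

(** In e, the factor 2 comes from the infimum in the Sobolev norm and m + 1 from passing from
    coordinates to the Euclidean norm. The same e serves as sup bound and as Lipschitz constant L,
    so 2 L^2 + e^2 = 3 e^2 in each of the d directions. *)
Lemma flow_estimate (R : realType) (d m : nat) (N : set 'rV[R]_m) (delta : R)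
    (pr : 'rV[R]_m -> 'rV[R]_m) (u0 : 'rV[R]_d -> 'rV[R]_m) (u : 'rV[R]_d -> R -> 'rV[R]_m)
    (P : 'rV[R]_m) (eps : R) :
  0 < delta -> nearest_point_projection N delta pr -> harmonic_map_heat_flow N pr u0 u -> N P ->
  0 < eps -> (W1infty_norm (fun x => (u0 x - P)%R) <= eps%:E)%E ->
  let e := 2 * (m%:R + 1) * eps in
  e <= delta / (2 * (m%:R + 1)) -> e <= delta / 8 ->
  forall x t, 0 <= t -> enorm (u x t - P) <= e /\
    (1 + t) * energy u x t <= 3 * d%:R * expR 1 * e ^+ 2.
Proof.
move=> d0 np hu NP eps0 W e ed ed8.
have e0 : 0 <= e by rewrite /e !mulr_ge0 ?addr_ge0 // ltW.
have cu0 : continuous (fun x => u0 x - P).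
  move=> y; exact: (cvgB (@continuous_initial _ _ _ _ _ _ _ hu y) (cvg_cst P)).
have [g [wg fe ge]] := W1infty_weak_gradient eps0 W.
have e20 : 0 <= 2 * eps by lra.
have eE : e = (m%:R + 1) * (2 * eps) by rewrite /e; ring.
have ue x : dot (u0 x - P) (u0 x - P) <= e ^+ 2.
  rewrite eE; apply: dot_box => // j; exact: initial_bound cu0 fe x j.
have uL (k : 'I_d) (x : 'rV[R]_d) (s : R) : dot (u0 (x + s *: basis_vec R k) - u0 x)
    (u0 (x + s *: basis_vec R k) - u0 x) <= (e * s) ^+ 2.
  have -> : (e * s) ^+ 2 = ((m%:R + 1) * (2 * eps * `|s|)) ^+ 2.
    by rewrite eE !exprMn real_normK ?num_real //; ring.
  apply: dot_box => [|j]; first by rewrite mulr_ge0.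
  have := initial_lipschitz e20 cu0 wg ge x k s j.
  by rewrite -row_subE; congr (`|_| <= _); congr (_ _ _); rewrite opprB addrA subrK.
have E1 : 1 <= expR 1 :> R by rewrite -[leLHS]expR0 ler_expR.
move=> x t t0; split.
  rewrite -(@ler_pXn2r _ 2) ?nnegrE ?enorm_ge0 // sqr_enorm.
  exact: (flow_close d0 np hu NP e0 ue ed).
have key k : (1 + t) * dot (partial k (u ^~ t) x) (partial k (u ^~ t) x) <= 3 * expR 1 * e ^+ 2.
  move: t0; rewrite le_eqVlt => /orP[/eqP <-|tp].
    rewrite addr0 mul1r; apply: (le_trans (gradient_initial hu uL k x)).
    by rewrite ler_peMl ?sqr_ge0 //; lra.
  apply: (le_trans (gradient_decay d0 np hu NP e0 ue ed ed8 uL k x tp)).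
  by rewrite le_eqVlt; apply/orP; left; apply/eqP; ring.
rewrite /energy mulr_sumr; apply: (le_trans (ler_sum _ (fun k _ => key k))).
by rewrite sumr_const card_ord -(mulr_natl (3 * expR 1 * e ^+ 2)) le_eqVlt; apply/orP; left; apply/eqP; ring.
Qed.

Theorem theorem2p9 (R : realType) (d m n : nat) (N : set 'rV[R]_m)
    (delta : R) (pr : 'rV[R]_m -> 'rV[R]_m)
    (hN : smooth_submanifold n N)
    (hdelta : 0 < delta)
    (hpr : nearest_point_projection N delta pr) :
  forall C : R, 0 < C ->
  exists b eps0 : R, [/\ 0 < b, 0 < eps0 &
    forall eps : R, 0 < eps < eps0 ->
    forall (P : 'rV[R]_m) (u0 : 'rV[R]_d -> 'rV[R]_m)
      (u : 'rV[R]_d -> R -> 'rV[R]_m),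
    N P ->
    harmonic_map_heat_flow N pr u0 u ->
    (W1infty_norm (fun x => (u0 x - P)%R) <= eps%:E)%E ->
    (ereal_sup [set C0norm (fun x => (u x t - P)%R)
                | t in `[0%R, (expR (b / eps) - 1)%R]]
     + ereal_sup [set ((1 + t) `^ 2^-1)%:E * C0norm (grad (u ^~ t))
                  | t in `[0%R, (expR (b / eps) - 1)%R]] <= C%:E)%E].
Proof.
move=> C C0; pose A : R := 3 * d%:R * expR 1.
have A0 : 0 <= A by rewrite !mulr_ge0 ?expR_ge0.
have m1 : 0 < m%:R + 1 :> R by rewrite ltr_wpDl.
(* The first two bounds are the smallness conditions of [flow_estimate]; the third makes each of the
   two suprema at most C / 2. *)
pose r : R := Num.min (delta / (2 * (m%:R + 1))) (Num.min (delta / 8) (C / (2 * (A + 1)))).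
have r0 : 0 < r.
  by rewrite !lt_min !divr_gt0 //= mulr_gt0 // ltr_wpDl.
have [r1 r2 r3] : [/\ r <= delta / (2 * (m%:R + 1)), r <= delta / 8 & r <= C / (2 * (A + 1))].
  by split; rewrite /r !ge_min lexx ?orbT.
(* The estimates hold for every t >= 0, so b = 1 will do; eps0 is chosen so that e <= r. *)
exists 1, (r / (2 * (m%:R + 1))); split => //; first by rewrite divr_gt0 // mulr_gt0.
move=> eps /andP[eps0 epsr] P u0 u NP hu W.
set e := 2 * (m%:R + 1) * eps.
have er : e <= r by rewrite /e mulrC -ler_pdivlMr ?mulr_gt0 // ltW.
have e0 : 0 <= e by rewrite !mulr_ge0 // ltW.
have est := flow_estimate hdelta hpr hu NP eps0 W (le_trans er r1) (le_trans er r2).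
have A1 : 0 < A + 1 by rewrite ltr_wpDl.
have eC : (A + 1) * e <= C / 2.
  have := le_trans er r3; rewrite ler_pdivlMr ?mulr_gt0 // => h.
  by rewrite ler_pdivlMr //; apply: le_trans h; rewrite le_eqVlt; apply/orP; left; apply/eqP; ring.
have eC2 : e <= C / 2 by apply: le_trans eC; rewrite ler_peMl // lerDr.
have -> : C%:E = ((C / 2)%:E + (C / 2)%:E)%E by rewrite -EFinD -splitr.
apply: leeD; apply: ge_ereal_sup => _ [t tI <-].
  apply: ge_ereal_sup => _ [x _ <-]; rewrite lee_fin; apply: le_trans eC2.
  by have [] := est x t; move: tI; rewrite /= in_itv /= => /andP[].
have t0 : 0 <= t by move: tI; rewrite /= in_itv /= => /andP[].
have t1 : 0 <= 1 + t by rewrite addr_ge0.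
have s0 : 0 < Num.sqrt (1 + t) by rewrite sqrtr_gt0 ltr_pwDl.
rewrite powR12_sqrt //.
have -> : (C / 2)%:E = ((Num.sqrt (1 + t))%:E * (C / 2 / Num.sqrt (1 + t))%:E)%E.
  by rewrite -EFinM (mulrC (Num.sqrt _)) divfK // gt_eqF.
apply: lee_wpmul2l; first by rewrite lee_fin ltW.
apply: ge_ereal_sup => _ [x _ <-]; rewrite lee_fin ler_pdivlMr //.
rewrite -(@ler_pXn2r _ 2) ?nnegrE ?mulr_ge0 ?enorm_ge0 ?divr_ge0 ?sqrtr_ge0 ?(ltW C0) //.
rewrite exprMn sqr_enorm_grad sqr_sqrtr // mulrC.
have [_ h] := est x t t0; apply: (le_trans h).
(* A <= (A + 1)^2 replaces the square root of A. *)
apply: (@le_trans _ _ (((A + 1) * e) ^+ 2)).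
  rewrite (exprMn _ (A + 1) e); apply: ler_wpM2r; first exact: sqr_ge0.
  by rewrite -/A; nra.
apply: lerXn2r => //; rewrite nnegrE; first exact: (mulr_ge0 (ltW A1) e0).
by rewrite divr_ge0 ?(ltW C0).
Qed.
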